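(* Let $\pi(\theta)=p(\theta|s_{\rm obs})$ be the posterior density on $\Theta$, let $g_{\rm IS}$ be an importance density on $\Theta$, and let $\widehat p(s_{\rm obs}|\theta,u)$, $u\sim p(\cdot|\theta)$, be the debiased unbiased estimator of the likelihood $p(s_{\rm obs}|\theta)$ described in the context. Let $\varphi:\Theta\to\mathbb{R}$ be a function and write $\mathbb{E}_\pi(\varphi)=\int_\Theta\varphi(\theta)\pi(\theta)\,d\theta$. Let $(\theta_i,u_i)$, $i=1,2,\dots$, be independent and identically distributed with $\theta_i\sim g_{\rm IS}(\cdot)$ and $u_i\,|\,\theta_i\sim p(\cdot|\theta_i)$, and put $$\widehat w(\theta_i,u_i):=\frac{\widehat p(s_{\rm obs}|\theta_i,u_i)\,p(\theta_i)}{g_{\rm IS}(\theta_i)},\qquad \widehat{\mathbb{E}_\pi(\varphi)}:=\frac{\frac1M\sum_{i=1}^M\varphi(\theta_i)\widehat w(\theta_i,u_i)}{\frac1M\sum_{i=1}^M\widehat w(\theta_i,u_i)},\qquad \xi(\theta,u):=\frac{\widehat p(s_{\rm obs}|\theta,u)}{p(s_{\rm obs}|\theta)}.$$ Suppose that $\mathrm{Sup}(\pi)\subseteq\mathrm{Sup}(g_{\rm IS})$, where $\mathrm{Sup}$ means support. (i) If $\mathbb{E}_\pi(|\varphi(\theta)|)<\infty$, then $\widehat{\mathbb{E}_\pi(\varphi)}\to\mathbb{E}_\pi(\varphi)$ almost surely as $M\to\infty$. (ii) If $$\mathbb{E}_{g_{\rm IS}}\left(\frac{\mathbb{E}_{u\sim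 p(\cdot|\theta)}(\xi^2(\theta,u))\,\varphi(\theta)^2\pi(\theta)^2}{g_{\rm IS}^2(\theta)}\right)<\infty,$$ then $\sqrt M\left(\widehat{\mathbb{E}_\pi(\varphi)}-\mathbb{E}_\pi(\varphi)\right)\to\mathcal{N}(0,\sigma_\varphi^2)$ in distribution as $M\to\infty$, where $$\sigma_\varphi^2:=\mathbb{E}_{g_{\rm IS}}\left(\frac{\pi^2(\theta)}{g_{\rm IS}^2(\theta)}\,(\varphi(\theta)-\mathbb{E}_\pi(\varphi))^2\,\mathbb{E}_{u\sim p(\cdot|\theta)}(\xi^2(\theta,u))\right).$$ If $p(s_{\rm obs}|\theta)$ can be evaluated, so that $\xi=1$, then $\sigma_\varphi^2=\mathbb{E}_{g_{\rm IS}}\left(\frac{\pi^2(\theta)}{g_{\rm IS}^2(\theta)}(\varphi(\theta)-\mathbb{E}_\pi(\varphi))^2\right)$ is the (asymptotic) variance of the noiseless importance sampler, i.e. the one using $p(s_{\rm obs}|\theta_i)$ in place of $\widehat p(s_{\rm obs}|\theta_i,u_i)$. (iii) $\widehat{\sigma_\varphi^2}$ is a consistent estimator of $\sigma_\varphi^2$, where $$\widehat{\sigma_\varphi^2}:=\frac{1}{M\,\widehat p(s_{\rm obs})^2}\sum_{i=1}^M\big(\varphi(\theta_i)-\widehat{\mathbb{E}_\pi(\varphi)}\big)^2\,\widehat w^2(\theta_i,u_i),\qquad \widehat p(s_{\rm obs}):=\frac1M\sum_{i=1}^M\widehat w(\theta_i,u_i).$$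
   Context: Setting. $\theta\in\Theta$ is a parameter vector with prior density $p(\theta)$; $p(s|\theta)$ is the density on $\mathbb{R}^d$ of a summary statistic given $\theta$; $s_{\rm obs}\in\mathbb{R}^d$ is its fixed observed value. The marginal likelihood is $p(s_{\rm obs})=\int_\Theta p(s_{\rm obs}|\theta)p(\theta)\,d\theta\in(0,\infty)$ and the posterior is $\pi(\theta)=p(\theta|s_{\rm obs})=p(s_{\rm obs}|\theta)p(\theta)/p(s_{\rm obs})$. $\mathbb{E}_{g_{\rm IS}}$ denotes expectation over $\theta\sim g_{\rm IS}$. Consistency of an estimator is understood as $M\to\infty$. Likelihood estimator. Let $K$ be a $d$-variate kernel density ($K\ge0$, $\int K=1$) with $\int xK(x)\,dx=0$ and $\int x'xK(x)\,dx$, $\int K^2(x)\,dx$, $\int x'xK^2(x)\,dx$ all finite, and let $K_\epsilon(u)=\epsilon^{-d}K(u/\epsilon)$. Let $\epsilon_k\downarrow0$ be positive numbers and $n_k\uparrow\infty$ positive integers. For each $k\ge0$ let $\zeta_k=\frac1{n_k}\sum_{i=1}^{n_k}K_{\epsilon_k}(s_i^k-s_{\rm obs})$, where $s_1^k,\dots,s_{n_k}^k$ are independent draws from $p(\cdot|\theta)$ (samples may be shared across different $k$). Let $T$ be a non-negative integer-valued random variable independent of the $\zeta_k$, with $P(T\ge k)>0$ for all $k\ge 0$, and let $\varpi_k=1/P(T\ge k)$. Assume $p(s|\theta)$ is twice differentiable in $s$ for every $\theta$ and $\sum_{k\ge1}\varpi_k\big(\epsilon_{k-1}^4+\frac1{n_{k-1}\epsilon_{k-1}^d}\big)<\infty$.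 The debiased estimator is $\zeta_0+\sum_{k=1}^T\varpi_k(\zeta_k-\zeta_{k-1})$ (or an average of finitely many independent replications of it). It is written $\widehat p(s_{\rm obs}|\theta,u)$, where $u\in\mathcal{U}$ collects all the random numbers used to generate $T$ and $\zeta_0,\dots,\zeta_T$; the density of $u$ is denoted $p(u|\theta,s_{\rm obs})$, abbreviated $p(u|\theta)$. It is unbiased: $\mathbb{E}_{u\sim p(\cdot|\theta)}\big(\widehat p(s_{\rm obs}|\theta,u)\big)=p(s_{\rm obs}|\theta)$ for every $\theta$, so that $\mathbb{E}_{u\sim p(\cdot|\theta)}(\xi(\theta,u))=1$. The estimator $\widehat p(s_{\rm obs}|\theta,u)$ may take negative values.
   Formalization: Added: p(s_obs|θ)>0 where p(θ)>0 and g_IS(θ)>0 (so ξ is defined); E_π(E_u|ξ|)<∞; in (i) also E_π(|φ|E_u|ξ|)<∞ (automatic if p̂≥0; (i) is false without it); finite σ²_φ in (ii), (iii) and the noiseless case. Support means {f≠0}; consistency is in probability. *)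

(* Defs.v *)
From HB Require Import structures.
From mathcomp Require Import all_boot all_order all_algebra.
From mathcomp Require Import all_classical all_reals all_analysis.

Set Implicit Arguments.
Unset Strict Implicit.
Unset Printing Implicit Defensive.

Import Order.TTheory GRing.Theory Num.Theory.
Import numFieldNormedType.Exports.

Local Open Scope classical_set_scope.
Local Open Scope ring_scope.

(* R^d is [d.-tuple R], which carries the product sigma-algebra of the
   coordinates. The library has Lebesgue measure on R only; on R^d it is
   obtained by iterating the product with the Lebesgue measure of R. *)
Section lebesgue_tuple.
Context {R : realType}.

Definition cons_pair n (p : R * n.-tuple R) : n.+1.-tuple R :=
  [tuple of p.1 :: p.2].

Lemma measurable_cons_pair n : measurable_fun setT (@cons_pair n).
Proof. exact: measurable_cons. Qed.

Section step.
Variables (n : nat) (m : {sigma_finite_measure set (n.-tuple R) -> \bar R}).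

Definition lebesgue_cons : set (n.+1.-tuple R) -> \bar R :=
  pushforward (lebesgue_measure \x m)%E (@cons_pair n).

Let mc := @measurable_cons_pair n.

Let lebesgue_cons0 : lebesgue_cons set0 = 0%E.
Proof. by rewrite /lebesgue_cons /pushforward preimage_set0 measure0. Qed.

Let lebesgue_cons_ge0 A : (0 <= lebesgue_cons A)%E.
Proof. exact: measure_ge0. Qed.

Let lebesgue_cons_sigma_additive : semi_sigma_additive lebesgue_cons.
Proof.
move=> F mF tF mUF; rewrite /lebesgue_cons /pushforward preimage_bigcup.
apply: measure_semi_sigma_additive.
- by move=> i; rewrite -[X in measurable X]setTI; exact: mc.
- apply/trivIsetP => /= i j _ _ ij; rewrite -preimage_setI.
  by move/trivIsetP : tF => /(_ _ _ _ _ ij) ->//; rewrite preimage_set0.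
- by rewrite -preimage_bigcup -[X in measurable X]setTI; exact: mc.
Qed.

HB.instance Definition _ := isMeasure.Build _ _ _ lebesgue_cons
  lebesgue_cons0 lebesgue_cons_ge0 lebesgue_cons_sigma_additive.

Let lebesgue_cons_sigma_finite : sigma_finite setT lebesgue_cons.
Proof.
have /sigma_finiteP[F [FT Fnd Ffin]] := sigma_finiteT (@lebesgue_measure R).
have /sigma_finiteP[G [GT Gnd Gfin]] := sigma_finiteT m.
pose uncons (t : n.+1.-tuple R) : R * n.-tuple R :=
  (tnth t ord0, [tuple of behead t]).
have muncons : measurable_fun setT uncons.
  by apply/measurable_fun_pair; [exact: measurable_tnth|
    exact: measurable_behead].
have consK p : uncons (cons_pair p) = p.
  by case: p => x t; rewrite /uncons /cons_pair (tnth_nth x)/=; congr pair;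
    exact/val_inj.
exists (fun i => uncons @^-1` (F i `*` G i)).
  apply/esym; rewrite -subTset => t _.
  have [i _ Fi] : (\bigcup_i F i) (uncons t).1 by rewrite -FT.
  have [j _ Gj] : (\bigcup_i G i) (uncons t).2 by rewrite -GT.
  exists (maxn i j) => //; split.
  - by move: Fi; exact/subsetPset/Fnd/leq_maxl.
  - by move: Gj; exact/subsetPset/Gnd/leq_maxr.
move=> i; have [mF Foo] := Ffin i; have [mG Goo] := Gfin i.
split; first by rewrite -[X in measurable X]setTI; apply: muncons => //;
  exact: measurableX.
rewrite /lebesgue_cons /pushforward -comp_preimage.
rewrite (_ : uncons \o @cons_pair n = id); last exact/funext.
by rewrite preimage_id product_measure1E// lte_mul_pinfty// ge0_fin_numE.
Qed.

HB.instance Definition _ := Measure_isSigmaFinite.Build _ _ _ lebesgue_cons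
  lebesgue_cons_sigma_finite.

End step.

Fixpoint lebesgue_tuple (d : nat) :
    {sigma_finite_measure set (d.-tuple R) -> \bar R} :=
  match d with
  | 0 => \d_([tuple] : 0.-tuple R)
  | n.+1 => lebesgue_cons (lebesgue_tuple n)
  end.

End lebesgue_tuple.

Section probability_notions.
Context {R : realType}.

Definition density d (T : measurableType d) (mu : set T -> \bar R)
    (f : T -> R) : Prop :=
  [/\ measurable_fun setT f, forall x, 0 <= f x & (\int[mu]_x (f x)%:E = 1)%E].

Definition sigma_of d d' (T : measurableType d) (T' : measurableType d')
    (X : T -> T') : set (set T) :=
  preimage_set_system setT X measurable.

Definition mutually_independent d (T : measurableType d)
    (P : set T -> \bar R) (I : eqType) (F : I -> set (set T)) : Prop :=
  forall (s : seq I) (A : I -> set T), uniq s ->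
    (forall i, i \in s -> F i (A i)) ->
    P (\bigcap_(i in [set` s]) A i) = (\prod_(i <- s) fine (P (A i)))%:E.

Definition supp (T : Type) (f : T -> R) : set T := [set x | f x != 0].

Section modes_of_convergence.
Context d (T : measurableType d) (P : set T -> \bar R).

Definition converges_in_probability (X : nat -> T -> R) (c : R) : Prop :=
  forall e : R, 0 < e -> P [set w | e <= `|X M w - c|] @[M --> \oo] --> 0%E.

Definition converges_in_distribution (X : nat -> T -> R)
    (nu : set R -> \bar R) : Prop :=
  forall x : R, {for x, continuous (fun y : R => nu `]-oo, y]%classic)} ->
    P [set w | X M w <= x] @[M --> \oo] --> nu `]-oo, x]%classic.

End modes_of_convergence.

(* N(0, v), given by its variance. The case v = 0 is separate because
   [normal_prob m 0] is the uniform distribution on [0, 1]. *)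
Definition centered_normal (v : R) : set R -> \bar R :=
  if v == 0 then \d_(0 : R) else normal_prob 0 (Num.sqrt v).

End probability_notions.

Section debiased_estimator.
Context {R : realType} {d : nat}.

Definition vec_sub (s t : d.-tuple R) : d.-tuple R :=
  [tuple tnth s i - tnth t i | i < d].

Definition sq_norm (x : d.-tuple R) : R := \sum_(i < d) tnth x i ^+ 2.

Definition scaled_kernel (K : d.-tuple R -> R) (e : R) (u : d.-tuple R) : R :=
  e ^- d * K [tuple tnth u i / e | i < d].

Definition kernel_density (K : d.-tuple R -> R) : Prop :=
  let leb := lebesgue_tuple d in
  [/\ density leb K,
      forall i, leb.-integrable setT (fun x => (tnth x i * K x)%:E) /\
        (\int[leb]_x (tnth x i * K x)%:E = 0)%E,
      (\int[leb]_x (sq_norm x * K x)%:E < +oo)%E,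
      (\int[leb]_x (K x ^+ 2)%:E < +oo)%E &
      (\int[leb]_x (sq_norm x * K x ^+ 2)%:E < +oo)%E].

(* Second-order differentiability asks every y |-> 'd f y v to be
   differentiable, which in finite dimension is differentiability of
   y |-> 'd f y; tuples carry no norm, hence the passage to row vectors. *)
Definition twice_differentiable (p : d.-tuple R -> R) : Prop :=
  let f : 'rV[R]_d -> R^o := fun x => p [tuple x ord0 i | i < d] in
  (forall x, differentiable f x) /\
  (forall x v : 'rV[R]_d,
     differentiable (fun y : 'rV[R]_d => 'd f y v : R^o) x).

Record design := Design {
  kern : d.-tuple R -> R ;
  bandwidth : nat -> R ;
  nsim : nat -> nat ;
  truncation : probability nat R ;
  nrep : nat }.

Implicit Type D : design.

Definition tail D (k : nat) : \bar R :=
  truncation D [set j : nat | (k <= j)%N].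

Definition varpi D (k : nat) : R := (fine (tail D k))^-1.

Definition admissible D : Prop :=
  [/\ kernel_density (kern D),
      [/\ forall k, 0 < bandwidth D k,
          {homo bandwidth D : j k / (j <= k)%N >-> k <= j} &
          bandwidth D k @[k --> \oo] --> (0 : R)],
      [/\ forall k, (0 < nsim D k)%N,
          {homo nsim D : j k / (j <= k)%N} &
          nsim D k @[k --> \oo] --> \oo],
      (forall k, (0 < tail D k)%E) /\
      (\sum_(1 <= k <oo) (varpi D k * (bandwidth D k.-1 ^+ 4 +
         ((nsim D k.-1)%:R * bandwidth D k.-1 ^+ d)^-1))%:E < +oo)%E &
      (0 < nrep D)%N].

Definition zeta D (sobs : d.-tuple R) (s : nat -> nat -> d.-tuple R)
    (k : nat) : R :=
  (nsim D k)%:R^-1 * \sum_(i < nsim D k)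
    scaled_kernel (kern D) (bandwidth D k) (vec_sub (s k i) sobs).

Definition debiased D (z : nat -> R) (t : nat) : R :=
  z 0%N + \sum_(1 <= k < t.+1) varpi D k * (z k - z k.-1).

Context {dU : measure_display} {U : measurableType dU}.

(* One replication of the random numbers, under the law Q of u: [S k i] is
   s_i^k, with density p. Nothing is assumed across different k. *)
Definition simulation D sobs (Q : set U -> \bar R) (p : d.-tuple R -> R)
    (S : nat -> nat -> U -> d.-tuple R) (T : U -> nat) : Prop :=
  let z k u := zeta D sobs (fun k i => S k i u) k in
  [/\ forall k i, (i < nsim D k)%N -> forall A, measurable A ->
        Q (S k i @^-1` A) = (\int[lebesgue_tuple d]_(s in A) (p s)%:E)%E,
      forall k, mutually_independent Q
        (fun i : 'I_(nsim D k) => sigma_of (S k i)),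
      forall A : set nat, Q (T @^-1` A) = truncation D A &
      forall (A : set nat) (B : set U), <<s \bigcup_k sigma_of (z k) >> B ->
        Q (T @^-1` A `&` B) = (Q (T @^-1` A) * Q B)%E].

Definition likelihood_estimator (X : Type) D sobs
    (S : 'I_(nrep D) -> nat -> nat -> X -> d.-tuple R)
    (T : 'I_(nrep D) -> X -> nat) (x : X) : R :=
  (nrep D)%:R^-1 * \sum_(r < nrep D)
    debiased D (zeta D sobs (fun k i => S r k i x)) (T r x).

End debiased_estimator.
Arguments design : clear implicits.

Section importance_sampling.
Context {R : realType} {dT dU dO : measure_display}.
Context {Theta : measurableType dT} {U : measurableType dU}.
Context {Omega : measurableType dO}.

Section exact.
Variables (mu : {measure set Theta -> \bar R}) (prior l : Theta -> R).

Definition evidence : \bar R := (\int[mu]_t (l t * prior t)%:E)%E.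

Definition posterior (t : Theta) : R := l t * prior t / fine evidence.

Definition posterior_mean (phi : Theta -> R) : R :=
  \int[mu]_t (phi t * posterior t).

Definition expectation_of (g : Theta -> R) (F : Theta -> \bar R) : \bar R :=
  (\int[mu]_t (F t * (g t)%:E))%E.

Definition noiseless_variance (g phi : Theta -> R) : \bar R :=
  expectation_of g (fun t => (posterior t ^+ 2 / g t ^+ 2 *
    (phi t - posterior_mean phi) ^+ 2)%:E).

(* [lh (t, u)] estimates [l t], with u drawn from [p t]. *)
Variables (p : Theta -> {measure set U -> \bar R}) (lh : Theta * U -> R).

Definition xi (t : Theta) (u : U) : R := lh (t, u) / l t.

Definition xi_moment2 (t : Theta) : \bar R :=
  (\int[p t]_u (xi t u ^+ 2)%:E)%E.

Definition xi_abs (t : Theta) : \bar R := (\int[p t]_u (`|xi t u|)%:E)%E.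

Definition asymptotic_variance (g phi : Theta -> R) : \bar R :=
  expectation_of g (fun t => ((posterior t ^+ 2 / g t ^+ 2 *
    (phi t - posterior_mean phi) ^+ 2)%:E * xi_moment2 t)%E).

End exact.

Definition weight (prior g : Theta -> R) (lh : Theta * U -> R)
    (v : Theta * U) : R :=
  lh v * prior v.1 / g v.1.

Section estimators.
Variables (phi : Theta -> R) (w : Theta * U -> R).
Variable Z : nat -> Omega -> Theta * U.

Definition evidence_estimator (M : nat) (o : Omega) : R :=
  M%:R^-1 * \sum_(i < M) w (Z i o).

Definition mean_estimator (M : nat) (o : Omega) : R :=
  (M%:R^-1 * \sum_(i < M) phi (Z i o).1 * w (Z i o)) / evidence_estimator M o.

Definition variance_estimator (M : nat) (o : Omega) : R :=
  (M%:R * evidence_estimator M o ^+ 2)^-1 *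
  \sum_(i < M) (phi (Z i o).1 - mean_estimator M o) ^+ 2 * w (Z i o) ^+ 2.

End estimators.

(* (theta_i, u_i), i = 0, 1, ..., are i.i.d. with theta_i of mu-density g and
   u_i of conditional law [p theta_i]. *)
Definition iid_sample (mu : set Theta -> \bar R) (g : Theta -> R)
    (p : Theta -> {measure set U -> \bar R}) (P : set Omega -> \bar R)
    (Z : nat -> Omega -> Theta * U) : Prop :=
  [/\ forall i, measurable_fun setT (Z i),
      forall i A, measurable A -> P (Z i @^-1` A) =
        (\int[mu]_t ((g t)%:E * p t (xsection A t)))%E &
      mutually_independent P (fun i => sigma_of (Z i))].

End importance_sampling.

(* Main.v *)
Require Import Defs.
From HB Require Import structures.
From mathcomp Require Import all_boot all_order all_algebra.
From mathcomp Require Import all_classical all_reals all_analysis.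
From mathcomp Require Import measurable_realfun ring lra.

Set Implicit Arguments.
Unset Strict Implicit.
Unset Printing Implicit Defensive.

Import Order.TTheory GRing.Theory Num.Theory.
Import numFieldNormedType.Exports.

Local Open Scope classical_set_scope.
Local Open Scope ring_scope.

(* The weights w(theta_i, u_i) and phi(theta_i) w(theta_i, u_i) are i.i.d. with
   means p(s_obs) and p(s_obs) E_pi(phi): integrating out u replaces the
   likelihood estimator by the likelihood. The strong law of large numbers
   applied to numerator and denominator gives (i). For (ii), put
   Y_i = (phi(theta_i) - E_pi(phi)) w(theta_i, u_i) / p(s_obs), which is centered
   with variance sigma_phi^2; the normalized error is the normalized sum S_M of
   the Y_i times a factor tending to 1 almost surely, so the central limit
   theorem and Slutsky's lemma apply. For (iii), expanding around E_pi(phi)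
   bounds the distance of the variance estimator to the average of the Y_i^2 by
   quantities that tend to 0 almost surely as long as S_M stays bounded, and S_M
   is tight by Chebyshev; here avg(w^2) / M -> 0 only uses that w is integrable.

   The strong law is proved by Etemadi's truncation along geometric
   subsequences. The central limit theorem is proved by Stein's method for
   compactly supported test functions of Gaussian mean 0, whose Stein equation
   has a compactly supported solution with elementary bounds; tightness extends
   it to bounded Lipschitz test functions. *)

(** * Independence *)

(** The estimated likelihood may be negative, so unbiasedness given theta does not make the weights
    integrable under the joint law of (theta, u). The strong law is available because the pi-mean of
    E|xi| is finite, and for (i) also that of |phi| E|xi|. Similarly, a second moment of phi w says
    nothing about w^2 where phi vanishes, so (ii) and (iii) start from a finite sigma_phi^2. This
    still leaves E(w^2) possibly infinite, since phi may equal E_pi(phi) where w is large. That is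
    the obstacle in (iii): the error contains the squared error of the mean times avg(w^2), and the
    latter may diverge. The squared error is S_M^2 / M up to a factor tending to 1, and moving its
    1/M onto avg(w^2) gives a product that vanishes. As S_M is only tight, the convergence is in
    probability. In the central limit theorem only second moments are at hand, so Taylor remainders
    are bounded by the minimum of a Lipschitz and a uniform bound instead of a third moment. *)

Section independence.
Context d (T : measurableType d) (R : realType) (P : probability T R).
Implicit Types X Y : T -> R.

Definition indep2 d1 d2 (T1 : measurableType d1) (T2 : measurableType d2)
    (X : T -> T1) (Y : T -> T2) :=
  forall A B, measurable A -> measurable B ->
    P (X @^-1` A `&` Y @^-1` B) = (P (X @^-1` A) * P (Y @^-1` B))%E.

(* The event C carries the variables that remain to be summed in the induction
   of indep_sum_bigcap. *)
Lemma indep2_pair d1 d2 (T1 : measurableType d1) (T2 : measurableType d2)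
    (X : {mfun T >-> T1}) (Y : {mfun T >-> T2}) (C : set T) D :
  measurable C ->
  (forall A B, measurable A -> measurable B ->
    P (X @^-1` A `&` Y @^-1` B `&` C) = (P (X @^-1` A) * P (Y @^-1` B) * P C)%E) ->
  measurable D ->
  P ((fun w => (X w, Y w)) @^-1` D `&` C) =
    (P C * (distribution P X \x distribution P Y)%E D)%E.
Proof.
move=> mC XY mD.
have mXY : measurable_fun setT (fun w => (X w, Y w)) by exact: measurable_fun_pair.
pose Z : {mfun T >-> (T1 * T2)%type} := HB.pack (fun w => (X w, Y w))
  (isMeasurableFun.Build _ _ _ _ _ mXY).
have [PC0|PC0] := eqVneq (P C) 0%E.
  rewrite PC0 mul0e; apply/eqP; rewrite eq_le measure_ge0 andbT -PC0.
  apply: le_measure; rewrite ?inE//.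
  by apply: measurableI => //; exact: (measurable_funPTI Z).
(* Conditioning on C: the normalized restriction of [P] to [C], pushed forward by [Z], agrees with
   the product of the two laws on rectangles, hence on every measurable set. *)
pose k : R := (fine (P C))^-1.
have PCfin : P C \is a fin_num by rewrite fin_num_measure.
have k0 : 0 <= k by rewrite invr_ge0 fine_ge0.
pose m := mscale (NngNum k0) (pushforward (mrestr P mC) Z).
have kPC : (k%:E * P C = 1)%E.
  rewrite /k -[in X in (_ * X)%E](fineK PCfin) -EFinM mulVf//.
  by apply: contra_neq PC0 => h; rewrite -(fineK PCfin) h.
have mE E : m mXY E = (k%:E * P ((fun w => (X w, Y w)) @^-1` E `&` C))%E by [].
have -> : ((distribution P X \x distribution P Y) D = m mXY D)%E.
  apply: (@product_measure_unique _ _ _ _ _ _ _ (m mXY)) => // A B mA mB.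
  transitivity (k%:E * P (X @^-1` A `&` Y @^-1` B `&` C))%E; first exact: mE.
  by rewrite XY// muleCA kPC mule1.
by rewrite mE muleA (muleC (P C)) kPC mul1e.
Qed.

(** The joint law is the product law by [indep2_pair] with the trivial event, so Tonelli for |x y|
    gives integrability and Fubini for x y gives the factorization. *)
Lemma indep2_integral (X Y : {mfun T >-> R}) : indep2 X Y ->
  P.-integrable setT (EFin \o X) -> P.-integrable setT (EFin \o Y) ->
  P.-integrable setT (EFin \o (X \* Y)) /\
  \int[P]_w (X w * Y w) = (\int[P]_w X w) * \int[P]_w Y w.
Proof.
move=> iXY iX iY.
pose mX := distribution P X; pose mY := distribution P Y.
pose Z w := (X w, Y w).
have mZ : measurable_fun setT Z by exact: measurable_fun_pair.
pose f (z : R * R) : \bar R := (z.1 * z.2)%:E.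
have mf : measurable_fun [set: (R * R)%type] f.
  by apply/measurable_EFinP; apply: measurable_funM;
    [exact: measurable_fst|exact: measurable_snd].
have law A : measurable A -> (mX \x mY)%E A = pushforward P Z A.
  move=> mA; have := @indep2_pair _ _ _ _ X Y setT A measurableT.
  rewrite probability_setT mul1e setIT => <- // B C mB mC.
  by rewrite setIT mule1 iXY.
have iidX : mX.-integrable setT (EFin \o idfun).
  apply: (integrable_pushforward (measurable_funP X)); [|exact: iX|exact: measurableT].
  exact: EFin_measurable.
have iidY : mY.-integrable setT (EFin \o idfun).
  apply: (integrable_pushforward (measurable_funP Y)); [|exact: iY|exact: measurableT].
  exact: EFin_measurable.
have intf : (mX \x mY)%E.-integrable setT f.
  apply/integrable12ltyP => //.
  have yfin : (\int[mY]_y `|y%:E| < +oo)%E by case/integrableP: iidY.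
  have mabs : measurable_fun setT (fun y : R => `|y%:E|%E).
    by apply: measurableT_comp => //; exact: EFin_measurable.
  have yE : (\int[mY]_y `|y%:E|)%E = (fine (\int[mY]_y `|y%:E|))%:E.
    by rewrite fineK// ge0_fin_numE// integral_ge0.
  have fE x : (\int[mY]_y `|f (x, y)| =
      (fine (\int[mY]_y `|y%:E|))%:E * `|x%:E|)%E.
    rewrite -yE muleC -ge0_integralZl//.
    by apply: eq_integral => y _; rewrite /f/= normrM EFinM.
  under eq_integral do rewrite fE.
  rewrite ge0_integralZl//; last by rewrite lee_fin fine_ge0// integral_ge0.
  rewrite lte_mul_pinfty//; first by rewrite lee_fin fine_ge0// integral_ge0.
  by case/integrableP: iidX.
have intZ : P.-integrable setT (f \o Z).
  apply/integrableP; split; first exact: measurableT_comp.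
  move/integrableP : intf => [_]; apply: le_lt_trans.
  rewrite (eq_measure_integral (pushforward P Z)); last first.
    by move=> A mA _; exact: law.
  rewrite (ge0_integral_pushforward mZ)//; exact: measurableT_comp.
split; first exact: intZ.
rewrite /Rintegral.
transitivity (fine (\int[mX \x mY]_z f z)%E).
  congr fine; rewrite (eq_measure_integral (pushforward P Z)); last first.
    by move=> A mA _; exact: law.
  by rewrite (integral_pushforward mZ).
rewrite -integral12_prod_meas1// /fubini_F.
have EY : (\int[mY]_y y%:E = (\int[P]_w Y w)%:E)%E.
  rewrite (integral_pushforward (measurable_funP Y) (@EFin_measurable _ setT) iY measurableT).
  by rewrite fineK// (integrable_fin_num _ iY).
have fE x : (\int[mY]_y f (x, y) = (\int[P]_w Y w)%:E * x%:E)%E.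
  rewrite -EY muleC -integralZl//.
transitivity (fine (\int[mX]_x ((\int[P]_w Y w)%:E * x%:E))%E).
  by congr fine; apply: eq_integral => x _; exact: fE.
rewrite integralZl// fineM//; last exact: (integrable_fin_num _ iidX).
rewrite mulrC; congr (fine _ * _).
exact: (integral_pushforward (measurable_funP X) (@EFin_measurable _ setT) iX measurableT).
Qed.

End independence.

(** * Independent identically distributed sequences *)

Section iid.
Context d (T : measurableType d) (R : realType) (P : probability T R).

Definition iid d' (T' : measurableType d') (Z : nat -> T -> T') :=
  [/\ forall i, measurable_fun setT (Z i),
      forall i A, measurable A -> P (Z i @^-1` A) = P (Z 0%N @^-1` A) &
      mutually_independent P (fun i => sigma_of (Z i))].

Lemma sigma_ofP d' (T' : measurableType d') (X : T -> T') (A : set T) :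
  sigma_of X A <-> exists2 B, measurable B & A = X @^-1` B.
Proof.
split=> [[B mB <-]|[B mB ->]]; first by exists B; rewrite ?setTI.
by exists B; rewrite ?setTI.
Qed.

Lemma iid_comp d1 d2 (T1 : measurableType d1) (T2 : measurableType d2)
    (Z : nat -> T -> T1) (f : T1 -> T2) :
  iid Z -> measurable_fun setT f -> iid (fun i => f \o Z i).
Proof.
move=> [mZ eZ iZ] mf; split.
- by move=> i; exact: measurableT_comp.
- move=> i A mA; apply: (eZ i (f @^-1` A)).
  by rewrite -[X in measurable X]setTI; exact: mf.
- move=> s A us As; apply: iZ => // i /As /sigma_ofP[B mB ->].
  apply/sigma_ofP; exists (f @^-1` B) => //.
  by rewrite -[X in measurable X]setTI; exact: mf.
Qed.

Lemma ge0_integral_iid d' (T' : measurableType d') (Z : nat -> T -> T')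
    (f : T' -> \bar R) i :
  iid Z -> measurable_fun setT f -> (forall x, 0 <= f x)%E ->
  (\int[P]_w f (Z i w) = \int[P]_w f (Z 0%N w))%E.
Proof.
move=> [mZ eZ _] mf f0.
have h j : (\int[P]_w f (Z j w) = \int[pushforward P (Z j)]_x f x)%E.
  by rewrite (ge0_integral_pushforward (mZ j)).
by rewrite !h; apply: eq_measure_integral => A mA _; exact: eZ.
Qed.

Lemma integrable_iid d' (T' : measurableType d') (Z : nat -> T -> T')
    (f : T' -> R) i :
  iid Z -> measurable_fun setT f ->
  P.-integrable setT (EFin \o (f \o Z 0%N)) ->
  P.-integrable setT (EFin \o (f \o Z i)).
Proof.
move=> iZ mf /integrableP[_ fi]; have [mZ _ _] := iZ.
apply/integrableP; split.
  by apply/measurable_EFinP; exact: measurableT_comp.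
rewrite (@ge0_integral_iid _ _ Z (fun x => `|(f x)%:E|%E) i)//.
by apply/measurableT_comp => //; exact/measurable_EFinP.
Qed.

(** Positive and negative parts are transported separately, which is why no integrability is
    required. *)
Lemma Rintegral_iid d' (T' : measurableType d') (Z : nat -> T -> T')
    (f : T' -> R) i :
  iid Z -> measurable_fun setT f ->
  \int[P]_w f (Z i w) = \int[P]_w f (Z 0%N w).
Proof.
move=> iZ mf; have [mZ _ _] := iZ; congr fine.
have mf' : measurable_fun setT (EFin \o f) by exact/measurable_EFinP.
rewrite integralE [RHS]integralE; congr (_ - _)%E.
- have := @ge0_integral_iid _ _ Z ((EFin \o f)^\+)%E i iZ (measurable_funepos mf').
  move=> /(_ (fun=> funepos_ge0 _ _)) h.
  have {}h : (\int[P]_w (EFin \o f)^\+ (Z i w) = \int[P]_w (EFin \o f)^\+ (Z 0%N w))%E by exact: h.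
  transitivity (\int[P]_w (EFin \o f)^\+ (Z i w))%E.
    by apply: eq_integral => w _; rewrite !funeposE.
  by rewrite h; apply: eq_integral => w _; rewrite !funeposE.
- have := @ge0_integral_iid _ _ Z ((EFin \o f)^\-)%E i iZ (measurable_funeneg mf').
  move=> /(_ (fun=> funeneg_ge0 _ _)) h.
  have {}h : (\int[P]_w (EFin \o f)^\- (Z i w) = \int[P]_w (EFin \o f)^\- (Z 0%N w))%E by exact: h.
  transitivity (\int[P]_w (EFin \o f)^\- (Z i w))%E.
    by apply: eq_integral => w _; rewrite !funenegE.
  by rewrite h; apply: eq_integral => w _; rewrite !funenegE.
Qed.

(** Induction on [s] with [t] general: the head of the sum is moved to the list of events, so the
    induction hypothesis makes the shorter sum independent of that variable together with all the
    events of [t]. *)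
Lemma indep_sum_bigcap (Y : nat -> T -> R) (s t : seq nat) (A : nat -> set T) B :
  iid Y -> uniq (s ++ t) -> measurable B ->
  (forall j, j \in t -> sigma_of (Y j) (A j)) ->
  let S w := \sum_(j <- s) Y j w in
  P (S @^-1` B `&` \bigcap_(j in [set` t]) A j) =
  (P (S @^-1` B) * P (\bigcap_(j in [set` t]) A j))%E.
Proof.
move=> iY; have [mY eY inY] := iY; elim: s t A B => [|j s IH] t A B /= us mB At.
  have [B0|B0] := pselect (B 0).
    rewrite (_ : _ @^-1` B = setT) ?setTI ?probability_setT ?mul1e//.
    by apply/seteqP; split => // w _ /=; rewrite big_nil.
  rewrite (_ : _ @^-1` B = set0) ?set0I ?measure0 ?mul0e//.
  by apply/seteqP; split => // w /=; rewrite big_nil.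
move: us => /andP[jst us].
have mS : measurable_fun setT (fun w => \sum_(k <- s) Y k w).
  exact: measurable_sum.
pose X : {mfun T >-> R} := HB.pack (Y j) (isMeasurableFun.Build _ _ _ _ _ (mY j)).
pose W : {mfun T >-> R} := HB.pack (fun w => \sum_(k <- s) Y k w)
  (isMeasurableFun.Build _ _ _ _ _ mS).
pose D : set (R * R) := [set z | B (z.1 + z.2)].
have mD : measurable D.
  rewrite -[D]setTI; apply: (measurable_funD measurable_fst measurable_snd) => //.
have mbig (r : seq nat) : (forall k, k \in r -> sigma_of (Y k) (A k)) ->
    measurable (\bigcap_(k in [set` r]) A k).
  move=> rA; apply: fin_bigcap_measurable => [|k /= /rA /sigma_ofP[C mC ->]].
    exact: finite_seq.
  by rewrite -[X in measurable X]setTI; apply: (mY k).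
(* The second factor on the right does not depend on [r]. Taking [r] empty will identify it as the
   law of the whole sum, and taking [r] equal to [t] then gives the claim. *)
have key r : uniq (s ++ j :: r) -> (forall k, k \in r -> sigma_of (Y k) (A k)) ->
    P ((fun w => \sum_(k <- j :: s) Y k w) @^-1` B `&` \bigcap_(k in [set` r]) A k) =
    (P (\bigcap_(k in [set` r]) A k)%classic * (distribution P X \x distribution P W)%E D)%E.
  move=> ur rA.
  rewrite -(@indep2_pair _ _ _ P _ _ _ _ X W _ D (mbig r rA))//.
    congr (P (_ `&` _)); apply/seteqP; split => w /=; by rewrite /D/= big_cons.
  move=> A1 B1 mA1 mB1.
  pose A' k := if k == j then Y j @^-1` A1 else A k.
  have rA' k : k \in j :: r -> sigma_of (Y k) (A' k).
    rewrite inE /A'; case: eqVneq => [-> _|_ /= kr]; last exact: rA.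
    by apply/sigma_ofP; exists A1.
  have jr : j \notin r by move: ur; rewrite cat_uniq/= => /and4P[].
  have A'E : \bigcap_(k in [set` r]) A' k = \bigcap_(k in [set` r]) A k.
    apply: eq_bigcapr => k /= kr; rewrite /A'; case: eqVneq => // kj.
    by rewrite -kj kr in jr.
  have bE : \bigcap_(k in [set` j :: r]) A' k = X @^-1` A1 `&` \bigcap_(k in [set` r]) A k.
    by rewrite bigcap_seq big_cons -bigcap_seq A'E {1}/A' eqxx.
  have Pb : P (X @^-1` A1 `&` \bigcap_(k in [set` r]) A k) =
      (P (X @^-1` A1) * P (\bigcap_(k in [set` r]) A k))%E.
    have := inY (j :: r) A' _ rA'; rewrite bE => ->; last first.
      by move: ur; rewrite cat_uniq => /and3P[].
    have := inY r A' _ _; rewrite A'E => ->; last 2 first.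
    - by move: ur; rewrite cat_uniq/= => /and4P[].
    - by move=> k kr; apply: rA'; rewrite inE kr orbT.
    rewrite big_cons EFinM {1}/A' eqxx fineK// fin_num_measure//.
    exact: (measurable_funPTI X).
  have := IH (j :: r) A' B1 ur mB1 rA'; rewrite bE => h.
  by rewrite (setIC (X @^-1` A1)) -setIA [LHS]h Pb muleA (muleC (P (W @^-1` B1))).
have ust : uniq (s ++ j :: t) by rewrite -cat1s uniq_catCA /= jst.
rewrite key// -[in RHS](setIT (_ @^-1` B)).
have := key [::]; rewrite set_nil bigcap_set0 => ->//.
  by rewrite probability_setT mul1e muleC.
rewrite cats1 rcons_uniq; move: us jst; rewrite cat_uniq mem_cat negb_or.
by move=> /and3P[-> _ _] /andP[-> _].
Qed.

Lemma indep2_sum (Y : nat -> T -> R) (s : seq nat) i :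
  iid Y -> uniq s -> i \notin s ->
  indep2 P (fun w => \sum_(j <- s) Y j w) (Y i).
Proof.
move=> iY us si A B mA mB; have [mY _ _] := iY.
have := @indep_sum_bigcap Y s [:: i] (fun=> Y i @^-1` B) A iY _ mA _.
rewrite set_cons1 bigcap_set1 => -> //; first by rewrite cats1 rcons_uniq si.
by move=> j; rewrite inE => /eqP ->; apply/sigma_ofP; exists B.
Qed.

End iid.

(** * Dominated convergence, second moments and the Borel-Cantelli lemma *)

Section dominated.
Context d (T : measurableType d) (R : realType) (mu : {measure set T -> \bar R}).

Lemma Rdominated_cvg (f_ : nat -> T -> R) (f g : T -> R) :
  (forall n, measurable_fun setT (f_ n)) -> measurable_fun setT f ->
  mu.-integrable setT (EFin \o g) ->
  (forall w, f_ n w @[n --> \oo] --> f w) -> (forall n w, `|f_ n w| <= g w) ->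
  \int[mu]_w f_ n w @[n --> \oo] --> \int[mu]_w f w.
Proof.
move=> mf_ mf ig f_f f_g.
have cv w : (f_ n w)%:E @[n --> \oo] --> (f w)%:E.
  by apply: cvg_EFin; [exact: nearW|exact: f_f].
have [fi _ h] := @dominated_convergence _ T R mu setT measurableT
  (fun n w => (f_ n w)%:E) (fun w => (f w)%:E) (fun w => (g w)%:E)
  (fun n => (measurable_EFinP _ _).2 (mf_ n)) ((measurable_EFinP _ _).2 mf)
  (aeW mu (fun w _ => cv w)) ig
  (aeW mu (fun w n _ => f_g n w)).
apply: fine_cvg; rewrite fineK; last exact: (integrable_fin_num _ fi).
exact: h.
Qed.

End dominated.

Section moments.
Context d (T : measurableType d) (R : realType) (P : probability T R).
Local Notation integrable X := (P.-integrable setT (EFin \o X)).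

Lemma integrable_dominated (f g : T -> R) : measurable_fun setT f ->
  (forall x, `|f x| <= g x) -> integrable g -> integrable f.
Proof.
move=> mf fg; apply: le_integrable => //; first exact/measurable_EFinP.
by move=> x _ /=; rewrite lee_fin (le_trans (fg x))// ler_norm.
Qed.

Lemma integrable_bounded (f : T -> R) (c : R) : measurable_fun setT f ->
  (forall x, `|f x| <= c) -> integrable f.
Proof.
move=> mf fc; apply: (integrable_dominated mf fc).
exact: finite_measure_integrable_cst.
Qed.

Lemma integrable_sqr (f : T -> R) : measurable_fun setT f ->
  integrable (fun x => f x ^+ 2) -> integrable f.
Proof.
move=> mf f2; apply: (@integrable_dominated _ (fun x => 1 + f x ^+ 2) mf).
  have key (y : R) : y <= 1 + y ^+ 2 by nra.
  by move=> x; rewrite (le_trans (key _))// real_normK ?num_real.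
have i1 : integrable (cst 1) by exact: finite_measure_integrable_cst.
exact: (integrableD measurableT i1 f2).
Qed.

Lemma EFin_Rintegral (f : T -> R) : integrable f ->
  (\int[P]_x (f x)%:E)%E = (\int[P]_x f x)%:E.
Proof. by move=> fi; rewrite fineK// (integrable_fin_num _ fi). Qed.

Lemma Rintegral_probability_cst (c : R) : \int[P]_w c = c.
Proof. by rewrite /Rintegral integral_cst// [X in (_ * X)%E]probability_setT mule1. Qed.

Lemma integrable_add (f g : T -> R) : integrable f -> integrable g ->
  integrable (fun x => f x + g x).
Proof. exact: integrableD. Qed.

Lemma integrable_sub (f g : T -> R) : integrable f -> integrable g ->
  integrable (fun x => f x - g x).
Proof. exact: integrableB. Qed.

Lemma integrable_scale (c : R) (f : T -> R) : integrable f ->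
  integrable (fun x => c * f x).
Proof. exact: integrableZl. Qed.

Lemma Rintegral_sum (n : nat) (f : nat -> T -> R) : (forall i, integrable (f i)) ->
  integrable (fun w => \sum_(i < n) f i w) /\
  \int[P]_w (\sum_(i < n) f i w) = \sum_(i < n) \int[P]_w f i w.
Proof.
move=> fi; elim: n => [|n [IH1 IH2]].
  have S0 w : \sum_(i < 0) f i w = 0 by rewrite big_ord0.
  split; first by under eq_fun do rewrite S0; exact: finite_measure_integrable_cst.
  by under eq_Rintegral do rewrite S0; rewrite Rintegral_probability_cst big_ord0.
have S w : \sum_(i < n.+1) f i w = \sum_(i < n) f i w + f n w by rewrite big_ord_recr.
split; first by under eq_fun do rewrite S; exact: integrable_add.
by under eq_Rintegral do rewrite S; rewrite RintegralD// IH2 big_ord_recr.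
Qed.

Lemma second_moment_markov (X : T -> R) (a : R) : measurable_fun setT X -> 0 < a ->
  (P [set w | (a <= `|X w|)%R] <= (a ^- 2)%:E * \int[P]_w (X w ^+ 2)%:E)%E.
Proof.
move=> mX a0.
pose X' : {mfun T >-> R} := HB.pack X (isMeasurableFun.Build _ _ _ _ _ mX).
have h := @markov _ _ _ P X' (fun x => x ^+ 2) a a0 _ _ _.
rewrite -lee_pdivrMl ?invr_gt0 ?exprn_gt0// invrK.
apply: le_trans (h _ _ _) _ => //=.
- by move=> r _; exact: sqr_ge0.
- by move=> x y; rewrite !nnegrE => x0 y0; rewrite ler_sqr.
- by rewrite unlock; apply: ge0_le_integral => //=;
    do ?[by move=> x _; rewrite lee_fin sqr_ge0];
    do ?[apply/measurable_EFinP; apply: measurable_funX; do ?exact: measurableT_comp];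
    by move=> x _; rewrite lee_fin real_normK ?num_real.
Qed.

(** The limsup of the events is null, and [P (F n)] is at most the probability of the union of the
    later events, which decreases to that of the limsup. This turns almost sure bounds into
    convergence in probability. *)
Lemma ae_eventually_cvg0 (F : nat -> set T) : (forall n, measurable (F n)) ->
  {ae P, forall w, \forall n \near \oo, ~ F n w} -> P (F n) @[n --> \oo] --> 0%E.
Proof.
move=> mF [N [mN PN0 hN]].
have mU n : measurable (\bigcup_(k >= n) F k) by apply: bigcup_measurable.
have lim0 : P (lim_sup_set F) = 0%E.
  apply/eqP; rewrite eq_le measure_ge0 andbT -PN0 le_measure ?inE//.
    by apply: bigcap_measurableType.
  move=> w Fw; apply: hN => /= -[n _ nF].
  by have [k /= nk Fk] := Fw n I; exact: (nF k).
have cvg : P (\bigcup_(k >= n) F k) @[n --> \oo] --> 0%E.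
  rewrite -lim0; apply: lim_sup_set_cvg => //.
  by rewrite (le_lt_trans (probability_le1 _ _))// ?ltry//; exact: mU.
apply: (squeeze_cvge _ (cvg_cst 0%E) cvg).
apply: nearW => n; rewrite measure_ge0/= le_measure ?inE//.
by apply: bigcup_sup => /=.
Qed.

Lemma borel_cantelli (F : nat -> set T) : (forall n, measurable (F n)) ->
  (\sum_(n <oo) P (F n) < +oo)%E -> {ae P, forall w, \forall n \near \oo, ~ F n w}.
Proof.
move=> mF sF; exists (lim_sup_set F); split.
- apply: bigcap_measurableType => n _; exact: bigcup_measurable.
- exact: lim_sup_set_cvg0.
- move=> w /= nF n _; apply: contrapT => h; apply: nF; exists n => // k /= nk Fk.
  by apply: h; exists k.
Qed.

Lemma iid_variance_sum (W : nat -> T -> R) (n : nat) : iid P W ->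
  integrable (fun w => W 0%N w ^+ 2) -> \int[P]_w W 0%N w = 0 ->
  [/\ integrable (fun w => \sum_(i < n) W i w),
      integrable (fun w => (\sum_(i < n) W i w) ^+ 2) &
      \int[P]_w (\sum_(i < n) W i w) ^+ 2 = n%:R * \int[P]_w (W 0%N w ^+ 2)].
Proof.
move=> iW W2 W0; have [mW _ _] := iW.
have iW2 i : integrable (fun w => W i w ^+ 2).
  have := @integrable_iid _ _ _ _ _ _ W (fun x => x ^+ 2) i iW; exact.
have iW1 i : integrable (W i) by apply: integrable_sqr.
have EW i : \int[P]_w W i w = 0.
  by rewrite (@Rintegral_iid _ _ _ _ _ _ W id i iW).
have EW2 i : \int[P]_w (W i w ^+ 2) = \int[P]_w (W 0%N w ^+ 2).
  by rewrite (@Rintegral_iid _ _ _ _ _ _ W (fun x => x ^+ 2) i iW)//; exact: measurable_funX.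
suff [? ? ? _] : [/\ integrable (fun w => \sum_(i < n) W i w),
      integrable (fun w => (\sum_(i < n) W i w) ^+ 2),
      \int[P]_w (\sum_(i < n) W i w) ^+ 2 = n%:R * \int[P]_w (W 0%N w ^+ 2) &
      \int[P]_w (\sum_(i < n) W i w) = 0] by [].
elim: n => [|n [i1 i2 e2 e1]].
  have S0 w : \sum_(i < 0) W i w = 0 by rewrite big_ord0.
  have z : integrable (cst 0) by exact: finite_measure_integrable_cst.
  split.
  - by under eq_fun do rewrite S0.
  - by under eq_fun do rewrite S0 expr0n.
  - under eq_Rintegral do rewrite S0 expr0n/=.
    by rewrite mul0r Rintegral_cst ?mul0r.
  - under eq_Rintegral do rewrite S0.
    by rewrite Rintegral_cst ?mul0r.
pose S w := \sum_(i < n) W i w.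
have mS : measurable_fun setT S by exact: measurable_sum.
have SS w : \sum_(i < n.+1) W i w = S w + W n w by rewrite big_ord_recr.
have ind : indep2 P S (W n).
  have := @indep2_sum _ _ _ P W (iota 0 n) n iW (iota_uniq _ _).
  rewrite mem_iota ltnn andbF => /(_ isT).
  rewrite (_ : (fun w => _) = S)//; apply/funext => w.
  by rewrite /S -(big_mkord xpredT (fun i => W i w)) /index_iota subn0.
pose S' : {mfun T >-> R} := HB.pack S (isMeasurableFun.Build _ _ _ _ _ mS).
pose W' : {mfun T >-> R} := HB.pack (W n) (isMeasurableFun.Build _ _ _ _ _ (mW n)).
have [iSW ESW] := @indep2_integral _ _ _ P S' W' ind i1 (iW1 n).
(* The new variable is centered and independent of the earlier sum, so the cross term of the square
   has mean 0. *)
have {}ESW : \int[P]_w (S w * W n w) = 0 by rewrite ESW/= EW mulr0.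
have {iSW} : integrable (fun w => 2 * (S w * W n w)).
  exact: (integrableZl measurableT 2 iSW).
set SW := (X in integrable X) => iSW.
have iS2W : integrable (fun w => S w ^+ 2 + SW w).
  exact: (integrableD measurableT i2 iSW).
have sq w : (\sum_(i < n.+1) W i w) ^+ 2 = (S w ^+ 2 + SW w) + W n w ^+ 2.
  by rewrite SS sqrrD /SW mulr_natl.
split.
- by under eq_fun do rewrite SS; exact: (integrableD measurableT i1 (iW1 n)).
- by under eq_fun do rewrite sq; exact: (integrableD measurableT iS2W (iW2 n)).
- under eq_Rintegral do rewrite sq.
  rewrite (RintegralD measurableT iS2W (iW2 n)) (RintegralD measurableT i2 iSW) e2 EW2.
  rewrite RintegralZl// ?ESW ?mulr0 ?addr0 -?natr1 ?mulrDl ?mul1r//.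
  have [] := @indep2_integral _ _ _ P S' W' ind i1 (iW1 n); by [].
- under eq_Rintegral do rewrite SS.
  by rewrite (RintegralD measurableT i1 (iW1 n)) e1 EW addr0.
Qed.

End moments.

(** * Strong law of large numbers *)

Section geometric_series.
Context (R : realType).
Implicit Types (a t y : R).

Lemma sum_expr_le a N : 1 < a -> \sum_(n < N) a ^+ n <= a ^+ N / (a - 1).
Proof.
move=> a1; have a10 : a - 1 != 0 by rewrite gt_eqF ?subr_gt0.
elim: N => [|N IH]; first by rewrite big_ord0 divr_ge0// subr_ge0 ltW.
rewrite big_ord_recr/= (le_trans (lerD IH (lexx _)))// exprS.
by rewrite le_eqVlt; apply/orP; left; apply/eqP; field.
Qed.

Lemma sum_exprV_le a N : 1 < a -> \sum_(n < N) a ^- n <= a / (a - 1).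
Proof.
move=> a1; have a10 : a - 1 != 0 by rewrite gt_eqF ?subr_gt0.
have a0 : 0 < a by rewrite (lt_trans ltr01).
have h : \sum_(n < N) a ^- n <= (a - a * a ^- N) / (a - 1).
  elim: N => [|N IH]; first by rewrite big_ord0 expr0 invr1 mulr1 subrr mul0r.
  rewrite big_ord_recr/= (le_trans (lerD IH (lexx _)))// exprS invfM mulVKf ?gt_eqF//.
  by move: (a ^- N) => x; rewrite le_eqVlt; apply/orP; left; apply/eqP; field.
apply: (le_trans h); rewrite ler_pM2r ?invr_gt0 ?subr_gt0//.
by rewrite lerBlDr lerDl mulr_ge0 ?invr_ge0 ?exprn_ge0// ltW.
Qed.

(** A geometric sum is dominated by its largest term, which is below y. Later y is a value of the
    variable and a^n the truncation level, so the expectation of this bound costs only a first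
    moment. *)
Lemma sum_expr_below a y N : 1 < a -> 0 <= y ->
  \sum_(n < N) (if a ^+ n < y then a ^+ n else 0) <= y * (a / (a - 1)).
Proof.
move=> a1 y0; have a0 : 0 < a by rewrite (lt_trans ltr01).
have C0 : 0 < a / (a - 1) by rewrite divr_gt0// subr_gt0.
elim: N => [|N IH]; first by rewrite big_ord0 mulr_ge0// ltW.
rewrite big_ord_recr/=; case: ifPn => [ay|_]; last by rewrite addr0.
apply: (@le_trans _ _ (\sum_(n < N.+1) a ^+ n)).
  rewrite big_ord_recr/= lerD2r ler_sum// => i _; case: ifP => // _.
  by rewrite exprn_ge0// ltW.
rewrite (le_trans (sum_expr_le _ a1))// exprS (mulrC a) -mulrA ler_pM2r//.
exact: ltW.
Qed.

(** For y > 1 the term of index 0 is absent, and shifting the index divides y by a; hence the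
    induction on [N] is general in y. Multiplied by y^2, the bound is linear in y, which handles the
    truncated second moments. *)
Lemma sum_exprV_above a y N : 1 < a -> 0 < y ->
  \sum_(n < N) (if y <= a ^+ n then a ^- n else 0) <= a / (a - 1) / y.
Proof.
move=> a1; have a0 : 0 < a by rewrite (lt_trans ltr01).
have C0 : 0 < a / (a - 1) by rewrite divr_gt0// subr_gt0.
elim: N y => [|N IH] y y0; first by rewrite big_ord0 divr_ge0// ltW.
have [y1|y1] := leP y 1.
  apply: (@le_trans _ _ (\sum_(n < N.+1) a ^- n)).
    by apply: ler_sum => i _; case: ifP => // _; rewrite invr_ge0 exprn_ge0// ltW.
  by rewrite (le_trans (sum_exprV_le _ a1))// ler_peMr ?invf_ge1// ltW.
rewrite big_ord_recl/= expr0 [y <= 1]leNgt y1/= add0r.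
have -> : \sum_(i < N) (if y <= a ^+ bump 0 i then a ^- bump 0 i else 0) =
    a^-1 * \sum_(i < N) (if y / a <= a ^+ i then a ^- i else 0).
  rewrite mulr_sumr; apply: eq_bigr => i _; rewrite /bump/= add1n exprS.
  by rewrite ler_pdivrMr// (mulrC (a ^+ i)); case: ifP => _; rewrite ?mulr0// invfM.
rewrite (le_trans (ler_wpM2l _ (IH (y / a) _)))//.
- by rewrite invr_ge0 ltW.
- by rewrite divr_gt0.
- rewrite le_eqVlt; apply/orP; left; apply/eqP; field.
  by rewrite !gt_eqF// subr_gt0.
Qed.

Lemma bernoulli_expr t n : 0 <= t -> 1 + n%:R * t <= (1 + t) ^+ n.
Proof.
move=> t0; elim: n => [|n IH]; first by rewrite mul0r addr0 expr0.
rewrite exprS -natr1; apply: le_trans (ler_wpM2l _ IH); last by rewrite addr_ge0.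
have n0 : 0 <= n%:R :> R by [].
nra.
Qed.

(** The successor makes the index positive and larger than (1 + t)^n. It is also at most twice that
    power when t >= 0, so it fits the window between the truncation level and its double in
    [truncated_deviation]. *)
Definition geom_index t n : nat := (Num.truncn ((1 + t) ^+ n)).+1.

Lemma geom_index_gt t n : (1 + t) ^+ n < (geom_index t n)%:R.
Proof. exact: truncnS_gt. Qed.

Lemma geom_index_le t n : 0 <= t -> (geom_index t n)%:R <= (1 + t) ^+ n + 1.
Proof.
move=> t0; rewrite /geom_index -natr1 lerD2r truncn_le// exprn_ge0// addr_ge0//.
Qed.

Lemma geom_index_homo t : 0 <= t -> {homo geom_index t : i j / (i <= j)%N}.
Proof.
move=> t0 i j ij; rewrite ltnS le_truncn//.
by rewrite ler_weXn2l// lerDl.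
Qed.

Lemma geom_index_unbounded t m : 0 < t -> exists n, (m < geom_index t n)%N.
Proof.
move=> t0; exists (Num.truncn (m%:R / t)).+1; rewrite -(ltr_nat R).
apply: le_lt_trans (geom_index_gt t _).
apply: le_trans (bernoulli_expr _ (ltW t0)).
rewrite (@le_trans _ _ ((Num.truncn (m%:R / t)).+1%:R * t))// ?lerDr//.
by rewrite -ler_pdivrMr// ltW// truncnS_gt.
Qed.

(* Etemadi's interpolation between consecutive indices of a geometric
   sequence. *)
Lemma cvg_average_geometric (S : nat -> R) (mu : R) : 0 <= mu ->
  (forall n, 0 <= S n) -> {homo S : i j / (i <= j)%N >-> i <= j} ->
  (forall q : nat, let k := geom_index q.+1%:R^-1 in
     (k n)%:R^-1 * S (k n) @[n --> \oo] --> mu) ->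
  m%:R^-1 * S m @[m --> \oo] --> mu.
Proof.
move=> mu0 S0 Smono Sk; apply/cvgrPdist_le => /= e e0.
(* With t <= 1, the upper bound (mu + t)(1 + 2 t) is at most mu + t (3 + 2 mu), so t is chosen to
   make the last product at most e. *)
pose q := Num.truncn ((3 + 2 * mu) / e).
pose t : R := q.+1%:R^-1.
have t0 : 0 < t by rewrite invr_gt0.
have t1 : t <= 1 by rewrite invf_le1// ler1n.
have te : t * (3 + 2 * mu) <= e.
  have : (3 + 2 * mu) / e < q.+1%:R by exact: truncnS_gt.
  by rewrite ltr_pdivrMr// => /ltW h; rewrite /t mulrC ler_pdivrMr ?ltr0n// [leRHS]mulrC.
have /= Skq := Sk q; move/cvgrPdist_le : Skq => /(_ t t0)[N _ hN].
pose k := geom_index t.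
have k0 n : (0 : R) < (k n)%:R by rewrite ltr0n.
(* Beyond (q + 1)^2 = 1 / t^2, Bernoulli's inequality gives t (1 + t)^n >= 1. This absorbs the
   rounding by 1 and bounds the ratio of consecutive indices by 1 + 2 t. *)
pose N' := maxn N (q.+1 ^ 2).
exists (k N') => // m /= km.
have m0 : (0 : R) < m%:R by rewrite ltr0n (leq_trans _ km).
pose ex := geom_index_unbounded m t0.
(* Minimality places [m] between two consecutive indices: [k n <= m < k n.+1]. *)
case: (ex_minnP ex) => -[|n] mk nmin.
  by have := leq_trans mk (leq_trans (geom_index_homo (ltW t0) (leq0n N')) km); rewrite ltnn.
have kn : (k n <= m)%N.
  by rewrite leqNgt; apply/negP => /nmin; rewrite ltnn.
have N'n : (N' <= n)%N.
  rewrite leqNgt; apply/negP => nN'.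
  by have := leq_trans mk (leq_trans (geom_index_homo (ltW t0) nN') km); rewrite ltnn.
have Nn : (N <= n)%N by rewrite (leq_trans (leq_maxl _ _) N'n).
have qn : (q.+1 ^ 2 <= n)%N by rewrite (leq_trans (leq_maxr _ _) N'n).
have h1 := hN n Nn; have h2 := hN n.+1 (leqW Nn).
rewrite -/t -/k /= !ler_norml !lerBrDl !lerBlDr in h1 h2 *.
set s := m%:R^-1 * S m; set u1 := _^-1 * S (k n) in h1; set u2 := _^-1 * S (k n.+1) in h2.
have s0 : 0 <= s by rewrite mulr_ge0// invr_ge0 ltW.
have u10 : 0 <= u1 by rewrite mulr_ge0// invr_ge0 ltW.
have u20 : 0 <= u2 by rewrite mulr_ge0// invr_ge0 ltW.
have ratio : (k n.+1)%:R <= (1 + 2 * t) * (k n)%:R.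
  rewrite (le_trans (geom_index_le _ (ltW t0)))// exprS.
  have : 1 / t <= (1 + t) ^+ n.
    apply: le_trans (bernoulli_expr _ (ltW t0)).
    rewrite (@le_trans _ _ (n%:R * t))// ?lerDr// ler_pdivrMr// -mulrA.
    rewrite -ler_pdivrMr ?mulr_gt0// div1r /t -invfM invrK -natrM ler_nat.
    by rewrite mulnn.
  rewrite ler_pdivrMr// => h3; have := geom_index_gt t n; rewrite -/k => h4.
  have := exprn_ge0 n (ltW (addr_gt0 ltr01 t0)).
  move: (k n)%:R ((1 + t) ^+ n) h3 h4 => x y h3 h4 y0; nra.
have t20 : 0 <= 1 + 2 * t by rewrite addr_ge0// mulr_ge0// ltW.
have sE : S m = s * m%:R by rewrite /s mulrAC mulVf ?mul1r// gt_eqF.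
have u1E : S (k n) = u1 * (k n)%:R by rewrite /u1 mulrAC mulVf ?mul1r// gt_eqF.
have u2E : S (k n.+1) = u2 * (k n.+1)%:R by rewrite /u2 mulrAC mulVf ?mul1r// gt_eqF.
clearbody s u1 u2.
have ub : s <= u2 * (1 + 2 * t).
  rewrite -(ler_pM2r m0) -sE (le_trans (Smono _ _ (ltnW mk)))// u2E -[leRHS]mulrA.
  by rewrite ler_wpM2l// (le_trans ratio)// ler_wpM2l// ler_nat.
have lb : u1 <= s * (1 + 2 * t).
  rewrite -(ler_pM2r (k0 n)) -u1E (le_trans (Smono _ _ kn))// sE -[leRHS]mulrA.
  by rewrite ler_wpM2l// (le_trans _ ratio)// ler_nat ltnW.
move: h1 h2 => /andP[h1a h1b] /andP[h2a h2b].
clearbody t.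
have tmu : 0 <= t * mu by rewrite mulr_ge0// ltW.
have tt : t * t <= t by rewrite ler_piMr// ltW.
apply/andP; split.
  have : u2 * (1 + 2 * t) <= (mu + t) * (1 + 2 * t) by rewrite ler_wpM2r.
  nra.
have [//|h] := leP mu (e + s).
have : s * (1 + 2 * t) <= (mu - e) * (1 + 2 * t) by rewrite ler_wpM2r//; lra.
have : 0 <= t * e by rewrite mulr_ge0// ltW.
nra.
Qed.

End geometric_series.

Section strong_law.
Context d (T : measurableType d) (R : realType) (P : probability T R).
Local Notation integrable X := (P.-integrable setT (EFin \o X)).

Let cut (c x : R) : R := if x <= c then x else 0.
Let tailind (c x : R) : R := if c < x then 1 else 0.

Let measurable_cut c : measurable_fun setT (cut c).
Proof. by apply: measurable_fun_ifT => //; exact: measurable_fun_ler. Qed.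

Let measurable_tailind c : measurable_fun setT (tailind c).
Proof. by apply: measurable_fun_ifT => //; exact: measurable_fun_ltr. Qed.

Let cut_bound c x : 0 <= x -> `|cut c x| <= `|c|.
Proof.
rewrite /cut => x0; case: ifPn => [xc|_]; last by rewrite normr0.
by rewrite !ger0_norm// (le_trans x0).
Qed.

Lemma Rintegral_tailind (X : T -> R) (c : R) : measurable_fun setT X ->
  P [set w | c < X w] = (\int[P]_w tailind c (X w))%:E.
Proof.
move=> mX.
have mA : measurable [set w | c < X w].
  rewrite -[X in measurable X]setTI (_ : [set w | c < X w] = X @^-1` `]c, +oo[).
    exact: mX.
  by apply/seteqP; split => w /=; rewrite in_itv/= andbT.
rewrite -EFin_Rintegral; last first.
  apply: (@integrable_bounded _ _ _ P _ 1); first exact: measurableT_comp.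
  by move=> x; rewrite /tailind; case: ifP; rewrite ?normr1 ?normr0.
rewrite -[in LHS](setIT [set w | c < X w]) -integral_indic//; apply: eq_integral => w _.
rewrite indicE /tailind; case: ifPn => h; first by rewrite mem_set.
by rewrite memNset//=; apply/negP.
Qed.

(* Boole's inequality for the event that some Y i exceeds c, Chebyshev for the
   truncated variables. *)
Lemma truncated_deviation (Y : nat -> T -> R) (c e : R) (k : nat) :
  iid P Y -> (forall i w, 0 <= Y i w) -> 0 < c -> 0 < e -> c <= k%:R <= 2 * c ->
  (P [set w | (e * k%:R <=
    `|\sum_(i < k) Y i w - k%:R * \int[P]_w cut c (Y 0%N w)|)%R] <=
   (2 * c * (\int[P]_w tailind c (Y 0%N w)) +
    e ^- 2 * c^-1 * (\int[P]_w (cut c (Y 0%N w) ^+ 2)))%:E)%E.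
Proof.
move=> iY Y0 c0 e0 /andP[ck kc]; have [mY _ _] := iY.
have k0 : 0 < k%:R :> R by rewrite (lt_le_trans c0).
set mu := \int[P]_w cut c (Y 0%N w).
pose W i w := cut c (Y i w) - mu.
pose f (x : R) : R := cut c x - mu.
have mf : measurable_fun setT f by exact: measurable_funB.
have iW : iid P W by exact: (@iid_comp _ _ _ P _ _ _ _ Y f iY mf).
have [mW _ _] := iW.
have mcY i : measurable_fun setT (fun w => cut c (Y i w)) by exact: measurableT_comp.
have icY i : integrable (fun w => cut c (Y i w)).
  by apply: (@integrable_bounded _ _ _ P _ `|c|) => // w; exact: cut_bound.
have icY2 i : integrable (fun w => cut c (Y i w) ^+ 2).
  apply: (@integrable_bounded _ _ _ P _ (c ^+ 2)); first exact: measurable_funX.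
  by move=> w; rewrite normrX -[leRHS]real_normK ?num_real// ler_sqr ?nnegrE// cut_bound.
have EW0 : \int[P]_w W 0%N w = 0.
  rewrite RintegralB//; last exact: finite_measure_integrable_cst.
  by rewrite Rintegral_probability_cst subrr.
have iW2 : integrable (fun w => W 0%N w ^+ 2).
  apply: (@integrable_bounded _ _ _ P _ ((`|c| + `|mu|) ^+ 2)); first exact: measurable_funX.
  move=> w; rewrite normrX ler_sqr ?nnegrE// ?addr_ge0//.
  by rewrite (le_trans (ler_normB _ _))// lerD2r cut_bound.
have EW2 : \int[P]_w (W 0%N w ^+ 2) <= \int[P]_w (cut c (Y 0%N w) ^+ 2).
  have i2 : integrable (fun w => 2 * mu * W 0%N w).
    apply: (integrable_scale (2 * mu)); exact: integrable_sqr.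
  have imu : integrable (cst (mu ^+ 2)) by exact: finite_measure_integrable_cst.
  have sq w : cut c (Y 0%N w) ^+ 2 = (W 0%N w ^+ 2 + 2 * mu * W 0%N w) + mu ^+ 2.
    by rewrite /W; ring.
  under [leRHS]eq_Rintegral do rewrite sq.
  rewrite RintegralD//; last exact: (integrableD measurableT iW2 i2).
  rewrite RintegralD// RintegralZl//; last exact: integrable_sqr.
  rewrite EW0 mulr0 addr0 lerDl Rintegral_probability_cst sqr_ge0//.
have [_ _ ES2] := @iid_variance_sum _ _ _ P W k iW iW2 EW0.
pose A := \big[setU/set0]_(i < k) [set w | c < Y i w].
pose B := [set w | e * k%:R <= `|\sum_(i < k) W i w|].
have mSW : measurable_fun setT (fun w => \sum_(i < k) W i w) by exact: measurable_sum.
have mB : measurable B.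
  rewrite -[X in measurable X]setTI (_ : B = (fun w => `|\sum_(i < k) W i w|) @^-1` `[e * k%:R, +oo[).
    by apply: (measurableT_comp (@normr_measurable _ _) mSW).
  by apply/seteqP; split => w /=; rewrite in_itv/= andbT.
have mAi i : measurable [set w | c < Y i w].
  rewrite -[X in measurable X]setTI (_ : [set w | c < Y i w] = Y i @^-1` `]c, +oo[).
    exact: mY.
  by apply/seteqP; split => w /=; rewrite in_itv/= andbT.
have mA : measurable A by apply: bigsetU_measurable.
rewrite EFinD.
apply: (@le_trans _ _ (P (A `|` B))).
  apply: le_measure; rewrite ?inE.
  - rewrite -[X in measurable X]setTI (_ : [set w | _] =
      (fun w => `|\sum_(i < k) Y i w - k%:R * mu|) @^-1` `[e * k%:R, +oo[).
      apply: measurableT_comp => //; apply: measurable_funB => //.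
      exact: measurable_sum.
    by apply/seteqP; split => w /=; rewrite in_itv/= andbT.
  - exact: measurableU.
  (* Off [A] no variable exceeds [c], so truncation changes nothing and the deviation is that of the
     centered truncated sum. *)
  - move=> w /= hw; have [Aw|nAw] := pselect (A w); first by left.
    right; rewrite /B/=; apply: (le_trans hw).
    rewrite le_eqVlt; apply/orP; left; apply/eqP; congr `| _ |.
    rewrite sumrB sumr_const card_ord mulr_natl; congr (_ - _).
    apply: eq_bigr => i _; rewrite /cut; case: ifPn => //; rewrite -ltNge => h.
    exfalso; apply: nAw; rewrite /A
      -(bigcup_mkord k (fun i => [set w | c < Y i w])); exists i => //=.
(* The bound [k <= 2 * c] is spent on the union of the [k] exceedances, the bound [c <= k] on the
   variance of the sum divided by (e k)^2. *)
apply: (le_trans (measureU2 _ mA mB)); apply: leeD.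
- apply: le_trans.
    exact: (@Boole_inequality _ _ _ P (fun i => [set w | c < Y i w]) k (fun i _ => mAi i)).
  have Pi i : P [set w | c < Y i w] = (\int[P]_w tailind c (Y 0%N w))%:E.
    by rewrite (Rintegral_tailind c (mY i)) (@Rintegral_iid _ _ _ P _ _ Y (tailind c) i iY).
  rewrite (eq_bigr (fun=> (\int[P]_w tailind c (Y 0%N w))%:E)); last first.
    by move=> i _; exact: Pi.
  rewrite sumEFin sumr_const card_ord lee_fin -[_ *+ k]mulr_natl ler_wpM2r//.
  by apply: Rintegral_ge0 => w _; rewrite /tailind; case: ifP.
- apply: (le_trans (second_moment_markov P mSW (mulr_gt0 e0 k0))).
  rewrite EFin_Rintegral; last by have [] := @iid_variance_sum _ _ _ P W k iW iW2 EW0.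
  rewrite ES2 -EFinM lee_fin exprMn invfM -!mulrA ler_wpM2l ?invr_ge0 ?sqr_ge0//.
  rewrite [leLHS](_ : _ = k%:R^-1 * \int[P]_w (W 0%N w ^+ 2)); last first.
    by field; rewrite gt_eqF.
  rewrite ler_pM// ?invr_ge0 ?(ltW k0)//.
    by apply: Rintegral_ge0 => w _; exact: sqr_ge0.
  by rewrite lef_pV2 ?posrE.
Qed.

(** The probability bounds are expectations of functions of [Y 0]. Summed over [n] inside the
    expectation they are pointwise at most a constant times [Y 0] by the two geometric estimates, so
    Borel-Cantelli applies with a first moment only. *)
Let geometric_deviation_summable (Y : nat -> T -> R) (t e : R) :
  iid P Y -> (forall i w, 0 <= Y i w) -> integrable (Y 0%N) -> 0 < t -> 0 < e ->
  {ae P, forall w, \forall n \near \oo, let k := geom_index t n in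
    `|k%:R^-1 * \sum_(i < k) Y i w - \int[P]_w cut ((1 + t) ^+ n) (Y 0%N w)| < e}.
Proof.
move=> iY Y0 Y1 t0 e0; have [mY _ _] := iY.
have a1 : 1 < 1 + t by rewrite ltrDl.
have c0 n : 0 < (1 + t) ^+ n by rewrite exprn_gt0// addr_gt0.
pose k n := geom_index t n; pose c n := (1 + t) ^+ n.
have k0 n : 0 < (k n)%:R :> R by rewrite ltr0n.
pose mu n := \int[P]_w cut (c n) (Y 0%N w).
pose F n := [set w | e * (k n)%:R <= `|\sum_(i < k n) Y i w - (k n)%:R * mu n|].
have mF n : measurable (F n).
  rewrite -[X in measurable X]setTI (_ : F n =
    (fun w => `|\sum_(i < k n) Y i w - (k n)%:R * mu n|) @^-1` `[e * (k n)%:R, +oo[).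
    apply: measurableT_comp => //; apply: measurable_funB => //.
    exact: measurable_sum.
  by apply/seteqP; split => w /=; rewrite in_itv/= andbT.
pose g n (y : R) := 2 * c n * tailind (c n) y + e ^- 2 * (c n)^-1 * (cut (c n) y ^+ 2).
have icut n : integrable (fun w => cut (c n) (Y 0%N w) ^+ 2).
  apply: (@integrable_bounded _ _ _ P _ (c n ^+ 2)).
    by apply: measurable_funX; exact: measurableT_comp.
  by move=> w; rewrite normrX -[leRHS]real_normK ?num_real// ler_sqr ?nnegrE// cut_bound.
have itail n : integrable (fun w => tailind (c n) (Y 0%N w)).
  apply: (@integrable_bounded _ _ _ P _ 1); first exact: measurableT_comp.
  by move=> x; rewrite /tailind; case: ifP; rewrite ?normr1 ?normr0.
have ig n : integrable (fun w => g n (Y 0%N w)).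
  by apply: integrable_add; exact: integrable_scale.
have PF n : (P (F n) <= (\int[P]_w g n (Y 0%N w))%:E)%E.
  rewrite [leRHS](_ : _ = (2 * c n * (\int[P]_w tailind (c n) (Y 0%N w)) +
    e ^- 2 * (c n)^-1 * (\int[P]_w (cut (c n) (Y 0%N w) ^+ 2)))%:E); last first.
    congr EFin; rewrite RintegralD//; do ?exact: integrable_scale.
    by rewrite !RintegralZl.
  apply: truncated_deviation => //; rewrite (ltW (geom_index_gt _ _))/=.
  rewrite (le_trans (geom_index_le _ (ltW t0)))// mulr_natl mulr2n lerD2l.
  by rewrite exprn_ege1// ltW.
pose C := (1 + t) / ((1 + t) - 1).
have sumg N y : 0 <= y -> \sum_(n < N) g n y <= (2 * C + e ^- 2 * C) * y.
  move=> y0; rewrite big_split/= mulrDl lerD//.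
    have -> : \sum_(n < N) 2 * c n * tailind (c n) y =
        2 * \sum_(n < N) (if c n < y then c n else 0).
      rewrite mulr_sumr; apply: eq_bigr => i _; rewrite /tailind.
      by case: ifP => _; rewrite ?mulr1 ?mulr0.
    by rewrite -mulrA ler_wpM2l// (mulrC C) sum_expr_below.
  have -> : \sum_(n < N) e ^- 2 * (c n)^-1 * cut (c n) y ^+ 2 =
      e ^- 2 * (y ^+ 2 * \sum_(n < N) (if y <= c n then (c n)^-1 else 0)).
    rewrite !mulr_sumr; apply: eq_bigr => i _; rewrite /cut -mulrA; congr (_ * _).
    by case: ifP => _; rewrite ?expr0n ?mulr0// mulrC.
  rewrite -[leRHS]mulrA ler_wpM2l// ?invr_ge0 ?sqr_ge0//.
  move: y0; rewrite le_eqVlt => /predU1P[<-|y0]; first by rewrite expr0n/= mul0r mulr0.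
  rewrite (le_trans (ler_wpM2l _ (sum_exprV_above N a1 y0)))// ?sqr_ge0// -/C.
  by rewrite le_eqVlt; apply/orP; left; apply/eqP; field; rewrite gt_eqF.
have : (\sum_(n <oo) P (F n) < +oo)%E.
  apply: (@le_lt_trans _ _ ((2 * C + e ^- 2 * C) * \int[P]_w Y 0%N w)%:E); last by rewrite ltry.
  apply: lime_le; first exact: is_cvg_nneseries.
  apply: nearW => N; rewrite big_mkord.
  apply: (@le_trans _ _ (\sum_(n < N) (\int[P]_w g n (Y 0%N w))%:E)%E).
    by apply: lee_sum => i _; exact: PF.
  have [iS ES] := @Rintegral_sum _ _ _ P N (fun n w => g n (Y 0%N w)) ig.
  rewrite sumEFin lee_fin -ES -RintegralZl//; apply: le_Rintegral => //.
    exact: integrable_scale.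
  by move=> w _; exact: sumg.
move=> /(borel_cantelli mF); apply: filterS => w; apply: filterS => n /= /negP.
rewrite -ltNge => h.
rewrite [X in `|X|](_ : _ = (k n)%:R^-1 * (\sum_(i < k n) Y i w - (k n)%:R * mu n)).
  rewrite normrM ger0_norm ?invr_ge0 ?ltW// mulrC ltr_pdivrMr//.
by rewrite mulrBr mulKf// gt_eqF.
Qed.

Let slln_ge0 (Y : nat -> T -> R) :
  iid P Y -> (forall i w, 0 <= Y i w) -> integrable (Y 0%N) ->
  {ae P, forall w, n%:R^-1 * \sum_(i < n) Y i w @[n --> \oo] --> \int[P]_w Y 0%N w}.
Proof.
move=> iY Y0 Y1; have [mY _ _] := iY.
(* Rates 1/(q + 1) and tolerances 1/(j + 1) are countably many, so a single null set serves all of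
   them. *)
have : {ae P, forall w, forall q j : nat, \forall n \near \oo,
    let k := geom_index (q.+1%:R^-1 : R) n in
    `|k%:R^-1 * \sum_(i < k) Y i w -
      \int[P]_w cut ((1 + (q.+1%:R^-1 : R)) ^+ n) (Y 0%N w)| < j.+1%:R^-1}.
  apply: ae_foralln => q; apply: ae_foralln => j.
  by apply: geometric_deviation_summable.
apply: filterS => w hw.
apply: (@cvg_average_geometric _ (fun n => \sum_(i < n) Y i w)).
- exact: Rintegral_ge0.
- by move=> n; apply: sumr_ge0.
- move=> i j ij; rewrite -(big_mkord xpredT (fun i => Y i w))
    -(big_mkord xpredT (fun i => Y i w)).
  by rewrite (big_cat_nat (leq0n i) ij)/= lerDl sumr_ge0.
move=> q k.
pose t : R := q.+1%:R^-1.
have t0 : 0 < t by rewrite invr_gt0.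
(* The deviations are measured from truncated means; these tend to the true mean, since at each
   point the truncation is eventually inactive. *)
have mucvg : \int[P]_w cut ((1 + t) ^+ n) (Y 0%N w) @[n --> \oo] --> \int[P]_w Y 0%N w.
  apply: (Rdominated_cvg _ _ Y1) => //.
  - by move=> n; exact: measurableT_comp.
  - move=> v; apply: cvg_near_cst; exists (Num.truncn (Y 0%N v / t)).+1 => // n /= hn.
    rewrite /cut ifT//; apply: le_trans (bernoulli_expr _ (ltW t0)).
    rewrite (@le_trans _ _ (n%:R * t)) ?lerDr// -ler_pdivrMr//.
    by rewrite (le_trans (ltW (truncnS_gt _)))// ler_nat.
  - by move=> n v; rewrite /cut; case: ifP; rewrite ?normr0// ger0_norm.
apply/cvgrPdist_lt => e e0.
have e20 : 0 < e / 2 by rewrite divr_gt0.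
move/cvgrPdist_lt : mucvg => /(_ _ e20) mucvg.
near=> n.
pose j := Num.truncn (e / 2)^-1.
have je : j.+1%:R^-1 < e / 2.
  by rewrite -[ltRHS]invrK ltf_pV2 ?posrE ?invr_gt0// truncnS_gt.
rewrite -(subrK (\int[P]_w cut ((1 + t) ^+ n) (Y 0%N w)) (\int[P]_w Y 0%N w)) -addrA.
rewrite (le_lt_trans (ler_normD _ _))// [ltRHS](splitr e) ltrD//.
  by near: n; exact: mucvg.
rewrite distrC; apply: lt_trans je; near: n; exact: (hw q j).
Unshelve. all: by end_near. Qed.

(** The interpolation between geometric indices needs monotone partial sums, so positive and
    negative parts are treated separately. *)
Theorem strong_law_of_large_numbers (Y : nat -> T -> R) :
  iid P Y -> integrable (Y 0%N) ->
  {ae P, forall w, n%:R^-1 * \sum_(i < n) Y i w @[n --> \oo] --> \int[P]_w Y 0%N w}.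
Proof.
move=> iY Y1; have [mY _ _] := iY.
pose f (x : R) := Num.max x 0; pose g (x : R) := Num.max (- x) 0.
have mf : measurable_fun setT f by exact: measurable_maxr.
have mg : measurable_fun setT g by apply: measurable_maxr => //; exact: measurableT_comp.
have f0 x : 0 <= f x by rewrite le_max lexx orbT.
have g0 x : 0 <= g x by rewrite le_max lexx orbT.
have fg x : x = f x - g x.
  by rewrite /f /g /Num.max; case: ltP => h1; case: ltP => h2; lra.
have fle x : `|f x| <= `|x|.
  by rewrite ger0_norm// ge_max normr_ge0 ler_norm.
have gle x : `|g x| <= `|x|.
  by rewrite ger0_norm// ge_max normr_ge0 -normrN ler_norm.
have iN : integrable (fun w => `|Y 0%N w|) by exact: integrable_norm.
have i_f : integrable (fun w => f (Y 0%N w)).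
  by apply: (integrable_dominated _ _ iN) => //; exact: measurableT_comp.
have i_g : integrable (fun w => g (Y 0%N w)).
  by apply: (integrable_dominated _ _ iN) => //; exact: measurableT_comp.
have := slln_ge0 (@iid_comp _ _ _ P _ _ _ _ Y f iY mf) (fun i w => f0 _) i_f.
have := slln_ge0 (@iid_comp _ _ _ P _ _ _ _ Y g iY mg) (fun i w => g0 _) i_g.
apply: filterS2 => w hg hf.
rewrite (_ : \int[P]_w Y 0%N w = \int[P]_w f (Y 0%N w) - \int[P]_w g (Y 0%N w)); last first.
  by rewrite -RintegralB//; apply: eq_Rintegral => v _; exact: fg.
rewrite (_ : (fun n => _) = (fun n => n%:R^-1 * \sum_(i < n) f (Y i w) -
    n%:R^-1 * \sum_(i < n) g (Y i w))); first exact: cvgB.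
by apply/funext => n; rewrite -mulrBr -sumrB; congr (_ * _); apply: eq_bigr => i _; exact: fg.
Qed.

End strong_law.

(** * Central limit theorem *)

Section stein_equation.
Context (R : realType).
Local Notation mu := (@lebesgue_measure R).

Lemma is_derive_continuous (f f' : R -> R) :
  (forall x : R, is_derive x (1:R) f (f' x)) -> continuous f.
Proof.
move=> df x; apply: differentiable_continuous; apply/derivable1_diffP.
by have [] := df x.
Qed.

Lemma mean_value (f f' : R -> R) (x y : R) :
  (forall x : R, is_derive x (1:R) f (f' x)) ->
  exists c, `|c - x| <= `|y - x| /\ f y - f x = f' c * (y - x).
Proof.
move=> df; have cf := is_derive_continuous df.
have [xy|yx] := leP x y.
  have [c] := @MVT_segment R f f' x y xy (fun z _ => df z) (continuous_subspaceT cf).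
  rewrite in_itv/= => /andP[xc cy] E; exists c; split => //.
  by rewrite !ger0_norm ?subr_ge0// lerD2r.
have [c] := @MVT_segment R f f' y x (ltW yx) (fun z _ => df z) (continuous_subspaceT cf).
rewrite in_itv/= => /andP[yc cx] E; exists c; split.
  by rewrite !ler0_norm ?subr_le0 ?(ltW yx)// lerN2 lerD2r.
by rewrite -opprB E; ring.
Qed.

Lemma lipschitz_derive (f f' : R -> R) (C : R) :
  (forall x : R, is_derive x (1:R) f (f' x)) -> (forall x, `|f' x| <= C) ->
  forall x y, `|f x - f y| <= C * `|x - y|.
Proof.
move=> df fC x y; have [c [_ ->]] := @mean_value f f' y x df.
by rewrite normrM ler_wpM2r.
Qed.

Lemma bounded_compact_support (f : R -> R) (B : R) : continuous f ->
  (forall x, B <= `|x| -> f x = 0) -> exists2 C : R, 0 <= C & forall x, `|f x| <= C.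
Proof.
move=> cf f0.
pose g x := `|f x|.
have cg : continuous g by move=> x; apply: continuous_comp; [exact: cf|exact: norm_continuous].
have [B0|B0] := leP 0 B.
  have [c cB hc] := @EVT_max R g (- B) B (ge0_cp B0).2 (continuous_subspaceT cg).
  exists (g c) => [|x]; first exact: normr_ge0.
  have [/ltW xB|xB] := ltP `|x| B.
    by apply: hc; rewrite in_itv/= -ler_norml.
  by rewrite f0// normr0; exact: normr_ge0.
by exists 0 => // x; rewrite f0 ?normr0// (le_trans (ltW B0)).
Qed.

Lemma lipschitz_continuous (g : R -> R) (L : R) :
  (forall x y, `|g x - g y| <= L * `|x - y|) -> continuous g.
Proof.
move=> gL x.
have L0 : 0 <= L.
  by have := le_trans (normr_ge0 _) (gL 1 0); rewrite subr0 normr1 mulr1.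
apply/cvgrPdist_le => e e0; near=> y.
apply: (le_trans (gL x y)); apply: (@le_trans _ _ ((L + 1) * `|x - y|)).
  by rewrite ler_wpM2r// lerDl.
rewrite -ler_pdivlMl ?ltr_pwDr//.
near: y; apply: cvgr_dist_le => //.
by rewrite mulr_gt0// invr_gt0 ltr_pwDr.
Unshelve. all: by end_near. Qed.

(* The primitive F of g phi vanishes outside the support of g because g has
   Gaussian mean 0, so that f = F / phi is compactly supported. *)
Lemma stein_solution (s L G B : R) (g : R -> R) : 0 < s ->
  (forall x y, `|g x - g y| <= L * `|x - y|) ->
  (forall x, `|g x| <= G) -> (forall x, B <= `|x| -> g x = 0) ->
  \int[mu]_x (g x * normal_pdf 0 s x) = 0 ->
  exists f f' C L', [/\ (0 : R) <= C, (0 : R) <= L', forall x : R, is_derive x (1:R) f (f' x),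
    forall x, `|f x| <= C &
    [/\ forall x, `|f' x| <= C, forall x y, `|f' x - f' y| <= L' * `|x - y| &
     forall x, s ^+ 2 * f' x - x * f x = s ^+ 2 * g x]].
Proof.
move=> s0 gL gG g0 Ig.
have sn0 : s != 0 by rewrite gt_eqF.
have L0 : 0 <= L.
  by have := le_trans (normr_ge0 _) (gL 1 0); rewrite subr0 normr1 mulr1.
have G0 : 0 <= G by exact: le_trans (normr_ge0 _) (gG 0).
have cg : continuous g by exact: lipschitz_continuous gL.
pose phi := normal_pdf 0 s.
have cphi : continuous phi by exact: continuous_normal_pdf.
have mphi : measurable_fun setT phi by exact: measurable_normal_pdf.
pose h x := g x * phi x.
have ch : continuous h by move=> x; apply: cvgM; [exact: cg|exact: cphi].
have ih : mu.-integrable setT (EFin \o h).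
  apply: (@le_integrable _ _ _ mu setT measurableT _ (fun x => (G * phi x)%:E)).
  - by apply/measurable_EFinP; exact: continuous_measurable_fun.
  - move=> x _ /=; rewrite lee_fin !normrM ler_wpM2r// (ger0_norm G0).
    exact: gG.
  - under eq_fun do rewrite EFinM; apply: integrableZl => //.
    exact: integrable_normal_pdf.
have mI (i : interval R) : measurable [set` i] by exact: measurable_itv.
have ihS (i : interval R) : mu.-integrable [set` i] (EFin \o h).
  by apply: (integrableS measurableT).
pose F x := \int[mu]_(y in `]-oo, x]) h y.
have dF (x : R) : is_derive x (1:R) F (h x).
  case: (@continuous_FTC1 R h -oo%O x (x + 1) _ (ihS _) _ (ch x)) => [||d e].
  - by rewrite ltrDl.
  - by rewrite ltNyr.
  - by rewrite derive1E in e; exact: (DeriveDef d e).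
(* To the right of the support [F] is the whole integral, which is 0 by [Ig]; to the left the
   integrand is 0. *)
have FB x : B <= `|x| -> F x = 0.
  move=> Bx.
  have [x0|x0] := leP 0 x.
    rewrite ger0_norm// in Bx.
    rewrite /F Rintegral_mkcond -[RHS]Ig; apply: eq_Rintegral => y _.
    rewrite patchE; case: ifPn => // /negP yx.
    rewrite g0 ?mul0r//; have : x < y.
      by rewrite ltNge; apply/negP => yx'; apply: yx; rewrite inE/= in_itv.
    by move=> xy; rewrite ger0_norm ?(le_trans Bx) ?ltW// (le_lt_trans x0).
  rewrite ltr0_norm// in Bx.
  transitivity (\int[mu]_(y in `]-oo, x]) (0 : R)); last first.
    by rewrite Rintegral_cst// mul0r.
  apply: eq_Rintegral => y; rewrite inE/= in_itv/= => yx.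
  by rewrite /h g0 ?mul0r// ltr0_norm ?(le_lt_trans yx)// (le_trans Bx)// lerN2.
(* The reciprocal of the Gaussian density. Its logarithmic derivative x / s^2 produces the linear
   term of the Stein equation for f = F E. *)
pose E x := (normal_peak s)^-1 * expR (x ^+ 2 / (s ^+ 2 *+ 2)).
have pE x : phi x * E x = 1.
  rewrite /phi /normal_pdf (negbTE sn0) /E /normal_fun subr0.
  rewrite mulrACA mulfV ?gt_eqF ?normal_peak_gt0// mul1r -expRD mulNr addNr.
  exact: expR0.
have dE (x : R) : is_derive x (1:R) E (x / s ^+ 2 * E x).
  pose c : R := s ^+ 2 *+ 2.
  have du := is_deriveZ c^-1 (is_deriveX 2 (is_derive_id x (1 : R))).
  have dv := is_deriveZ (normal_peak s)^-1
    (is_derive1_comp (is_derive_expR _) du).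
  have -> : E = (normal_peak s)^-1 \*: (expR \o (c^-1 \*: (id ^+ 2))).
    by apply/funext => y; rewrite /E /= /GRing.scale/= /c mulrC [in RHS]mulrC (mulrC (y ^+ 2)).
  apply: (is_derive_eq dv).
  change ((normal_peak s)^-1 * (expR (c^-1 * x ^+ 2) * (c^-1 * (2 * x ^+ 1 * 1))) =
    x / s ^+ 2 * ((normal_peak s)^-1 * expR (c^-1 * x ^+ 2))).
  set p := (normal_peak s)^-1; set y := expR _; rewrite /c.
  by field.
pose f x := F x * E x.
pose f' x := g x + x / s ^+ 2 * f x.
have df (x : R) : is_derive x (1:R) f (f' x).
  apply: (is_derive_eq (is_deriveM (dF x) (dE x))).
  change (F x * (x / s ^+ 2 * E x) + E x * (g x * phi x) = f' x).
  rewrite (mulrC (E x)) -(mulrA (g x)) pE mulr1 /f' /f; ring.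
have fB x : B <= `|x| -> f x = 0 by move=> /FB; rewrite /f => ->; rewrite mul0r.
have f'B x : B <= `|x| -> f' x = 0.
  by move=> Bx; rewrite /f' fB// g0// mulr0 addr0.
have [C C0 fC] := bounded_compact_support (is_derive_continuous df) fB.
have s20 : 0 < s ^+ 2 by rewrite exprn_gt0.
(* Compact support tames the unbounded factor x. The bound has |B| because the sign of [B] is not
   prescribed. *)
have xB (u : R -> R) c : (forall x, B <= `|x| -> u x = 0) -> (forall x, `|u x| <= c) ->
    forall x, `|x * u x| <= `|B| * c.
  move=> uB uc x; have c0 : 0 <= c by rewrite (le_trans (normr_ge0 _) (uc 0)).
  have [/ltW h1|h1] := ltP `|x| B; last by rewrite uB// mulr0 normr0 mulr_ge0.
  by rewrite normrM ler_pM// (le_trans h1)// ler_norm.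
pose C' := G + `|B| * C / s ^+ 2.
have f'C x : `|f' x| <= C'.
  rewrite (le_trans (ler_normD _ _))// lerD// mulrAC normrM (normfV (s ^+ 2)).
  by rewrite (ger0_norm (ltW s20)) ler_pM2r ?invr_gt0// xB.
have C'0 : 0 <= C' by rewrite addr_ge0// divr_ge0 ?mulr_ge0// ltW.
(* Since f' = g + k / s^2, a bounded derivative of [k] makes f' Lipschitz; g is only Lipschitz, so
   f' cannot be differentiated directly. *)
pose k x := x * f x.
have dk (x : R) : is_derive x (1:R) k (f x + x * f' x).
  apply: (is_derive_eq (is_deriveM (is_derive_id x (1:R)) (df x))).
  change (x * f' x + f x * 1 = f x + x * f' x); ring.
have kC x : `|f x + x * f' x| <= C + `|B| * C'.
  by rewrite (le_trans (ler_normD _ _))// lerD// xB.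
pose L' := L + (C + `|B| * C') / s ^+ 2.
exists f, f', (Num.max C C'), L'; split => //.
- by rewrite le_max C0.
- by rewrite addr_ge0// divr_ge0 ?(ltW s20)// addr_ge0// mulr_ge0.
- by move=> x; rewrite le_max fC.
split; first by move=> x; rewrite le_max f'C orbT.
  move=> x y; have -> : f' x - f' y = (g x - g y) + (k x - k y) / s ^+ 2.
    by rewrite /f' /k; field.
  rewrite (le_trans (ler_normD _ _))// /L' [leRHS]mulrDl lerD// normrM (normfV (s ^+ 2)).
  rewrite (ger0_norm (ltW s20)) mulrAC ler_pM2r ?invr_gt0//.
  exact: lipschitz_derive.
by move=> x; rewrite /f'; field.
Qed.

End stein_equation.

Lemma cvg_inv_sqrt (R : realType) : (Num.sqrt (n%:R : R))^-1 @[n --> \oo] --> (0 : R).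
Proof.
apply/cvgrPdist_le => e e0; exists (Num.truncn (e ^- 2)).+1 => // n /= hn.
have en : e ^- 2 <= n%:R by rewrite (le_trans (ltW (truncnS_gt _)))// ler_nat.
have n0 : (0 : R) < n%:R by rewrite (lt_le_trans _ en)// invr_gt0 exprn_gt0.
rewrite sub0r normrN ger0_norm ?invr_ge0 ?sqrtr_ge0//.
rewrite -[leRHS]invrK lef_pV2 ?posrE ?invr_gt0 ?sqrtr_gt0//.
rewrite -[leLHS]ger0_norm ?invr_ge0 ?(ltW e0)// -sqrtr_sqr exprVn.
exact: ler_wsqrtr.
Qed.

(** * Stein's method for normalized sums *)

Section stein_method.
Context d (T : measurableType d) (R : realType) (P : probability T R).
Local Notation integrable X := (P.-integrable setT (EFin \o X)).

Lemma indep2_comp (X Y : T -> R) (f g : R -> R) :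
  measurable_fun setT f -> measurable_fun setT g ->
  indep2 P X Y -> indep2 P (f \o X) (g \o Y).
Proof.
move=> mf mg XY A B mA mB; apply: (XY (f @^-1` A) (g @^-1` B)).
  by rewrite -[X in measurable X]setTI; exact: mf.
by rewrite -[X in measurable X]setTI; exact: mg.
Qed.

Lemma indep2_RintegralM (X Y : T -> R) :
  measurable_fun setT X -> measurable_fun setT Y -> indep2 P X Y ->
  integrable X -> integrable Y ->
  integrable (fun w => X w * Y w) /\
  \int[P]_w (X w * Y w) = (\int[P]_w X w) * \int[P]_w Y w.
Proof.
move=> mX mY XY iX iY.
pose X' : {mfun T >-> R} := HB.pack X (isMeasurableFun.Build _ _ _ _ _ mX).
pose Y' : {mfun T >-> R} := HB.pack Y (isMeasurableFun.Build _ _ _ _ _ mY).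
exact: (@indep2_integral _ _ _ P X' Y' XY iX iY).
Qed.

(* Taylor expansion of f at V, which is independent of Y. *)
Lemma stein_term (f f' : R -> R) (C L r s2 : R) (V Y : T -> R) :
  0 <= C -> 0 <= L -> (forall x : R, is_derive x (1:R) f (f' x)) -> continuous f' ->
  (forall x, `|f x| <= C) -> (forall x, `|f' x| <= C) ->
  (forall x y, `|f' x - f' y| <= L * `|x - y|) ->
  measurable_fun setT V -> measurable_fun setT Y -> indep2 P V Y -> 0 <= r ->
  integrable (fun w => Y w ^+ 2) -> \int[P]_w Y w = 0 -> \int[P]_w (Y w ^+ 2) = s2 ->
  let W w := V w + r * Y w in
  [/\ integrable (fun w => Y w * f (W w)), integrable (fun w => f' (W w)) &
  `|\int[P]_w (Y w * f (W w)) - r * s2 * \int[P]_w f' (W w)| <=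
    r * \int[P]_w ((Y w ^+ 2 + s2) * Num.min (L * `|r * Y w|) (2 * C))].
Proof.
move=> C0 L0 df cf' fC f'C f'L mV mY VY r0 Y2 EY EY2 W.
have iY : integrable Y by exact: integrable_sqr.
have mf : measurable_fun setT f.
  by apply: continuous_measurable_fun; exact: is_derive_continuous df.
have mf' : measurable_fun setT f' by exact: continuous_measurable_fun.
have mW : measurable_fun setT W by apply: measurable_funD => //; exact: measurable_funM.
have s20 : 0 <= s2 by rewrite -EY2; apply: Rintegral_ge0 => w _; exact: sqr_ge0.
(* Both bounds on increments of f' at once: the Lipschitz one makes the remainder small as r tends
   to 0, the uniform one keeps it dominated by a multiple of Y^2 + s2. *)
pose rho (t : R) := Num.min (L * `|t|) (2 * C).
have rho0 t : 0 <= rho t by rewrite le_min !mulr_ge0.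
have mrho : measurable_fun setT (fun w => rho (r * Y w)).
  apply: measurable_minr => //; apply: measurable_funM => //.
  by apply: measurableT_comp => //; exact: measurable_funM.
have f'rho x y : `|f' x - f' y| <= rho (x - y).
  by rewrite le_min f'L/= (le_trans (ler_normB _ _))// mulr_natl mulr2n lerD.
have rho_mono x y : `|x| <= `|y| -> rho x <= rho y.
  move=> xy; rewrite /rho le_min !ge_min lexx orbT andbT.
  by rewrite ler_wpM2l.
have taylor v t : `|f (v + t) - f v - t * f' v| <= `|t| * rho t.
  have [c []] := @mean_value R f f' v (v + t) df.
  rewrite (addrC v) addrK => ct ->.
  rewrite (mulrC (f' c)) -mulrBr normrM ler_wpM2l//.
  by rewrite (le_trans (f'rho _ _))// rho_mono.
have ifV : integrable (fun w => f (V w)).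
  by apply: (@integrable_bounded _ _ _ P _ C) => //; exact: measurableT_comp.
have if'V : integrable (fun w => f' (V w)).
  by apply: (@integrable_bounded _ _ _ P _ C) => //; exact: measurableT_comp.
have if'W : integrable (fun w => f' (W w)).
  by apply: (@integrable_bounded _ _ _ P _ C) => //; exact: measurableT_comp.
have iYfW : integrable (fun w => Y w * f (W w)).
  apply: (@integrable_dominated _ _ _ P _ (fun w => C * `|Y w|)).
  - by apply: measurable_funM => //; exact: measurableT_comp.
  - by move=> w; rewrite normrM mulrC ler_wpM2r.
  - by apply: integrable_scale; exact: integrable_norm.
have idf : measurable_fun setT (@idfun R) by exact: measurable_id.
have [iYfV EYfV] := indep2_RintegralM (measurableT_comp mf mV) mY
  (indep2_comp mf idf VY) ifV iY.
have [iY2f'V EY2f'V] := indep2_RintegralM (measurableT_comp mf' mV) (measurable_funX 2 mY)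
  (@indep2_comp V Y f' (fun x => x ^+ 2) mf' (measurable_funX 2 idf) VY) if'V Y2.
split => //.
rewrite EY mulr0 in EYfV; rewrite EY2 in EY2f'V.
(* The two subtracted corrections have mean 0 by independence of [V] and [Y]. They leave the
   integral unchanged but turn the integrand into a Taylor remainder plus a difference of values of
   f'. *)
pose Q w := Y w * f (W w) - r * s2 * f' (W w) - f (V w) * Y w -
  r * (f' (V w) * Y w ^+ 2 - s2 * f' (V w)).
have iQ1 : integrable (fun w => Y w * f (W w) - r * s2 * f' (W w)).
  by apply: integrable_sub => //; exact: integrable_scale.
have iQ3 : integrable (fun w => f' (V w) * Y w ^+ 2 - s2 * f' (V w)).
  by apply: integrable_sub => //; exact: integrable_scale.
have iQ2 : integrable (fun w => Y w * f (W w) - r * s2 * f' (W w) - f (V w) * Y w).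
  exact: integrable_sub.
have iQ : integrable Q by apply: integrable_sub => //; exact: integrable_scale.
have EQ : \int[P]_w Q w = \int[P]_w (Y w * f (W w)) - r * s2 * \int[P]_w f' (W w).
  rewrite /Q RintegralB//; last exact: integrable_scale.
  rewrite RintegralB// RintegralB//; last exact: integrable_scale.
  rewrite !RintegralZl// RintegralB//; last exact: integrable_scale.
  by rewrite RintegralZl// EYfV EY2f'V; ring.
rewrite -EQ (le_trans (le_normr_Rintegral _ _))// -RintegralZl//; last first.
  apply: (@integrable_dominated _ _ _ P _ (fun w => 2 * C * (Y w ^+ 2 + s2))).
  - by apply: measurable_funM => //; apply: measurable_funD => //; exact: measurable_funX.
  - move=> w; have h : 0 <= Y w ^+ 2 + s2 by rewrite addr_ge0// sqr_ge0.
    rewrite -/(rho (r * Y w)) normrM (ger0_norm h) (ger0_norm (rho0 _)) mulrC.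
    by rewrite ler_wpM2r// /rho ge_min lexx orbT.
  - apply: integrable_scale; apply: integrable_add => //.
    exact: finite_measure_integrable_cst.
apply: le_Rintegral => //; first exact: integrable_norm.
  apply: integrable_scale.
  apply: (@integrable_dominated _ _ _ P _ (fun w => 2 * C * (Y w ^+ 2 + s2))).
  - by apply: measurable_funM => //; apply: measurable_funD => //; exact: measurable_funX.
  - move=> w; have h : 0 <= Y w ^+ 2 + s2 by rewrite addr_ge0// sqr_ge0.
    rewrite -/(rho (r * Y w)) normrM (ger0_norm h) (ger0_norm (rho0 _)) mulrC.
    by rewrite ler_wpM2r// /rho ge_min lexx orbT.
  - apply: integrable_scale; apply: integrable_add => //.
    exact: finite_measure_integrable_cst.
move=> w _; rewrite -/(rho _).
have -> : Q w = Y w * (f (W w) - f (V w) - r * Y w * f' (V w)) +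
    r * s2 * (f' (V w) - f' (W w)) by rewrite /Q; ring.
rewrite (le_trans (ler_normD _ _))//.
have -> : r * ((Y w ^+ 2 + s2) * rho (r * Y w)) =
  `|Y w| * (`|r * Y w| * rho (r * Y w)) + r * s2 * rho (r * Y w).
  by rewrite normrM (ger0_norm r0) -[Y w ^+ 2]real_normK ?num_real//; ring.
rewrite lerD//; first by rewrite normrM ler_wpM2l// taylor.
rewrite normrM (ger0_norm (mulr_ge0 r0 s20)) ler_wpM2l ?mulr_ge0//.
by rewrite distrC (le_trans (f'rho _ _))// /W (addrC (V w)) addrK.
Qed.

(** Each summand of W f(W) is expanded around the sum without it, at a cost of at most r b with r =
    1 / sqrt n. The n costs, multiplied by the outer factor r, add up to b since r^2 n = 1, and b
    tends to 0 by dominated convergence. *)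
Lemma stein_cvg (f f' : R -> R) (C L : R) (Y : nat -> T -> R) :
  0 <= C -> 0 <= L -> (forall x : R, is_derive x (1:R) f (f' x)) -> continuous f' ->
  (forall x, `|f x| <= C) -> (forall x, `|f' x| <= C) ->
  (forall x y, `|f' x - f' y| <= L * `|x - y|) ->
  iid P Y -> integrable (fun w => Y 0%N w ^+ 2) -> \int[P]_w Y 0%N w = 0 ->
  let s2 := \int[P]_w (Y 0%N w ^+ 2) in
  let W n w := (Num.sqrt n%:R)^-1 * \sum_(i < n) Y i w in
  s2 * \int[P]_w f' (W n w) - \int[P]_w (W n w * f (W n w)) @[n --> \oo] --> 0.
Proof.
move=> C0 L0 df cf' fC f'C f'L iY Y2 EY s2 W; have [mY _ _] := iY.
pose r n : R := (Num.sqrt n%:R)^-1.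
pose b n := \int[P]_w ((Y 0%N w ^+ 2 + s2) * Num.min (L * `|r n * Y 0%N w|) (2 * C)).
have s20 : 0 <= s2 by apply: Rintegral_ge0 => w _; exact: sqr_ge0.
have r0 n : 0 <= r n by rewrite invr_ge0 sqrtr_ge0.
have r_cvg : r n @[n --> \oo] --> 0 by exact: cvg_inv_sqrt.
have idf : measurable_fun setT (@idfun R) by exact: measurable_id.
have bcvg : b n @[n --> \oo] --> 0.
  rewrite -[X in _ --> X](Rintegral_probability_cst P 0).
  apply: (@Rdominated_cvg _ _ _ P _ _ (fun w => 2 * C * (Y 0%N w ^+ 2 + s2))).
  - move=> n; apply: measurable_funM.
      by apply: measurable_funD => //; exact: measurable_funX.
    apply: measurable_minr => //; apply: measurable_funM => //.
    by apply: measurableT_comp => //; exact: measurable_funM.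
  - exact: measurable_cst.
  - apply: integrable_scale; apply: integrable_add => //.
    exact: finite_measure_integrable_cst.
  - move=> w; rewrite -[X in _ --> X](mulr0 (Y 0%N w ^+ 2 + s2)).
    apply: cvgM; first exact: cvg_cst.
    apply: (@squeeze_cvgr _ _ _ _ (cst 0) (fun n => L * (r n * `|Y 0%N w|))).
    + apply: nearW => n; rewrite le_min !mulr_ge0//=.
      by rewrite ge_min normrM (ger0_norm (r0 n)) lexx.
    + exact: cvg_cst.
    + rewrite -[X in _ --> X](mulr0 L); apply: cvgM; first exact: cvg_cst.
      by rewrite -[X in _ --> X](mul0r `|Y 0%N w|); apply: cvgM => //; exact: cvg_cst.
  - move=> n w; have h : 0 <= Y 0%N w ^+ 2 + s2 by rewrite addr_ge0// sqr_ge0.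
    rewrite normrM (ger0_norm h) mulrC ler_wpM2r// ger0_norm ?le_min ?mulr_ge0//.
    by rewrite ge_min lexx orbT.
apply: norm_cvg0.
apply: (@squeeze_cvgr _ _ _ _ (cst 0) b) => //; last exact: cvg_cst.
exists 1%N => // n /= n1; rewrite normr_ge0/=.
have n0 : (0 : R) < n%:R by rewrite ltr0n.
have rr : r n * (r n * n%:R) = 1.
  by rewrite mulrA -expr2 exprVn sqr_sqrtr ?ler0n// mulVf// gt_eqF.
have main i : (i < n)%N ->
  [/\ integrable (fun w => Y i w * f (W n w)), integrable (fun w => f' (W n w)) &
   `|\int[P]_w (Y i w * f (W n w)) - r n * s2 * \int[P]_w f' (W n w)| <= r n * b n].
  move=> i_n.
  pose V w := r n * \sum_(j <- rem i (iota 0 n)) Y j w.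
  have ii : i \in iota 0 n by rewrite mem_iota.
  have WE : W n = fun w => V w + r n * Y i w.
    apply/funext => w; rewrite /W /V -mulrDr; congr (_ * _).
    rewrite -(big_mkord xpredT (fun j => Y j w)) /index_iota subn0.
    by rewrite (perm_big _ (perm_to_rem ii))/= big_cons addrC.
  have mS : measurable_fun setT (fun w => \sum_(j <- rem i (iota 0 n)) Y j w).
    exact: measurable_sum.
  have VY : indep2 P V (Y i).
    apply: (@indep2_comp (fun w => \sum_(j <- rem i (iota 0 n)) Y j w) (Y i)
      (fun x => r n * x) idfun) => //.
    - exact: measurable_funM.
    - apply: indep2_sum => //; first by rewrite rem_uniq// iota_uniq.
      by rewrite mem_rem_uniq ?iota_uniq// inE eqxx.
  have iY2 := @integrable_iid _ _ _ P _ _ Y (fun x => x ^+ 2) i iY (measurable_funX 2 idf) Y2.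
  have EYi : \int[P]_w Y i w = 0 by rewrite (@Rintegral_iid _ _ _ P _ _ Y idfun i iY).
  have EYi2 : \int[P]_w (Y i w ^+ 2) = s2.
    by rewrite (@Rintegral_iid _ _ _ P _ _ Y (fun x => x ^+ 2) i iY).
  have mV : measurable_fun setT V by exact: measurable_funM.
  have := @stein_term f f' C L (r n) s2 V (Y i) C0 L0 df cf' fC f'C f'L
    mV (mY i) VY (r0 n) iY2 EYi EYi2.
  have -> : \int[P]_w ((Y i w ^+ 2 + s2) * Num.min (L * `|r n * Y i w|) (2 * C)) = b n.
    apply: (@Rintegral_iid _ _ _ P _ _ Y
      (fun y => (y ^+ 2 + s2) * Num.min (L * `|r n * y|) (2 * C)) i iY).
    apply: measurable_funM; first exact: measurable_funD.
    apply: measurable_minr => //; apply: measurable_funM => //.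
    by apply: measurableT_comp => //; exact: measurable_funM.
  by rewrite WE.
have EW : \int[P]_w (W n w * f (W n w)) =
    r n * \sum_(i < n) \int[P]_w (Y i w * f (W n w)).
  (* [Rintegral_sum] wants integrability at every index, whereas [main] gives it only below [n]; the
     guard supplies 0 elsewhere. *)
  have E w : W n w * f (W n w) = r n * \sum_(i < n) (if (i < n)%N then Y i w * f (W n w) else 0).
    rewrite {1}/W -mulrA mulr_suml; congr (_ * _); apply: eq_bigr => i _.
    by rewrite ltn_ord.
  under eq_Rintegral do rewrite E.
  have iif i : integrable (fun w => if (i < n)%N then Y i w * f (W n w) else 0).
    case: (boolP (i < n)%N) => [i_n|_] /=; first by case: (main i i_n).
    exact: finite_measure_integrable_cst.
  have [iS ES] := @Rintegral_sum _ _ _ P n _ iif.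
  rewrite RintegralZl// ES; congr (_ * _); apply: eq_bigr => i _.
  by apply: eq_Rintegral => w _; rewrite ltn_ord.
have -> : s2 * \int[P]_w f' (W n w) - \int[P]_w (W n w * f (W n w)) =
    - (r n * \sum_(i < n) (\int[P]_w (Y i w * f (W n w)) - r n * s2 * \int[P]_w f' (W n w))).
  rewrite EW sumrB sumr_const card_ord -[_ *+ n]mulr_natl mulrBr opprB.
  by congr (_ - _); rewrite !mulrA -(mulrA (r n)) -mulrA (mulrC n%:R) rr mul1r.
rewrite normrN normrM (ger0_norm (r0 n)).
have -> : b n = r n * (\sum_(i < n) r n * b n).
  by rewrite sumr_const card_ord -[_ *+ n]mulr_natl [n%:R * _]mulrA (mulrC n%:R) mulrA rr mul1r.
rewrite ler_wpM2l// (le_trans (ler_norm_sum _ _ _))// ler_sum// => i _.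
by have [] := main i (ltn_ord i).
Qed.

End stein_method.

Lemma normr_maxr_le (R : realDomainType) (a b c : R) :
  `|Num.max c a - Num.max c b| <= `|a - b|.
Proof.
by rewrite /Num.max; case: ltP => h1; case: ltP => h2; rewrite ler_norml;
  have := ler_norm (a - b); have := ler_norm (b - a); rewrite distrC => *;
  apply/andP; split; lra.
Qed.

Lemma normr_minr_le (R : realDomainType) (a b c : R) :
  `|Num.min c a - Num.min c b| <= `|a - b|.
Proof.
by rewrite /Num.min; case: ltP => h1; case: ltP => h2; rewrite ler_norml;
  have := ler_norm (a - b); have := ler_norm (b - a); rewrite distrC => *;
  apply/andP; split; lra.
Qed.

Section central_limit.
Context d (T : measurableType d) (R : realType) (P : probability T R).
Local Notation integrable X := (P.-integrable setT (EFin \o X)).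
Local Notation mu := (@lebesgue_measure R).

Definition normalized_sum (Y : nat -> T -> R) n w :=
  (Num.sqrt n%:R)^-1 * \sum_(i < n) Y i w.

Lemma measurable_normalized_sum (Y : nat -> T -> R) n : iid P Y ->
  measurable_fun setT (normalized_sum Y n).
Proof.
by move=> [mY _ _]; apply: measurable_funM => //; exact: measurable_sum.
Qed.

Lemma normalized_sum_moment2 (Y : nat -> T -> R) n : iid P Y -> (0 < n)%N ->
  integrable (fun w => Y 0%N w ^+ 2) -> \int[P]_w Y 0%N w = 0 ->
  integrable (fun w => normalized_sum Y n w ^+ 2) /\
  \int[P]_w (normalized_sum Y n w ^+ 2) = \int[P]_w (Y 0%N w ^+ 2).
Proof.
move=> iY n0 Y2 EY; have [_ i2 e2] := @iid_variance_sum _ _ _ P Y n iY Y2 EY.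
have E w : normalized_sum Y n w ^+ 2 = n%:R^-1 * (\sum_(i < n) Y i w) ^+ 2.
  by rewrite exprMn exprVn sqr_sqrtr.
split; first by under eq_fun do rewrite E; exact: integrable_scale.
under eq_Rintegral do rewrite E.
by rewrite RintegralZl// e2 mulKf// pnatr_eq0 -lt0n.
Qed.

(** By the Stein equation g(W) = (s2 f'(W) - W f(W)) / s2, and the mean of the numerator tends to 0
    by [stein_cvg]. *)
Lemma stein_clt_compact (L G B : R) (g : R -> R) (Y : nat -> T -> R) :
  (forall x y, `|g x - g y| <= L * `|x - y|) ->
  (forall x, `|g x| <= G) -> (forall x, B <= `|x| -> g x = 0) ->
  iid P Y -> integrable (fun w => Y 0%N w ^+ 2) -> \int[P]_w Y 0%N w = 0 ->
  let s2 := \int[P]_w (Y 0%N w ^+ 2) in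
  0 < s2 -> \int[mu]_x (g x * normal_pdf 0 (Num.sqrt s2) x) = 0 ->
  \int[P]_w g (normalized_sum Y n w) @[n --> \oo] --> 0.
Proof.
move=> gL gG gB iY Y2 EY s2 s20 Ig.
have s0 : 0 < Num.sqrt s2 by rewrite sqrtr_gt0.
have [f [f' [C [L' [C0 L'0 df fC [f'C f'L eq]]]]]] := stein_solution s0 gL gG gB Ig.
rewrite sqr_sqrtr ?ltW// in eq.
have cf' : continuous f' by exact: lipschitz_continuous f'L.
have := stein_cvg C0 L'0 df cf' fC f'C f'L iY Y2 EY; rewrite -/s2.
move=> h; have {h} : s2^-1 * (s2 * \int[P]_w f' (normalized_sum Y n w) -
    \int[P]_w (normalized_sum Y n w * f (normalized_sum Y n w))) @[n --> \oo] --> s2^-1 * 0.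
  by apply: cvgM; [exact: cvg_cst|exact: h].
rewrite mulr0; apply: cvg_trans; apply: near_eq_cvg.
exists 1%N => // n /= n1; set W := normalized_sum Y n.
have mW : measurable_fun setT W by exact: measurable_normalized_sum.
have [W2 _] := normalized_sum_moment2 iY n1 Y2 EY.
have iW : integrable W by exact: integrable_sqr.
have mf : measurable_fun setT f.
  by apply: continuous_measurable_fun; exact: is_derive_continuous df.
have mf' : measurable_fun setT f' by exact: continuous_measurable_fun.
have mg : measurable_fun setT g.
  by apply: continuous_measurable_fun; exact: lipschitz_continuous gL.
have if'W : integrable (fun w => f' (W w)).
  by apply: (@integrable_bounded _ _ _ P _ C) => //; exact: measurableT_comp.
have igW : integrable (fun w => g (W w)).
  by apply: (@integrable_bounded _ _ _ P _ G) => //; exact: measurableT_comp.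
have iWfW : integrable (fun w => W w * f (W w)).
  apply: (@integrable_dominated _ _ _ P _ (fun w => C * `|W w|)).
  - by apply: measurable_funM => //; exact: measurableT_comp.
  - by move=> w; rewrite normrM mulrC ler_wpM2r.
  - by apply: integrable_scale; exact: integrable_norm.
apply: (mulfI (lt0r_neq0 s20)); rewrite mulVKf ?gt_eqF//.
rewrite -RintegralZl// -RintegralZl// -RintegralB//; last exact: integrable_scale.
by apply: eq_Rintegral => w _; rewrite eq.
Qed.

Let cutoff (A x : R) : R := Num.max 0 (Num.min 1 (A + 1 - `|x|)).

Let cutoff_itv A x : 0 <= cutoff A x <= 1.
Proof. by rewrite /cutoff le_max lexx/= ge_max ler01 ge_min lexx. Qed.

Let cutoff_lip A x y : `|cutoff A x - cutoff A y| <= `|x - y|.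
Proof.
rewrite (le_trans (normr_maxr_le _ _ _))// (le_trans (normr_minr_le _ _ _))//.
by rewrite opprB addrC addrA subrK distrC ler_dist_dist.
Qed.

Let cutoff_out A x : A + 1 <= `|x| -> cutoff A x = 0.
Proof.
by move=> Ax; apply/eqP; rewrite eq_le (andP (cutoff_itv A x)).1 andbT ge_max lexx/=
  ge_min subr_le0 Ax orbT.
Qed.

Let cutoff_in A x : `|x| <= A -> cutoff A x = 1.
Proof.
move=> Ax; apply/eqP; rewrite eq_le (andP (cutoff_itv A x)).2/= le_max.
by apply/orP; right; rewrite le_min lexx/=; lra.
Qed.

Let measurable_cutoff A : measurable_fun setT (cutoff A).
Proof.
apply: measurable_maxr => //; apply: measurable_minr => //.
by apply: measurable_funB => //; exact: normr_measurable.
Qed.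

(* The test function is (h - c) times a cutoff, with c chosen to make its
   Gaussian mean 0. *)
Lemma clt_bounded_lipschitz (L : R) (h : R -> R) (Y : nat -> T -> R) :
  (forall x y, `|h x - h y| <= L * `|x - y|) -> (forall x, `|h x| <= 1) ->
  iid P Y -> integrable (fun w => Y 0%N w ^+ 2) -> \int[P]_w Y 0%N w = 0 ->
  let s2 := \int[P]_w (Y 0%N w ^+ 2) in
  0 < s2 ->
  \int[P]_w h (normalized_sum Y n w) @[n --> \oo] -->
    \int[mu]_x (h x * normal_pdf 0 (Num.sqrt s2) x).
Proof.
move=> hL h1 iY Y2 EY s2 s20.
have mh : measurable_fun setT h.
  by apply: continuous_measurable_fun; exact: lipschitz_continuous hL.
pose s := Num.sqrt s2; pose phi := normal_pdf 0 s.
have s0 : s != 0 by rewrite gt_eqF// sqrtr_gt0.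
have mphi : measurable_fun setT phi by exact: measurable_normal_pdf.
have phi0 x : 0 <= phi x by exact: normal_pdf_ge0.
have iphi : mu.-integrable setT (EFin \o phi) by exact: integrable_normal_pdf.
have Ephi : \int[mu]_x phi x = 1 by rewrite /Rintegral integral_normal_pdf.
have ibphi (u : R -> R) c : measurable_fun setT u -> (forall x, `|u x| <= c) ->
    mu.-integrable setT (EFin \o (fun x => u x * phi x)).
  move=> mu_ uc; apply: (@le_integrable _ _ _ mu setT measurableT _ (fun x => (c * phi x)%:E)).
  - by apply/measurable_EFinP; exact: measurable_funM.
  - move=> x _ /=; rewrite lee_fin !normrM ler_wpM2r//.
    by rewrite (le_trans (uc x))// ler_norm.
  - by under eq_fun do rewrite EFinM; apply: integrableZl.
have cutoff1 A x : `|cutoff A x| <= 1.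
  by have /andP[? ?] := cutoff_itv A x; rewrite ger0_norm.
pose kap A := \int[mu]_x (cutoff A x * phi x).
have kap_cvg : kap n%:R @[n --> \oo] --> (1 : R).
  rewrite -[X in _ --> X]Ephi; apply: (@Rdominated_cvg _ _ _ mu _ _ phi) => //.
  - by move=> n; exact: (measurable_funM (measurable_cutoff _) mphi).
  - move=> x; apply: cvg_near_cst; exists (Num.truncn `|x|).+1 => // n /= hn.
    by rewrite cutoff_in ?mul1r// (le_trans (ltW (truncnS_gt _)))// ler_nat.
  - by move=> n x; rewrite normrM (ger0_norm (phi0 x)) ler_piMl.
apply/cvgrPdist_le => e e0.
(* e/6 bounds the Gaussian mass lost to the cutoff, which is counted twice because |h - c| <= 2; 1/2
   keeps [kap A] positive, so that [c] can be defined as a quotient. *)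
have e6 : 0 < Num.min (e / 6) (1 / 2) by rewrite lt_min !divr_gt0.
move/cvgrPdist_le : kap_cvg => /(_ _ e6)[N _ hN].
(* As A >= 1 and A >= 6 s2 / e, the Chebyshev bound 2 s2 / A^2 for the part outside the cutoff is at
   most e/3. *)
pose M := maxn N (Num.truncn (6 * s2 / e)).+1; pose A : R := M%:R.
have : `|1 - kap A| <= Num.min (e / 6) (1 / 2) by apply: hN; exact: leq_maxl.
rewrite le_min => /andP[kA1 kA2].
have Mb : (Num.truncn (6 * s2 / e)).+1%:R <= A by rewrite ler_nat leq_maxr.
have A1 : 1 <= A by rewrite (le_trans _ Mb)// ler1n.
have A0 : 0 < A by rewrite (lt_le_trans ltr01).
have Ae : 2 * (s2 / A ^+ 2) <= e / 3.
  have : 6 * s2 / e <= A by rewrite (le_trans _ Mb)// ltW// truncnS_gt.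
  rewrite ler_pdivrMr// => h6.
  rewrite mulrA ler_pdivrMr ?exprn_gt0// mulrAC ler_pdivlMr//.
  have : A * e <= e * A ^+ 2 by rewrite mulrC ler_wpM2l ?(ltW e0)// expr2 ler_peMl ?(ltW A0).
  by lra.
have kappos : 0 < kap A.
  by move: kA2; rewrite ler_norml => /andP[_ kA2]; lra.
have ihk : mu.-integrable setT (EFin \o (fun x => h x * cutoff A x * phi x)).
  apply: (ibphi (fun x => h x * cutoff A x) 1); first exact: measurable_funM.
  by move=> x; rewrite normrM mulr_ile1.
have ik : mu.-integrable setT (EFin \o (fun x => cutoff A x * phi x)) by exact: (ibphi _ 1).
pose c := (\int[mu]_x (h x * cutoff A x * phi x)) / kap A.
have c1 : `|c| <= 1.
  rewrite normrM normfV (ger0_norm (ltW kappos)) ler_pdivrMr// mul1r.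
  rewrite (le_trans (le_normr_Rintegral _ _))//; apply: le_Rintegral => //.
    exact: integrable_norm.
  move=> x _; rewrite !normrM (ger0_norm (phi0 x)) ler_wpM2r//.
  have /andP[k0 _] := cutoff_itv A x.
  by rewrite (ger0_norm k0) ler_piMl.
have hc2 x : `|h x - c| <= 2 by rewrite (le_trans (ler_normB _ _))// (lerD (h1 x) c1).
pose g x := (h x - c) * cutoff A x.
have mhc : measurable_fun setT (fun x => h x - c) by exact: measurable_funB.
have mg : measurable_fun setT g by exact: measurable_funM.
have gG x : `|g x| <= 2.
  by rewrite normrM -[leRHS]mulr1 ler_pM.
have gL x y : `|g x - g y| <= (L + 2) * `|x - y|.
  have -> : g x - g y = (h x - h y) * cutoff A x + (h y - c) * (cutoff A x - cutoff A y).
    by rewrite /g; ring.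
  rewrite (le_trans (ler_normD _ _))// [leRHS]mulrDl lerD// normrM.
    by rewrite -[leRHS]mulr1 ler_pM.
  by rewrite ler_pM.
have gB x : A + 1 <= `|x| -> g x = 0 by move=> /cutoff_out; rewrite /g => ->; rewrite mulr0.
have Ig : \int[mu]_x (g x * phi x) = 0.
  have -> : (fun x => g x * phi x) =
      (fun x => h x * cutoff A x * phi x - c * (cutoff A x * phi x)).
    by apply/funext => x; rewrite /g; ring.
  have ick := integrableZl measurableT c ik.
  rewrite (RintegralB measurableT ihk ick) (RintegralZl _ measurableT ik).
  by rewrite /c divfK ?gt_eqF// subrr.
have := stein_clt_compact gL gG gB iY Y2 EY s20 Ig.
move/cvgrPdist_le => /(_ (e / 3) (divr_gt0 e0 _)) [//|N' _ hN'].
exists (maxn N' 1) => // n /=; rewrite geq_max => /andP[N'n n0].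
have := hN' n N'n; rewrite /= sub0r normrN => gn.
set W := normalized_sum Y n in gn *.
have mW : measurable_fun setT W by exact: measurable_normalized_sum.
have [W2 EW2] := normalized_sum_moment2 iY n0 Y2 EY.
have ib (u : R -> R) b : measurable_fun setT u -> (forall x, `|u x| <= b) ->
    integrable (fun w => u (W w)).
  by move=> mu_ ub; apply: (@integrable_bounded _ _ _ P _ b) => //; exact: measurableT_comp.
(* Both parts split h - c as g + (h - c)(1 - cutoff). The constant [c] is the intermediate value
   between the Gaussian mean of h and its mean under the normalized sum. *)
have part1 : `|\int[mu]_x (h x * phi x) - c| <= e / 3.
  have m1k : measurable_fun setT (fun x => (h x - c) * (1 - cutoff A x)).
    by apply: measurable_funM => //; exact: measurable_funB.
  have b1k x : `|(h x - c) * (1 - cutoff A x)| <= 2.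
    have /andP[? ?] := cutoff_itv A x.
    by rewrite normrM -[leRHS]mulr1 ler_pM// ger0_norm ?subr_ge0// lerBlDr lerDl.
  have i1 := ibphi _ _ m1k b1k.
  have E : \int[mu]_x (h x * phi x) - c = \int[mu]_x ((h x - c) * (1 - cutoff A x) * phi x).
    have -> : (fun x => (h x - c) * (1 - cutoff A x) * phi x) =
       (fun x => (h x * phi x - c * phi x) - g x * phi x).
      by apply/funext => x; rewrite /g; ring.
    rewrite RintegralB//; last exact: (ibphi _ _ mg gG).
      rewrite RintegralB//; first by rewrite RintegralZl// Ephi Ig mulr1 subr0.
        exact: (ibphi _ _ mh h1).
      exact: (ibphi (cst c) `|c|).
    have := ibphi _ _ mhc hc2; congr (_.-integrable _ _).
    by apply/funext => x /=; rewrite mulrBl.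
  rewrite E (le_trans (le_normr_Rintegral _ i1))//.
  apply: (@le_trans _ _ (2 * (1 - kap A))); last first.
    by move: kA1; rewrite ler_norml => /andP[_ ?]; lra.
  have i1k := integrableB measurableT iphi ik.
  have -> : 1 - kap A = \int[mu]_x (phi x - cutoff A x * phi x).
    by rewrite (RintegralB measurableT iphi ik) Ephi.
  rewrite -(RintegralZl 2 measurableT i1k).
  have i12 := integrableZl measurableT 2 i1k.
  apply: (le_Rintegral measurableT (integrable_norm i1) i12).
  move=> x _; have /andP[? ?] := cutoff_itv A x.
  rewrite /= !normrM (ger0_norm (phi0 x)) (ger0_norm (_ : 0 <= 1 - cutoff A x)) ?subr_ge0//.
  rewrite -[leRHS](_ : 2 * (1 - cutoff A x) * phi x = _); last by ring.
  by rewrite ler_wpM2r// ler_wpM2r// subr_ge0.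
have part2 : `|c - \int[P]_w h (W w)| <= e / 3 + e / 3.
  have ig := ib g 2 mg gG.
  have i1k : integrable (fun w => (h (W w) - c) * (1 - cutoff A (W w))).
    apply: (ib (fun x => (h x - c) * (1 - cutoff A x)) 2).
      by apply: measurable_funM => //; exact: measurable_funB.
    move=> x; have /andP[? ?] := cutoff_itv A x.
    by rewrite normrM -[leRHS]mulr1 ler_pM// ger0_norm ?subr_ge0// lerBlDr lerDl.
  have ih := ib h 1 mh h1.
  have E : c - \int[P]_w h (W w) =
     - (\int[P]_w g (W w) + \int[P]_w ((h (W w) - c) * (1 - cutoff A (W w)))).
    rewrite -RintegralD// -[c in LHS](Rintegral_probability_cst P).
    rewrite -opprB -RintegralB//; last exact: finite_measure_integrable_cst.
    by congr (- _); apply: eq_Rintegral => w _; rewrite /g; ring.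
  rewrite E normrN (le_trans (ler_normD _ _))// lerD//.
  rewrite (le_trans (le_normr_Rintegral _ i1k))//; apply: le_trans Ae.
  have -> : 2 * (s2 / A ^+ 2) = 2 / A ^+ 2 * \int[P]_w (W w ^+ 2).
    by rewrite EW2 mulrCA mulrC.
  rewrite -RintegralZl//.
  apply: le_Rintegral => //; [exact: integrable_norm|exact: integrable_scale|].
  move=> w _; have /andP[k0 k1] := cutoff_itv A (W w).
  rewrite normrM (ger0_norm (_ : 0 <= 1 - cutoff A (W w))) ?subr_ge0// -mulrA ler_pM// ?subr_ge0//.
  have [WA|AW] := leP `|W w| A.
    by rewrite cutoff_in// subrr mulr_ge0 ?invr_ge0 ?sqr_ge0.
  rewrite mulrC ler_pdivlMr ?exprn_gt0//.
  apply: (@le_trans _ _ (A ^+ 2)); first by rewrite ler_piMl ?sqr_ge0// lerBlDr lerDl.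
  by rewrite -[leRHS]real_normK ?num_real// ler_sqr ?nnegrE ?(ltW A0)// ltW.
rewrite -(subrK c (\int[mu]_x (h x * phi x))) -addrA (le_trans (ler_normD _ _))//.
rewrite [leRHS](_ : e = e / 3 + (e / 3 + e / 3)); last by field.
exact: lerD.
Qed.

End central_limit.

(** * Slutsky's lemma *)

Section slutsky_portmanteau.
Context d (T : measurableType d) (R : realType) (P : probability T R).
Local Notation integrable X := (P.-integrable setT (EFin \o X)).
Local Notation mu := (@lebesgue_measure R).

(** A Lipschitz function of [y] lying between the indicators of ]-oo, x] and ]-oo, x + e]. *)
Definition ramp (x e y : R) : R := Num.max 0 (Num.min 1 ((x + e - y) / e)).

Lemma ramp_ge0 (x e y : R) : 0 <= ramp x e y.
Proof. by rewrite le_max lexx. Qed.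

Lemma ramp_le1 (x e y : R) : ramp x e y <= 1.
Proof. by rewrite ge_max ler01 ge_min lexx. Qed.

Lemma ramp_left (x e y : R) : 0 < e -> y <= x -> ramp x e y = 1.
Proof.
move=> e0 yx; apply/eqP; rewrite eq_le ramp_le1/= le_max; apply/orP; right.
by rewrite le_min lexx/= ler_pdivlMr//; lra.
Qed.

Lemma ramp_right (x e y : R) : 0 < e -> x + e <= y -> ramp x e y = 0.
Proof.
move=> e0 yx; apply/eqP; rewrite eq_le ramp_ge0 andbT ge_max lexx/= ge_min.
by apply/orP; right; rewrite ler_pdivrMr// mul0r subr_le0.
Qed.

Lemma ramp_lip (x e y z : R) : 0 < e -> `|ramp x e y - ramp x e z| <= e^-1 * `|y - z|.
Proof.
move=> e0; rewrite (le_trans (normr_maxr_le _ _ _))// (le_trans (normr_minr_le _ _ _))//.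
rewrite -mulrBl normrM normfV (ger0_norm (ltW e0)) mulrC ler_wpM2l ?invr_ge0 ?(ltW e0)//.
by rewrite opprB addrC addrA subrK distrC.
Qed.

Lemma measurable_ramp (x e : R) : measurable_fun setT (ramp x e).
Proof.
apply: measurable_maxr => //; apply: measurable_minr => //.
by apply: measurable_funM => //; exact: measurable_funB.
Qed.

Lemma measurable_le (X : T -> R) (x : R) : measurable_fun setT X ->
  measurable [set w | X w <= x].
Proof.
move=> mX; rewrite -[X in measurable X]setTI (_ : [set w | _] = X @^-1` `]-oo, x]).
  exact: mX.
by apply/seteqP; split => w /=; rewrite in_itv.
Qed.

Lemma measurable_norm_ge (X : T -> R) (x : R) : measurable_fun setT X ->
  measurable [set w | x <= `|X w|].
Proof.
move=> mX; rewrite -[X in measurable X]setTI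
  (_ : [set w | _] = (fun w => `|X w|) @^-1` `[x, +oo[).
  by apply: measurableT_comp.
by apply/seteqP; split => w /=; rewrite in_itv/= andbT.
Qed.

Lemma probability_Rintegral (A : set T) : measurable A ->
  fine (P A) = \int[P]_w \1_A w /\ integrable (\1_A : T -> R).
Proof.
move=> mA; split; last exact: integrable_indic.
by rewrite /Rintegral integral_indic// setIT.
Qed.

(** The ramp is (1/e)-Lipschitz, so where |X - W| < (r/3) e the two values differ by at most r/3.
    Elsewhere they differ by at most 1, on an event of vanishing probability. *)
Lemma slutsky_ramp (X W : nat -> T -> R) (x e I : R) : 0 < e ->
  (forall n, measurable_fun setT (X n)) -> (forall n, measurable_fun setT (W n)) ->
  (forall a, 0 < a -> P [set w | a <= `|X n w - W n w|] @[n --> \oo] --> 0%E) ->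
  \int[P]_w ramp x e (W n w) @[n --> \oo] --> I ->
  \int[P]_w ramp x e (X n w) @[n --> \oo] --> I.
Proof.
move=> e0 mX mW XW WI; apply/cvgrPdist_le => r r0.
pose a := r / 3 * e; have a0 : 0 < a by rewrite mulr_gt0 ?divr_gt0.
have r30 : 0 < r / 3 by rewrite divr_gt0.
have {}XW := XW a a0.
pose A n := [set w | a <= `|X n w - W n w|].
have mA n : measurable (A n) by apply: measurable_norm_ge; exact: measurable_funB.
have {XW} : fine (P (A n)) @[n --> \oo] --> (0 : R) by exact: fine_cvg.
move/cvgrPdist_le => /(_ _ r30); move/cvgrPdist_le : WI => /(_ _ r30) WI PA.
near=> n.
rewrite -(subrK (\int[P]_w ramp x e (W n w)) I) -addrA (le_trans (ler_normD _ _))//.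
rewrite [leRHS](_ : r = r / 3 + (r / 3 + r / 3)); last by field.
apply: lerD; first by near: n.
have ir (Y : T -> R) : measurable_fun setT Y -> integrable (fun w => ramp x e (Y w)).
  move=> mY; apply: (@integrable_bounded _ _ _ P _ 1).
    by apply: measurableT_comp => //; exact: measurable_ramp.
  by move=> w; rewrite ger0_norm ?ramp_ge0 ?ramp_le1.
have [PE iA] := probability_Rintegral (mA n).
have ic : integrable (cst (r / 3)) by exact: finite_measure_integrable_cst.
have ib := integrable_sub (ir _ (mW n)) (ir _ (mX n)).
rewrite -RintegralB//; [|exact: ir|exact: ir].
rewrite (le_trans (le_normr_Rintegral _ ib))//.
apply: (@le_trans _ _ (\int[P]_w (r / 3 + \1_(A n) w))); last first.
  rewrite RintegralD// Rintegral_probability_cst lerD2l -PE.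
  rewrite -[leLHS]ger0_norm ?fine_ge0// -normrN -[X in `|X|]sub0r.
  by near: n.
apply: le_Rintegral => //; [exact: integrable_norm|exact: integrable_add|].
move=> w _ /=; have [Aw|Aw] := pselect (A n w).
  rewrite indicE mem_set//= (le_trans (_ : _ <= 1))//; last by rewrite lerDr ltW.
  rewrite ler_norml; have := ramp_ge0 x e (W n w); have := ramp_le1 x e (W n w).
  have := ramp_ge0 x e (X n w); have := ramp_le1 x e (X n w) => *.
  by apply/andP; split; lra.
rewrite indicE memNset//= addr0 (le_trans (ramp_lip _ _ _ e0))//.
rewrite ler_pdivrMl// mulrC distrC -/a; apply: ltW.
by rewrite ltNge; apply/negP.
Unshelve. all: by end_near. Qed.

(** The indicator of X <= x lies between the ramps of width b starting at x - b and at x. Their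
    limits are at least F (x - b) and at most F (x + b), both close to F x by continuity. *)
Lemma portmanteau_ramp (X : nat -> T -> R) (F : R -> R) (x : R) :
  (forall n, measurable_fun setT (X n)) ->
  (forall y e, 0 < e -> exists2 I, F y <= I <= F (y + e) &
     \int[P]_w ramp y e (X n w) @[n --> \oo] --> I) ->
  {for x, continuous F} ->
  fine (P [set w | X n w <= x]) @[n --> \oo] --> F x.
Proof.
move=> mX hI cF; apply/cvgrPdist_le => r r0.
have r20 : 0 < r / 2 by rewrite divr_gt0.
move/cvgrPdist_le : cF => /(_ _ r20) [e /= e0 he].
pose b := e / 2; have b0 : 0 < b by rewrite divr_gt0.
have hb : `|F x - F (x + b)| <= r / 2.
  by apply: he; rewrite /ball/= opprD addNKr normrN gtr0_norm// /b; lra.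
have hb' : `|F x - F (x - b)| <= r / 2.
  by apply: he; rewrite /ball/= subKr gtr0_norm// /b; lra.
have [I1 /andP[_ I1F]] := hI x b b0.
move/cvgrPdist_le => /(_ _ r20) c1.
have [I2 /andP[FI2 _]] := hI (x - b) b b0.
move/cvgrPdist_le => /(_ _ r20) c2.
near=> n.
have mA : measurable [set w | X n w <= x] by exact: measurable_le.
have [PE iA] := probability_Rintegral mA.
have ir y : integrable (fun w => ramp y b (X n w)).
  apply: (@integrable_bounded _ _ _ P _ 1).
    by apply: measurableT_comp => //; exact: measurable_ramp.
  by move=> w; rewrite ger0_norm ?ramp_ge0 ?ramp_le1.
have up : fine (P [set w | X n w <= x]) <= \int[P]_w ramp x b (X n w).
  rewrite PE; apply: le_Rintegral => // w _; rewrite indicE.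
  have [h|h] := leP (X n w) x; first by rewrite mem_set//= ramp_left.
  by rewrite memNset ?ramp_ge0//=; apply/negP; rewrite -ltNge.
have lo : \int[P]_w ramp (x - b) b (X n w) <= fine (P [set w | X n w <= x]).
  rewrite PE; apply: le_Rintegral => // w _; rewrite indicE.
  have [h|h] := leP (X n w) x; first by rewrite mem_set//= ramp_le1.
  by rewrite ramp_right// subrK ltW.
have c1n : `|I1 - \int[P]_w ramp x b (X n w)| <= r / 2 by near: n.
have c2n : `|I2 - \int[P]_w ramp (x - b) b (X n w)| <= r / 2 by near: n.
move: hb hb' c1n c2n; rewrite !ler_norml => /andP[? ?] /andP[? ?] /andP[? ?] /andP[? ?].
by apply/andP; split; lra.
Unshelve. all: by end_near. Qed.

Lemma clt_slutsky (Y X : nat -> T -> R) : iid P Y ->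
  integrable (fun w => Y 0%N w ^+ 2) -> \int[P]_w Y 0%N w = 0 ->
  (forall n, measurable_fun setT (X n)) ->
  (forall a, 0 < a -> P [set w | a <= `|X n w - normalized_sum Y n w|] @[n --> \oo] --> 0%E) ->
  converges_in_distribution P X (centered_normal (\int[P]_w (Y 0%N w ^+ 2))).
Proof.
move=> iY Y2 EY mX XW x.
set s2 := \int[P]_w _; set nu := centered_normal s2.
have mW n := measurable_normalized_sum n iY.
have s20 : 0 <= s2 by apply: Rintegral_ge0 => w _; exact: sqr_ge0.
pose F y := fine (nu `]-oo, y]%classic).
have nuF y : nu `]-oo, y]%classic = (F y)%:E.
  by rewrite /F fineK// /nu /centered_normal; case: ifP => _; exact: fin_num_measure.
move=> cnu.
have cF : {for x, continuous F}.
  have h : (fun y => nu `]-oo, y]%classic) @ x --> (F x)%:E by rewrite -nuF; exact: cnu.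
  exact: fine_cvg h.
have hI y e : 0 < e -> exists2 I, F y <= I <= F (y + e) &
     \int[P]_w ramp y e (X n w) @[n --> \oo] --> I.
  (* Stein's equation needs positive variance. For s2 = 0 the limit law is the Dirac mass at 0, and
     Chebyshev with second moment 0 allows the normalized sum to be replaced by the constant 0. *)
  move=> e0; have [s2E|s2n0] := eqVneq s2 0.
    exists (ramp y e 0).
      rewrite /F /nu /centered_normal s2E eqxx !diracE.
      have [y0|y0] := leP 0 y.
        rewrite !mem_set/= ?in_itv//= ?ramp_left// ?lexx//.
        by rewrite addr_ge0// ltW.
      rewrite memNset/= ?ramp_ge0//=; last by rewrite in_itv/=; apply/negP; rewrite -ltNge.
      have [ye|ye] := leP 0 (y + e); first by rewrite mem_set/= ?in_itv//= ramp_le1.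
      by rewrite ramp_right// ltW.
    apply: (slutsky_ramp e0 mX mW XW).
    apply: (@slutsky_ramp (normalized_sum Y) (fun _ _ => 0)) => //.
    - move=> a a0; apply: cvg_near_cst; exists 1%N => // n /= n1.
      under eq_set do rewrite subr0.
      apply/eqP; rewrite eq_le measure_ge0 andbT.
      apply: (le_trans (second_moment_markov P (mW n) a0)).
      have [W2 EW2] := normalized_sum_moment2 iY n1 Y2 EY.
      by rewrite EFin_Rintegral// EW2 -/s2 s2E mule0.
    - under eq_fun do rewrite Rintegral_probability_cst.
      exact: cvg_cst.
  have s2pos : 0 < s2 by rewrite lt_def s2n0.
  pose phi := normal_pdf 0 (Num.sqrt s2).
  have phi0 t : 0 <= phi t by exact: normal_pdf_ge0.
  have mphi : measurable_fun setT phi by exact: measurable_normal_pdf.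
  have FE t : F t = fine (\int[mu]_(z in `]-oo, t]) (phi z)%:E)%E.
    by rewrite /F /nu /centered_normal (negbTE s2n0).
  have iphi : mu.-integrable setT (EFin \o phi) by exact: integrable_normal_pdf.
  have mI (i : interval R) : measurable [set` i] by exact: measurable_itv.
  have iS (i : interval R) : mu.-integrable setT (EFin \o (phi \_ [set` i])).
    apply: (@le_integrable _ _ _ mu setT measurableT _ (EFin \o phi)) => //.
    - apply/measurable_EFinP; apply: (iffLR (measurable_restrictT _ (mI i))).
      exact: measurable_funTS.
    - move=> z _ /=; rewrite lee_fin patchE; case: ifPn => // _.
      by rewrite normr0.
  have ir : mu.-integrable setT (EFin \o (fun z => ramp y e z * phi z)).
    apply: (@le_integrable _ _ _ mu setT measurableT _ (EFin \o phi)) => //.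
    - by apply/measurable_EFinP; apply: measurable_funM => //; exact: measurable_ramp.
    - move=> z _ /=; rewrite lee_fin normrM ler_piMl//.
      by rewrite ger0_norm ?ramp_ge0 ?ramp_le1.
  exists (\int[mu]_z (ramp y e z * phi z)).
    have FE' t : F t = \int[mu]_z (phi \_ `]-oo, t]%classic) z by rewrite FE -Rintegral_mkcond.
    rewrite !FE'; apply/andP; split; apply: (le_Rintegral measurableT) => //.
    - move=> z _; rewrite patchE; case: ifPn => [|_]; last by rewrite mulr_ge0 ?ramp_ge0.
      by rewrite inE/= in_itv/= => zy; rewrite ramp_left// mul1r.
    - move=> z _; rewrite patchE; case: ifPn => [_|]; first by rewrite ler_piMl ?ramp_le1.
      rewrite notin_setE/= in_itv/= => /negP; rewrite -ltNge => zy.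
      by rewrite ramp_right ?mul0r// ltW.
  apply: (slutsky_ramp e0 mX mW XW).
  apply: (clt_bounded_lipschitz (L := e^-1)) => //.
  - by move=> u v; exact: ramp_lip.
  - by move=> u; rewrite ger0_norm ?ramp_ge0 ?ramp_le1.
rewrite nuF.
have h := portmanteau_ramp mX hI cF.
have -> : (fun n => P [set w | X n w <= x]) = (fun n => (fine (P [set w | X n w <= x]))%:E).
  by apply/funext => n; rewrite fineK// fin_num_measure//; exact: measurable_le.
by apply: cvg_EFin => //; exact: nearW.
Qed.

End slutsky_portmanteau.

(** * Law of the importance sample *)

Section kernel_law.
Context (R : realType) (d1 d2 : measure_display).
Context (X : measurableType d1) (U : measurableType d2).
Variables (mu : {measure set X -> \bar R}) (g : X -> R) (p : R.-pker X ~> U).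
Variable (law : {measure set (X * U) -> \bar R}).
Import HBNNSimple.
Hypotheses (mg : measurable_fun setT g) (g0 : forall x, 0 <= g x).
Hypothesis lawE : forall A, measurable A ->
  law A = (\int[mu]_t ((g t)%:E * p t (xsection A t)))%E.

Let mgE : measurable_fun setT (fun t => (g t)%:E).
Proof. exact/measurable_EFinP. Qed.

Let section_integral (h : {nnsfun (X * U) >-> R}) t :
  (\int[p t]_u (h (t, u))%:E =
   \sum_(r \in range h) (r%:E * p t (xsection (h @^-1` [set r]) t)))%E.
Proof.
under eq_integral => u _ do rewrite fimfunE -fsumEFin//.
have mA r : measurable (xsection (h @^-1` [set r]) t) by exact: measurable_xsection.
have m1 r : measurable_fun setT (fun u : U => (\1_(h @^-1` [set r]) (t, u) : R)%:E).
  apply/measurable_EFinP.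
  rewrite [X in measurable_fun _ X](_ : _ = \1_(xsection (h @^-1` [set r]) t)).
    exact: measurable_indic.
  by apply/funext => u; rewrite !indicE mem_xsection.
rewrite ge0_integral_fsum//; last 2 first.
- by move=> r; under eq_fun do rewrite EFinM; apply: measurable_funeM; exact: m1.
- by move=> r u _; rewrite EFinM nnfun_muleindic_ge0.
apply: eq_fsbigr => r; rewrite inE => -[z _ <-].
under eq_integral do rewrite EFinM.
rewrite ge0_integralZl//; last by rewrite lee_fin.
congr (_ * _)%E; rewrite -[in RHS](setIT (xsection _ _)) -integral_indic//.
by apply: eq_integral => u _; rewrite !indicE mem_xsection.
Qed.

Let law_integral_nnsfun (h : {nnsfun (X * U) >-> R}) :
  (\int[law]_z (h z)%:E = \int[mu]_t ((g t)%:E * \int[p t]_u (h (t, u))%:E))%E.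
Proof.
under [in LHS]eq_integral do rewrite fimfunE -fsumEFin//.
rewrite ge0_integral_fsum//; last 2 first.
- by move=> r; exact/measurable_EFinP/measurableT_comp.
- by move=> r z _; rewrite EFinM nnfun_muleindic_ge0.
(* The index [r] ranges over all reals; a negative [r] is not a value of [h], so its section is
   empty. *)
have px0 r t : (0 <= r%:E * p t (xsection (h @^-1` [set r]) t))%E.
  have [r0|r0] := leP 0 r; first by rewrite mule_ge0.
  by rewrite preimage_nnfun0// xsection0 measure0 mule0.
have mp A : measurable A -> measurable_fun setT (fun t => p t (xsection A t)).
  by move=> mA; apply: measurable_fun_xsection_finite_kernel; rewrite inE.
under [in RHS]eq_integral => t _.
  rewrite section_integral ge0_mule_fsumr; last by move=> r; exact: px0.
  over.
rewrite ge0_integral_fsum//; last 2 first.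
- move=> r; apply: emeasurable_funM => //; apply: measurable_funeM; exact: mp.
- by move=> r t _; rewrite mule_ge0// lee_fin.
apply: eq_fsbigr => r; rewrite inE => -[z _ <-].
under eq_integral do rewrite EFinM.
rewrite ge0_integralZl//; last by rewrite lee_fin.
rewrite integral_indic// setIT lawE//.
rewrite -ge0_integralZl//.
- by apply: eq_integral => t _; rewrite muleCA.
- by apply: emeasurable_funM => //; exact: mp.
- by move=> t _; rewrite mule_ge0// lee_fin.
- by rewrite lee_fin.
- exact/measurable_EFinP/measurable_indic.
Qed.

Lemma measurable_kernel_integral (f : X * U -> \bar R) : measurable_fun setT f ->
  (forall z, 0 <= f z)%E -> measurable_fun setT (fun t => (\int[p t]_u f (t, u))%E).
Proof. by move=> mf f0; exact: (@measurable_fun_integral_finite_kernel _ _ _ _ _ f p f0 mf). Qed.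

(** Simple functions increase to [f], and monotone convergence is applied to the joint law on one
    side and successively to [p t] and [mu] on the other. *)
Lemma law_integral (f : X * U -> \bar R) : measurable_fun setT f ->
  (forall z, 0 <= f z)%E ->
  (\int[law]_z f z = \int[mu]_t ((g t)%:E * \int[p t]_u f (t, u)))%E.
Proof.
move=> mf f0.
pose f_ := nnsfun_approx measurableT mf.
have mf_ n t : measurable_fun setT (fun u => (f_ n (t, u))%:E).
  by apply/measurable_EFinP; exact: measurableT_comp.
have nd_f_ : forall z (a b : nat), (a <= b)%N -> ((f_ a z)%:E <= (f_ b z)%:E)%E.
  by move=> z a b ab; rewrite lee_fin; exact/lefP/nd_nnsfun_approx.
have cf_ z : (f_ n z)%:E @[n --> \oo] --> f z by exact: cvg_nnsfun_approx.
transitivity (\int[law]_z (limn (fun n => (f_ n z)%:E)))%E.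
  by apply/eq_integral => z _; apply/esym/cvg_lim.
rewrite monotone_convergence//; last 3 first.
- by move=> n; exact/measurable_EFinP.
- by move=> n z _; rewrite lee_fin.
- by move=> z _ a b; exact: nd_f_.
rewrite (_ : (fun _ => _) =
    (fun n => \int[mu]_t ((g t)%:E * \int[p t]_u (f_ n (t, u))%:E)))%E; last first.
  by apply/funext => n; rewrite law_integral_nnsfun.
have mI n : measurable_fun setT (fun t => (\int[p t]_u (f_ n (t, u))%:E)%E).
  apply: (measurable_kernel_integral (f := fun z => (f_ n z)%:E)).
    exact/measurable_EFinP.
  by move=> z; rewrite lee_fin.
have I0 n t : (0 <= \int[p t]_u (f_ n (t, u))%:E)%E.
  by apply: integral_ge0 => u _; rewrite lee_fin.
have ndI t (a b : nat) : (a <= b)%N ->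
    (\int[p t]_u (f_ a (t, u))%:E <= \int[p t]_u (f_ b (t, u))%:E)%E.
  move=> ab; apply: ge0_le_integral => //.
  - by move=> u _; rewrite lee_fin.
  - by move=> u _; exact: nd_f_.
rewrite -monotone_convergence//; last 3 first.
- by move=> n; exact: emeasurable_funM.
- by move=> n t _; rewrite mule_ge0// lee_fin.
- by move=> t _ a b ab; rewrite lee_wpmul2l// ?lee_fin//; exact: ndI.
apply: eq_integral => t _.
have h : (\int[p t]_u (f_ n (t, u))%:E)%E @[n --> \oo] --> (\int[p t]_u f (t, u))%E.
  rewrite (_ : \int[p t]_u f (t, u) = \int[p t]_u (limn (fun n => (f_ n (t, u))%:E)))%E; last first.
    by apply/eq_integral => u _; apply/esym/cvg_lim.
  apply: cvg_monotone_convergence => //.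
  - by move=> n u _; rewrite lee_fin.
  - by move=> u _ a b ab; exact: nd_f_.
by apply/cvg_lim => //; exact: cvgeZl.
Qed.

End kernel_law.

(** * Measurability of the debiased likelihood estimator *)

Section likelihood_estimator_measurable.
Context (R : realType) (d : nat) (dX : measure_display) (X : measurableType dX).
Implicit Types (D : design R d) (sobs : d.-tuple R).

Lemma measurable_vec_sub sobs : measurable_fun setT (vec_sub ^~ sobs).
Proof.
apply/measurable_fun_tnthP => i.
rewrite (_ : _ \o _ = fun s => tnth s i - tnth sobs i).
  by apply: measurable_funB => //; exact: measurable_tnth.
by apply/funext => s; rewrite /= tnth_mktuple.
Qed.

Lemma measurable_scaled_kernel (K : d.-tuple R -> R) e :
  measurable_fun setT K -> measurable_fun setT (scaled_kernel K e).
Proof.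
move=> mK; apply: measurable_funM => //; apply: measurableT_comp => //.
apply/measurable_fun_tnthP => i.
rewrite (_ : _ \o _ = fun s => tnth s i / e).
  by apply: measurable_funM => //; exact: measurable_tnth.
by apply/funext => s; rewrite /= tnth_mktuple.
Qed.

Lemma measurable_zeta D sobs (S : nat -> nat -> X -> d.-tuple R) k :
  measurable_fun setT (kern D) ->
  (forall k i, measurable_fun setT (S k i)) ->
  measurable_fun setT (fun x => zeta D sobs (fun k i => S k i x) k).
Proof.
move=> mK mS; apply: measurable_funM => //; apply: measurable_sum => i.
apply: measurableT_comp; first exact: measurable_scaled_kernel.
exact: (measurableT_comp (measurable_vec_sub sobs) (mS k i)).
Qed.

(** The debiased sum has a random number of terms; the countably many values of [T] partition the
    preimage. *)
Lemma measurable_stopped (f : nat -> X -> R) (T : X -> nat) :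
  (forall n, measurable_fun setT (f n)) -> measurable_fun setT T ->
  measurable_fun setT (fun x => f (T x) x).
Proof.
move=> mf mT _ A mA; rewrite setTI.
rewrite (_ : _ @^-1` _ = \bigcup_n (T @^-1` [set n] `&` f n @^-1` A)).
  apply: bigcupT_measurable => n; apply: measurableI.
    by rewrite -[X in measurable X]setTI; exact: mT.
  by rewrite -[X in measurable X]setTI; exact: mf.
apply/seteqP; split => [x Ax|x [n _ [/= Tn]]]; last by rewrite -Tn.
by exists (T x).
Qed.

Lemma measurable_likelihood_estimator D sobs
    (S : 'I_(nrep D) -> nat -> nat -> X -> d.-tuple R)
    (T : 'I_(nrep D) -> X -> nat) :
  measurable_fun setT (kern D) ->
  (forall r k i, measurable_fun setT (S r k i)) ->
  (forall r, measurable_fun setT (T r)) ->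
  measurable_fun setT (likelihood_estimator sobs S T).
Proof.
move=> mK mS mT; apply: measurable_funM => //; apply: measurable_sum => r.
apply: (@measurable_stopped (fun n x => debiased D
  (zeta D sobs (fun k i => S r k i x)) n)) => // n.
apply: measurable_funD; first exact: measurable_zeta.
apply: measurable_sum => k; apply: measurable_funM => //.
by apply: measurable_funB; exact: measurable_zeta.
Qed.

End likelihood_estimator_measurable.

Section sample_law.
Context (R : realType) (dT dU dO : measure_display).
Context (Theta : measurableType dT) (U : measurableType dU).
Context (Omega : measurableType dO).
Variables (mu : {measure set Theta -> \bar R}) (g : Theta -> R).
Variables (p : R.-pker Theta ~> U) (P : probability Omega R).
Variable Z : nat -> Omega -> Theta * U.
Hypotheses (dg : density mu g) (sZ : iid_sample mu g p P Z).

Lemma iid_sample_iid : iid P Z.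
Proof.
have [mZ lawZ iZ] := sZ.
by split=> // i A mA; rewrite !lawZ.
Qed.

Lemma sample_integral (f : Theta * U -> \bar R) : measurable_fun setT f ->
  (forall z, 0 <= f z)%E ->
  (\int[P]_o f (Z 0%N o) = \int[mu]_t ((g t)%:E * \int[p t]_u f (t, u)))%E.
Proof.
have [mg g0 _] := dg; have [mZ lawZ _] := sZ => mf f0.
rewrite -(law_integral (law := pushforward P (Z 0%N)) mg g0 (lawZ 0%N))//.
by rewrite ge0_integral_pushforward.
Qed.

Let sample_Rintegral_ge0 (f : Theta * U -> R) : measurable_fun setT f ->
  (forall z, 0 <= f z) ->
  (forall t, (p t).-integrable setT (fun u => (f (t, u))%:E)) ->
  P.-integrable setT (fun o => (f (Z 0%N o))%:E) ->
  mu.-integrable setT (fun t => (g t * \int[p t]_u f (t, u))%:E) /\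
  \int[P]_o f (Z 0%N o) = \int[mu]_t (g t * \int[p t]_u f (t, u)).
Proof.
have [mg g0 _] := dg => mf f0 intf intZ.
have mfE : measurable_fun setT (fun z => (f z)%:E) by exact/measurable_EFinP.
have fE0 z : (0 <= (f z)%:E)%E by rewrite lee_fin.
have E t : ((g t)%:E * \int[p t]_u (f (t, u))%:E)%E =
    (g t * \int[p t]_u f (t, u))%:E.
  by rewrite EFinM /Rintegral fineK//; exact: integrable_fin_num.
have mI : measurable_fun setT (fun t => (g t * \int[p t]_u f (t, u))%:E).
  under eq_fun do rewrite -E.
  apply: emeasurable_funM; first exact/measurable_EFinP.
  exact: (measurable_kernel_integral p mfE).
have := sample_integral mfE fE0; under [RHS]eq_integral do rewrite E.
move=> eI; split; last by rewrite /Rintegral eI.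
apply/integrableP; split=> //.
under eq_integral => t _.
  rewrite gee0_abs; last first.
    by rewrite lee_fin mulr_ge0// Rintegral_ge0.
  over.
rewrite -eI; have /integrableP[_] := intZ.
by under eq_integral do rewrite gee0_abs//.
Qed.

(** For signed integrands the nonnegative formula is applied to both parts; integrability under each
    [p t] and under [P] is what allows subtracting the results. *)
Lemma sample_Rintegral (f : Theta * U -> R) : measurable_fun setT f ->
  (forall t, (p t).-integrable setT (fun u => (f (t, u))%:E)) ->
  P.-integrable setT (fun o => (f (Z 0%N o))%:E) ->
  mu.-integrable setT (fun t => (g t * \int[p t]_u f (t, u))%:E) /\
  \int[P]_o f (Z 0%N o) = \int[mu]_t (g t * \int[p t]_u f (t, u)).
Proof.
move=> mf intf intZ; have [mZ _ _] := sZ.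
pose fp z := Num.max (f z) 0; pose fm z := Num.max (- f z) 0.
have fE z : f z = fp z - fm z.
  rewrite /fp /fm; case/orP: (le_total 0 (f z)) => f0.
    by rewrite max_l// max_r ?oppr_le0// subr0.
  by rewrite max_r// max_l ?opprK ?add0r// oppr_ge0.
have fp0 z : 0 <= fp z by rewrite le_max lexx orbT.
have fm0 z : 0 <= fm z by rewrite le_max lexx orbT.
have fpf z : `|fp z| <= `|f z|.
  by rewrite ger0_norm// ge_max ler_norm normr_ge0.
have fmf z : `|fm z| <= `|f z|.
  by rewrite ger0_norm// ge_max -normrN ler_norm normr_ge0.
have mfp : measurable_fun setT fp by exact: measurable_maxr.
have mfm : measurable_fun setT fm by apply: measurable_maxr => //; exact: measurableT_comp.
have dom (dY : measure_display) (Y : measurableType dY)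
    (nu : {measure set Y -> \bar R}) (c : Y -> Theta * U) (h : Theta * U -> R) :
    measurable_fun setT c -> measurable_fun setT h -> (forall z, `|h z| <= `|f z|) ->
    nu.-integrable setT (fun y => (f (c y))%:E) ->
    nu.-integrable setT (fun y => (h (c y))%:E).
  move=> mc mh hf; apply: le_integrable => //.
    by apply/measurable_EFinP; exact: measurableT_comp.
  by move=> y _; rewrite !abse_EFin lee_fin.
have mpair (t : Theta) : measurable_fun setT (fun u : U => (t, u)).
  exact: pair1_measurable.
have ip t : (p t).-integrable setT (fun u => (fp (t, u))%:E) by exact: dom.
have im t : (p t).-integrable setT (fun u => (fm (t, u))%:E) by exact: dom.
have ipZ : P.-integrable setT (fun o => (fp (Z 0%N o))%:E) by exact: dom.
have imZ : P.-integrable setT (fun o => (fm (Z 0%N o))%:E) by exact: dom.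
have [jp ep] := sample_Rintegral_ge0 mfp fp0 ip ipZ.
have [jm em] := sample_Rintegral_ge0 mfm fm0 im imZ.
have fI t : g t * \int[p t]_u f (t, u) =
    g t * \int[p t]_u fp (t, u) - g t * \int[p t]_u fm (t, u).
  rewrite -mulrBr -RintegralB//.
  by congr (_ * _); apply: eq_Rintegral => u _; rewrite fE.
split; first by under eq_fun do rewrite fI EFinB; exact: integrableB.
under eq_Rintegral do rewrite fE.
rewrite (RintegralB measurableT ipZ imZ) ep em -(RintegralB measurableT jp jm).
by apply: eq_Rintegral => t _; rewrite fI.
Qed.

End sample_law.

(** The inverse of x is x times the power -1 of x^2, which is measurable. The identity also holds at
    0, where both sides are 0 by convention. *)
Lemma measurable_invr (R : realType) (dX : measure_display) (X : measurableType dX)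
  (f : X -> R) : measurable_fun setT f -> measurable_fun setT (fun x => (f x)^-1).
Proof.
move=> mf; rewrite (_ : (fun _ => _) = fun x => f x * ((f x ^+ 2) `^ (-1))).
  apply: measurable_funM => //.
  apply: (@measurableT_comp _ _ _ _ _ _ (fun y : R => y `^ (-1)) _ (fun x => f x ^+ 2)).
    exact: measurable_powR.
  exact: measurable_funX.
apply/funext => x; rewrite powR_inv1 ?sqr_ge0//.
have [->|fx0] := eqVneq (f x) 0; first by rewrite invr0 mul0r.
by rewrite expr2 invfM mulrA divff// mul1r.
Qed.

(** * Estimators *)

(* A convergent average forces x n = o(n), and then x i ^+ 2 <= eps n x i for
   all but finitely many i < n. *)
Lemma cvg_mean_sqr (R : realType) (x : R^nat) (k : R) : (forall n, 0 <= x n) ->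
  n%:R^-1 * \sum_(i < n) x i @[n --> \oo] --> k ->
  n%:R^-1 * (n%:R^-1 * \sum_(i < n) x i ^+ 2) @[n --> \oo] --> (0 : R).
Proof.
move=> x0 xk.
pose a n := n%:R^-1 * \sum_(i < n) x i.
have invn : (n%:R^-1 : R) @[n --> \oo] --> (0 : R).
  by rewrite -(cvg_shiftS (fun n => n%:R^-1 : R)); exact: cvg_harmonic.
have s0 n : 0 <= \sum_(i < n) x i by apply: sumr_ge0 => i _.
have a0 n : 0 <= a n by rewrite mulr_ge0// invr_ge0.
(* One term is the difference of two consecutive partial sums, so the common limit of the averages
   cancels and x n / (n + 1) tends to 0. *)
have aS n : x n / n.+1%:R = a n.+1 - a n * (1 - n.+1%:R^-1).
  rewrite /a big_ord_recr/= mulrDr; set s := \sum_(_ < n) _.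
  have [n0|n0] := posnP n.
    by rewrite /s n0 big_ord0 !mulr0 mul0r add0r subr0 mulrC.
  have n1 : (n%:R : R) != 0 by rewrite pnatr_eq0 -lt0n.
  have n2 : (n.+1%:R : R) != 0 by rewrite pnatr_eq0.
  by rewrite -natr1 in n2 *; field; rewrite n1 n2.
have xn : (x n / n.+1%:R) @[n --> \oo] --> (0 : R).
  rewrite (_ : (fun n => _) = fun n => a n.+1 - a n * (1 - n.+1%:R^-1)); last first.
    exact/funext.
  rewrite [X in _ --> X](_ : 0 = k - k * (1 - 0)); last by rewrite subr0 mulr1 subrr.
  apply: cvgB; first by rewrite (cvg_shiftS a).
  apply: cvgM => //; apply: cvgB; [exact: cvg_cst|exact: cvg_harmonic].
apply/cvgr0Pnorm_lt => eps eps0.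
(* [K] eventually bounds the averages, so the terms beyond [N] contribute at most del K = eps / 2;
   the first [N] terms form a constant divided by n^2. *)
pose K := `|k| + 1; have K0 : 0 < K by rewrite ltr_wpDl.
pose del := eps / 2 / K; have del0 : 0 < del by rewrite !divr_gt0.
have /cvgr0Pnorm_lt/(_ _ del0)[N _ hN] := xn.
pose C := \sum_(i < N) x i ^+ 2.
have sumN j : \sum_(i < N + j) x i ^+ 2 <=
    C + del * ((N + j)%:R * \sum_(i < N + j) x i).
  elim: j => [|j IH].
    by rewrite addn0 lerDl mulr_ge0 ?(ltW del0)// mulr_ge0.
  rewrite addnS !big_ord_recr/=; set n := (N + j)%N in IH *.
  have xndel : x n <= del * n.+1%:R.
    rewrite -ler_pdivrMr//; apply: le_trans (ler_norm _) (ltW (hN n _)).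
    exact: leq_addr.
  rewrite -natr1 in xndel *.
  have h1 : x n ^+ 2 <= del * (n%:R + 1) * x n by rewrite expr2 ler_wpM2r.
  have h2 : 0 <= del * \sum_(i < n) x i by rewrite mulr_ge0 ?(ltW del0).
  move: IH h1 h2; move: (\sum_(i < n) x i) (\sum_(i < n) _) => s T.
  lra.
have CN : (n%:R^-1 * (n%:R^-1 * C)) @[n --> \oo] --> (0 : R).
  rewrite -[X in _ --> X](mul0r (0 * C)); apply: cvgM => //.
  by apply: cvgM => //; exact: cvg_cst.
have /cvgr0Pnorm_lt/(_ (eps / 2) _)[|N1 _ hN1] := CN; first by rewrite divr_gt0.
have /cvgrPdist_lt/(_ 1 ltr01)[N2 _ hN2] := xk.
exists (maxn N.+1 (maxn N1 N2)) => // n /=; rewrite !geq_max => /and3P[nN nN1 nN2].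
have n0 : 0 < (n%:R : R) by rewrite ltr0n (leq_trans _ nN).
have aK : a n <= K.
  rewrite -[leLHS](subrK k) addrC; apply: lerD; first exact: ler_norm.
  by apply: le_trans (ler_norm _) _; rewrite distrC; exact/ltW/(hN2 n nN2).
have hC := le_lt_trans (ler_norm _) (hN1 n nN1).
rewrite ger0_norm; last first.
  by rewrite !mulr_ge0 ?invr_ge0// sumr_ge0// => i _; rewrite sqr_ge0.
have := sumN (n - N)%N; rewrite subnKC ?(ltnW nN)// => hs.
apply: (@le_lt_trans _ _ (n%:R^-1 * (n%:R^-1 * C) + del * a n)).
  rewrite (_ : _ + _ = n%:R^-1 * (n%:R^-1 * (C + del * (n%:R * \sum_(i < n) x i)))).
    by rewrite !ler_wpM2l ?invr_ge0.
  by rewrite /a; field; rewrite gt_eqF.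
rewrite [ltRHS](splitr eps) ltr_leD//.
by apply: (@le_trans _ _ (del * K)); rewrite ?ler_wpM2l ?(ltW del0)// /del divfK// gt_eqF.
Qed.

Section mean_estimator_limit.
Context (R : realType) (dT dU dO : measure_display).
Context (Theta : measurableType dT) (U : measurableType dU).
Context (Omega : measurableType dO).
Variables (P : probability Omega R) (phi : Theta -> R) (w : Theta * U -> R).
Variables (Z : nat -> Omega -> Theta * U) (e m : R).
Hypotheses (iZ : iid P Z) (mphi : measurable_fun setT phi).
Hypotheses (mw : measurable_fun setT w) (e0 : e != 0).
Hypothesis int_w : P.-integrable setT (fun o => (w (Z 0%N o))%:E).
Hypothesis mean_w : \int[P]_o w (Z 0%N o) = e.

Lemma evidence_estimator_cvg :
  {ae P, forall o, evidence_estimator w Z M o @[M --> \oo] --> e}.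
Proof.
rewrite -mean_w.
exact: (strong_law_of_large_numbers (iid_comp iZ mw) int_w).
Qed.

Lemma measurable_evidence_estimator M :
  measurable_fun setT (evidence_estimator w Z M).
Proof.
have [mZ _ _] := iZ.
apply: measurable_funM => //; apply: measurable_sum => i.
exact: measurableT_comp.
Qed.

Lemma measurable_mean_estimator M :
  measurable_fun setT (mean_estimator phi w Z M).
Proof.
have [mZ _ _] := iZ.
apply: measurable_funM; last first.
  by apply: measurable_invr; exact: measurable_evidence_estimator.
apply: measurable_funM => //; apply: measurable_sum => i.
apply: measurable_funM; last exact: measurableT_comp.
by apply: measurableT_comp => //; exact: measurableT_comp.
Qed.

Lemma measurable_variance_estimator M :
  measurable_fun setT (variance_estimator phi w Z M).
Proof.
have [mZ _ _] := iZ.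
apply: measurable_funM.
  apply: measurable_invr; apply: measurable_funM => //.
  by apply: measurable_funX; exact: measurable_evidence_estimator.
apply: measurable_sum => i; apply: measurable_funM; apply: measurable_funX.
  apply: measurable_funB; last exact: measurable_mean_estimator.
  by apply: measurableT_comp => //; exact: measurableT_comp.
exact: measurableT_comp.
Qed.

Lemma mean_estimator_cvg :
  P.-integrable setT (fun o => (phi (Z 0%N o).1 * w (Z 0%N o))%:E) ->
  \int[P]_o (phi (Z 0%N o).1 * w (Z 0%N o)) = e * m ->
  {ae P, forall o, mean_estimator phi w Z M o @[M --> \oo] --> m}.
Proof.
move=> int_phiw mean_phiw.
have mphiw : measurable_fun setT (fun z => phi z.1 * w z).
  by apply: measurable_funM => //; exact: measurableT_comp.
have := strong_law_of_large_numbers (iid_comp iZ mphiw) int_phiw.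
have := evidence_estimator_cvg.
apply: filterS2 => o ew; rewrite mean_phiw => ephiw.
rewrite -[X in _ --> X](mulKf e0) [X in _ --> X]mulrC.
by apply: cvgM => //; exact: cvgV.
Qed.

Let yf (z : Theta * U) := (phi z.1 - m) * w z / e.
Let Y n o := yf (Z n o).
Hypothesis int_Y2 : P.-integrable setT (fun o => (Y 0%N o ^+ 2)%:E).
Hypothesis mean_Y : \int[P]_o Y 0%N o = 0.

Let iY : iid P Y.
Proof.
apply: (iid_comp iZ).
apply: measurable_funM => //; apply: measurable_funM => //.
by apply: measurable_funB => //; exact: measurableT_comp.
Qed.

(** The error of the ratio is the average of (phi - m) w over the average of w; [Y] is normalized by
    the limit [e] of that denominator, whence the factor e / a. *)
Let mean_estimator_error M o : evidence_estimator w Z M o != 0 ->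
  Num.sqrt M%:R * (mean_estimator phi w Z M o - m) =
  normalized_sum Y M o * (e / evidence_estimator w Z M o).
Proof.
move=> a0.
have -> : normalized_sum Y M o = Num.sqrt M%:R *
    (M%:R^-1 * \sum_(i < M) phi (Z i o).1 * w (Z i o) -
     m * evidence_estimator w Z M o) / e.
  rewrite /normalized_sum /evidence_estimator.
  have -> : (Num.sqrt M%:R)^-1 = Num.sqrt M%:R * M%:R^-1 :> R.
    have [->|M0] := posnP M; first by rewrite !sqrtr0 !invr0 mulr0.
    have q0 : Num.sqrt M%:R != 0 :> R by rewrite gt_eqF// sqrtr_gt0 ltr0n.
    by apply: (mulfI q0); rewrite divff// mulrA -expr2 sqr_sqrtr// divff// pnatr_eq0 -lt0n.
  rewrite -!mulrA; congr (_ * _); rewrite mulrCA -mulrBr -mulrA; congr (_ * _).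
  rewrite mulr_sumr -sumrB mulr_suml; apply: eq_bigr => i _.
  by rewrite /Y /yf; ring.
rewrite /mean_estimator; move: M%:R^-1 => Mi; field.
by rewrite a0 e0.
Qed.

(* On [|S n| < A] the bad event is eventually empty, and Chebyshev bounds the
   rest uniformly in [n]. *)
Let tight_cvg0 (E : nat -> set Omega) : (forall n, measurable (E n)) ->
  (forall A : R, 0 < A -> {ae P, forall o, \forall n \near \oo,
     `|normalized_sum Y n o| < A -> ~ E n o}) ->
  P (E n) @[n --> \oo] --> 0%E.
Proof.
move=> mE hE; apply/fine_cvgP; split.
  by apply: nearW => n; exact: fin_num_measure.
have mS n := measurable_normalized_sum n iY.
set s2 : R := \int[P]_o (Y 0%N o ^+ 2).
have s20 : 0 <= s2 by apply: Rintegral_ge0 => o _; exact: sqr_ge0.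
apply/cvgr0Pnorm_lt => eps eps0.
(* Chebyshev then bounds the excluded event by (eps / 2) s2 / (s2 + 1); adding 1 keeps [A] positive
   when s2 = 0 and makes the bound strictly less than eps / 2. *)
pose A := Num.sqrt (2 * (s2 + 1) / eps).
have A20 : 0 < 2 * (s2 + 1) / eps by rewrite divr_gt0// mulr_gt0// ltr_wpDl.
have A0 : 0 < A by rewrite sqrtr_gt0.
have A2 : A ^+ 2 = 2 * (s2 + 1) / eps by rewrite sqr_sqrtr// ltW.
pose G n := [set o | A <= `|normalized_sum Y n o|].
have mG n : measurable (G n) by exact: measurable_norm_ge.
have PG n : (0 < n)%N -> fine (P (G n)) < eps / 2.
  move=> n0; have [iS eS] := normalized_sum_moment2 iY n0 int_Y2 mean_Y.
  have := @second_moment_markov _ _ _ P _ _ (mS n) A0.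
  rewrite (EFin_Rintegral iS) eS -/s2 -/(G n) -EFinM -(fineK (fin_num_measure P _ (mG n))).
  rewrite lee_fin => /le_lt_trans; apply; rewrite mulrC ltr_pdivrMr ?exprn_gt0//.
  rewrite A2 (_ : eps / 2 * _ = s2 + 1); first by rewrite ltrDl.
  by rewrite mulrA [eps / 2 * _]mulrA divfK// mulrAC divff ?mul1r// gt_eqF.
have mF n : measurable (E n `\` G n) by exact: measurableD.
have /fine_cvgP[_ /cvgr0Pnorm_lt/(_ (eps / 2) _)[|N _ hN]] :
    P (E n `\` G n) @[n --> \oo] --> 0%E.
- apply: ae_eventually_cvg0 => //.
  have := hE A A0; apply: filterS => o; apply: filterS => n h [/h + /negP].
  by rewrite -ltNge.
- by rewrite divr_gt0.
exists N.+1 => // n /= nN; have := hN n (ltnW nN).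
rewrite !ger0_norm ?fine_ge0// => hF.
have : (P (E n) <= P (E n `\` G n) + P (G n))%E.
  rewrite -measureU//; last by rewrite setDKI.
  rewrite le_measure ?inE//; first exact: measurableU.
  by move=> o Eo; have [Go|Go] := pselect (G n o); [right|left].
rewrite -(fineK (fin_num_measure P _ (mE n))) -(fineK (fin_num_measure P _ (mF n))).
rewrite -(fineK (fin_num_measure P _ (mG n))) lee_fin => /le_lt_trans; apply.
by rewrite [ltRHS](splitr eps) ltrD// PG// (leq_ltn_trans _ nN).
Qed.

(** The distance to the normalized sum S is |S| |e / a - 1|. Where |S| < A it tends to 0 almost
    surely, which is the form [tight_cvg0] requires. *)
Lemma mean_estimator_clt : converges_in_distribution P
  (fun M o => Num.sqrt M%:R * (mean_estimator phi w Z M o - m))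
  (centered_normal (\int[P]_o (Y 0%N o ^+ 2))).
Proof.
have mm n : measurable_fun setT
    (fun o => Num.sqrt n%:R * (mean_estimator phi w Z n o - m)).
  apply: measurable_funM => //; apply: measurable_funB => //.
  exact: measurable_mean_estimator.
apply: clt_slutsky => // a a0; apply: tight_cvg0 => [n|A A0].
  apply: measurable_norm_ge; apply: measurable_funB => //.
  exact: (measurable_normalized_sum _ iY).
have := evidence_estimator_cvg; apply: filterS => o ew.
have r1 : `|e / evidence_estimator w Z n o - 1| * A @[n --> \oo] --> (0 : R).
  rewrite [X in _ --> X](_ : 0 = `|e / e - 1| * A); last first.
    by rewrite divff// subrr normr0 mul0r.
  apply: cvgM; last exact: cvg_cst.
  apply: cvg_norm; apply: cvgB; last exact: cvg_cst.
  by apply: cvgM; [exact: cvg_cst|exact: cvgV].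
have near0 : \forall n \near \oo, evidence_estimator w Z n o != 0.
  exact: (cvgr_neq0 _ ew).
have near1 : \forall n \near \oo, `|e / evidence_estimator w Z n o - 1| * A < a.
  move/cvgrPdist_lt : r1 => /(_ _ a0); apply: filterS => n.
  by rewrite sub0r normrN ger0_norm// mulr_ge0// ltW.
apply: filterS2 near0 near1 => n an0 rn SA /=; apply/negP; rewrite -ltNge.
rewrite mean_estimator_error// -[X in _ - X]mulr1 -mulrBr normrM mulrC.
by apply: le_lt_trans rn; rewrite ler_wpM2l// ltW.
Qed.

(** Young's inequality 2 |x y| <= del x^2 + y^2 / del, read off the squares of del x + y and del x -
    y. The parameter makes the x^2 term as small as desired, at the expense of y^2. *)
Let sqrD_dist (x y del : R) : 0 < del ->
  `|(x + y) ^+ 2 - x ^+ 2| <= del * x ^+ 2 + (1 + del^-1) * y ^+ 2.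
Proof.
move=> del0; have d0 : del != 0 by rewrite gt_eqF.
have h1 : 0 <= del^-1 * (del * x + y) ^+ 2 by rewrite mulr_ge0 ?sqr_ge0// invr_ge0 ltW.
have h2 : 0 <= del^-1 * (del * x - y) ^+ 2 by rewrite mulr_ge0 ?sqr_ge0// invr_ge0 ltW.
have e1 : del^-1 * (del * x + y) ^+ 2 = del * x ^+ 2 + 2 * (x * y) + del^-1 * y ^+ 2 by field.
have e2 : del^-1 * (del * x - y) ^+ 2 = del * x ^+ 2 - 2 * (x * y) + del^-1 * y ^+ 2 by field.
have y2 : 0 <= y ^+ 2 by exact: sqr_ge0.
rewrite e1 in h1; rewrite e2 in h2.
have -> : (x + y) ^+ 2 - x ^+ 2 = 2 * (x * y) + y ^+ 2 by ring.
rewrite mulrDl mul1r ler_norml; apply/andP; split; lra.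
Qed.

(** Each summand is the square of (e / a) Y_i - D w_i / a, where D is the error of the mean. Since
    D^2 = S^2 (e / a)^2 / M, the factor 1/M joins the average of w^2 and forms [c], which tends to
    0. *)
Let variance_estimator_error M o (del : R) : 0 < del -> (0 < M)%N ->
  evidence_estimator w Z M o != 0 ->
  let a := evidence_estimator w Z M o in
  let b := M%:R^-1 * \sum_(i < M) Y i o ^+ 2 in
  let c := M%:R^-1 * (M%:R^-1 * \sum_(i < M) w (Z i o) ^+ 2) in
  (`|variance_estimator phi w Z M o - (e / a) ^+ 2 * b| <=
  del * ((e / a) ^+ 2 * b) +
  (1 + del^-1) * (normalized_sum Y M o ^+ 2 * ((e / a) ^+ 2 * (a ^- 2 * c))) : Prop).
Proof.
move=> del0 M0 an0 a b c.
have M0' : (M%:R : R) != 0 by rewrite pnatr_eq0 -lt0n.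
set D := mean_estimator phi w Z M o - m.
have D2 : D ^+ 2 = M%:R^-1 * (normalized_sum Y M o * (e / a)) ^+ 2.
  by rewrite -(mean_estimator_error an0) exprMn sqr_sqrtr// mulKf.
have -> : variance_estimator phi w Z M o =
    M%:R^-1 * \sum_(i < M) (e / a * Y i o + - (D * w (Z i o) / a)) ^+ 2.
  rewrite /variance_estimator invfM -mulrA; congr (_ * _).
  rewrite mulr_sumr; apply: eq_bigr => i _; rewrite /Y /yf /D.
  rewrite -/a; set mh := mean_estimator _ _ _ _ _.
  by field; rewrite an0 e0.
have -> : (e / a) ^+ 2 * b = M%:R^-1 * \sum_(i < M) (e / a * Y i o) ^+ 2.
  rewrite mulrCA mulr_sumr; congr (_ * _); apply: eq_bigr => i _.
  by rewrite !exprMn.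
rewrite -mulrBr -sumrB normrM ger0_norm ?invr_ge0//.
have -> : normalized_sum Y M o ^+ 2 * ((e / a) ^+ 2 * (a ^- 2 * c)) =
    M%:R^-1 * \sum_(i < M) (- (D * w (Z i o) / a)) ^+ 2.
  have -> : \sum_(i < M) (- (D * w (Z i o) / a)) ^+ 2 =
      D ^+ 2 / a ^+ 2 * \sum_(i < M) w (Z i o) ^+ 2.
    rewrite mulr_sumr; apply: eq_bigr => i _.
    by rewrite sqrrN; field.
  rewrite D2 /c !exprMn; ring.
rewrite (mulrCA del) (mulrCA (1 + _)) -mulrDr ler_wpM2l ?invr_ge0//.
rewrite !mulr_sumr -big_split/=; apply: le_trans (ler_norm_sum _ _ _) _.
by apply: ler_sum => i _; exact: sqrD_dist.
Qed.

Lemma variance_estimator_cvg :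
  converges_in_probability P (variance_estimator phi w Z)
    (\int[P]_o (Y 0%N o ^+ 2)).
Proof.
move=> a a0; set s2 : R := \int[P]_o (Y 0%N o ^+ 2).
have s20 : 0 <= s2 by apply: Rintegral_ge0 => o _; exact: sqr_ge0.
apply: tight_cvg0 => [n|A A0].
  apply: measurable_norm_ge; apply: measurable_funB => //.
  exact: measurable_variance_estimator.
(* The final bound tends to del s2, which this choice makes strictly less than [a], also when s2 =
   0. *)
pose del := a / (s2 + 1).
have s210 : 0 < s2 + 1 by rewrite ltr_wpDl.
have del0 : 0 < del by rewrite divr_gt0.
have dels2 : del * s2 < a by rewrite /del mulrAC ltr_pdivrMr// ltr_pM2l// ltrDl.
have [mY _ _] := iY.
have mY2 : measurable_fun setT (fun y : R => y ^+ 2) by exact: measurable_funX.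
have sY := strong_law_of_large_numbers (iid_comp iY mY2) int_Y2.
have mwn : measurable_fun setT (fun z => `|w z|) by exact: measurableT_comp.
have sw := strong_law_of_large_numbers (iid_comp iZ mwn) (integrable_abse int_w).
have se := evidence_estimator_cvg.
have : {ae P, forall o, [/\ evidence_estimator w Z M o @[M --> \oo] --> e,
   n%:R^-1 * \sum_(i < n) Y i o ^+ 2 @[n --> \oo] --> s2 &
   n%:R^-1 * (n%:R^-1 * \sum_(i < n) w (Z i o) ^+ 2) @[n --> \oo] --> (0 : R)]}.
  apply: filterS3 se sY sw => o h1 h2 h3; split=> //.
  rewrite (_ : (fun n => _) = fun n =>
      n%:R^-1 * (n%:R^-1 * \sum_(i < n) `|w (Z i o)| ^+ 2)); last first.
    apply/funext => n; congr (_ * (_ * _)); apply: eq_bigr => i _.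
    by rewrite real_normK ?num_real.
  by apply: (cvg_mean_sqr (x := fun i => `|w (Z i o)|)) h3 => n; exact: normr_ge0.
apply: filterS => o [ew cb cc].
pose r n := e / evidence_estimator w Z n o.
pose b n := n%:R^-1 * \sum_(i < n) Y i o ^+ 2.
pose c n := n%:R^-1 * (n%:R^-1 * \sum_(i < n) w (Z i o) ^+ 2).
(* The error bound with the squared normalized sum replaced by A^2: what remains converges at every
   point of an almost sure event. *)
pose u n := `|r n ^+ 2 * b n - s2| + (del * (r n ^+ 2 * b n) +
  (1 + del^-1) * (A ^+ 2 * (r n ^+ 2 * (evidence_estimator w Z n o ^- 2 * c n)))).
have cr : r n ^+ 2 @[n --> \oo] --> (1 : R).
  rewrite -[X in _ --> X](mulr1 1) -(divff e0).
  by apply: cvgM; apply: cvgM; try exact: cvg_cst; exact: cvgV.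
have crb : r n ^+ 2 * b n @[n --> \oo] --> s2.
  by rewrite -[X in _ --> X](mul1r s2); exact: cvgM.
have ci : evidence_estimator w Z n o ^- 2 @[n --> \oo] --> e ^- 2.
  by apply: cvgV; [rewrite expf_neq0|apply: cvgM].
have cu : u n @[n --> \oo] --> del * s2.
  rewrite (_ : del * s2 = `|s2 - s2| + (del * s2 +
    (1 + del^-1) * (A ^+ 2 * (1 * (e ^- 2 * 0))))); last first.
    by rewrite subrr normr0 !mulr0 addr0 add0r.
  apply: cvgD; first by apply: cvg_norm; apply: cvgB => //; exact: cvg_cst.
  apply: cvgD; first by apply: cvgM => //; exact: cvg_cst.
  apply: cvgM; first exact: cvg_cst.
  apply: cvgM; first exact: cvg_cst.
  by apply: cvgM => //; exact: cvgM.
have near0 : \forall n \near \oo, evidence_estimator w Z n o != 0.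
  exact: (cvgr_neq0 _ ew).
have near1 : \forall n \near \oo, u n < a by exact: (cvgr_lt _ cu).
have near2 : \forall n \near \oo, (0 < n)%N by exists 1%N.
apply: filterS3 near0 near1 near2 => n an0 un n0 SA /=; apply/negP; rewrite -ltNge.
apply: le_lt_trans un.
set V := variance_estimator _ _ _ _ _.
have -> : V - s2 = (r n ^+ 2 * b n - s2) + (V - r n ^+ 2 * b n) by ring.
apply: le_trans (ler_normD _ _) _; rewrite lerD2l.
apply: le_trans (variance_estimator_error del0 n0 an0) _; rewrite lerD2l.
rewrite ler_wpM2l ?addr_ge0 ?invr_ge0 ?(ltW del0)// ler_wpM2r//.
  rewrite mulr_ge0 ?sqr_ge0// mulr_ge0 ?invr_ge0 ?sqr_ge0//.
  by rewrite !mulr_ge0 ?invr_ge0// sumr_ge0// => i _; rewrite sqr_ge0.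
by rewrite -real_normK ?num_real// lerXn2r ?nnegrE// ltW.
Qed.

End mean_estimator_limit.

(** * Moments of the weights under the importance sample *)

Section weight_moments.
Context (R : realType) (dT dU dO : measure_display).
Context (Theta : measurableType dT) (U : measurableType dU).
Context (Omega : measurableType dO).
Variables (mu : {measure set Theta -> \bar R}) (prior g l : Theta -> R).
Variables (p : R.-pker Theta ~> U) (P : probability Omega R).
Variable lh : Theta * U -> R.
Variable Z : nat -> Omega -> Theta * U.
Hypotheses (dprior : density mu prior) (dg : density mu g).
Hypotheses (ml : measurable_fun setT l) (l0 : forall t, 0 <= l t).
Hypothesis evl : (0 < evidence mu prior l < +oo)%E.
Hypothesis mlh : measurable_fun setT lh.
Hypothesis lhE : forall t, (p t).-integrable setT (fun u => (lh (t, u))%:E) /\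
  (\int[p t]_u (lh (t, u))%:E = (l t)%:E)%E.
Hypothesis lpos : forall t, 0 < prior t -> 0 < g t -> 0 < l t.
Let pi := posterior mu prior l.
Hypothesis supp_pi : supp pi `<=` supp g.
Hypothesis sZ : iid_sample mu g p P Z.

Let w := weight prior g lh.
Let ev : R := fine (evidence mu prior l).

Lemma evidence_fine_gt0 : 0 < ev.
Proof. by move: evl => /andP[? ?]; rewrite fine_gt0//; apply/andP. Qed.
Let ev0 := evidence_fine_gt0.

Lemma integral_posterior : (\int[mu]_t (pi t)%:E = 1)%E.
Proof.
have [mp p0 _] := dprior.
under eq_integral do rewrite /pi /posterior mulrC EFinM.
rewrite ge0_integralZl//; last 3 first.
- by apply/measurable_EFinP; exact: measurable_funM.
- by move=> t _; rewrite lee_fin mulr_ge0.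
- by rewrite lee_fin invr_ge0 ltW.
have evfin : evidence mu prior l \is a fin_num.
  by move: evl => /andP[? ?]; rewrite ge0_fin_numE// ltW.
by rewrite -/(evidence mu prior l) -(fineK evfin) -/ev -EFinM mulVf// gt_eqF.
Qed.

Lemma measurable_weight : measurable_fun setT w.
Proof.
have [mp _ _] := dprior; have [mg _ _] := dg.
apply: measurable_funM; last first.
  by apply: measurable_invr; exact: (measurableT_comp mg).
by apply: measurable_funM => //; exact: (measurableT_comp mp).
Qed.

(** Measurability is asked of [A] only: [B], which will contain moments of xi with their division by
    the likelihood, inherits it as a multiple of [A]. *)
Let integral_eqZl (k : R) (A B : Theta -> \bar R) : 0 < k ->
  measurable_fun setT A -> (forall t, 0 <= A t)%E ->
  (forall t, A t = k%:E * B t)%E -> (\int[mu]_t A t = k%:E * \int[mu]_t B t)%E.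
Proof.
move=> k0 mA A0 AB.
have BA t : (B t = k^-1%:E * A t)%E.
  by rewrite AB muleA -EFinM mulVf ?gt_eqF// mul1e.
under [in RHS]eq_integral do rewrite BA.
by rewrite ge0_integralZl_EFin ?invr_ge0 ?(ltW k0)// muleA -EFinM divff ?gt_eqF// mul1e.
Qed.

(** Where g vanishes pi does too, by the inclusion of supports; where the prior vanishes both sides
    are 0; elsewhere [lpos] makes the division by the likelihood legitimate. *)
Let weight_coef t : g t * (prior t / g t) = ev * ((l t)^-1 * pi t).
Proof.
have [_ p0 _] := dprior; have [_ g0 _] := dg.
have [gt0|gt0] := eqVneq (g t) 0.
  rewrite gt0 mul0r (_ : pi t = 0) ?mulr0//.
  by apply: contrapT => /eqP/supp_pi; rewrite /supp/= gt0 eqxx.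
rewrite [LHS]mulrC divfK// /pi /posterior.
have [->|pt0] := eqVneq (prior t) 0; first by rewrite mulr0 mul0r !mulr0.
have lt0 : l t != 0 by rewrite gt_eqF// lpos// lt0r ?p0 ?g0 ?pt0 ?gt0.
have ev1 : ev != 0 by rewrite gt_eqF.
by rewrite -/ev; field; rewrite lt0 ev1.
Qed.

Let msec (f : Theta * U -> R) t : measurable_fun setT f ->
  measurable_fun setT (fun u => f (t, u)).
Proof. by move=> mf; exact: (measurableT_comp mf (pair1_measurable t)). Qed.

Lemma weight_abs_moment (c : Theta -> R) : measurable_fun setT c ->
  (forall t, 0 <= c t) ->
  (\int[P]_o (c (Z 0%N o).1 * `|w (Z 0%N o)|)%:E =
   ev%:E * \int[mu]_t (xi_abs l p lh t * (c t * pi t)%:E))%E.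
Proof.
move=> mc c0; have [_ p0 _] := dprior; have [mg g0 _] := dg.
have mf : measurable_fun setT (fun z => (c z.1 * `|w z|)%:E).
  apply/measurable_EFinP; apply: measurable_funM.
    exact: (measurableT_comp mc).
  by apply: measurableT_comp => //; exact: measurable_weight.
have f0 z : (0 <= (c z.1 * `|w z|)%:E)%E by rewrite lee_fin mulr_ge0.
rewrite (sample_integral dg sZ mf f0); apply: integral_eqZl => //.
- apply: emeasurable_funM; first exact/measurable_EFinP.
  exact: (measurable_kernel_integral p mf).
- by move=> t; rewrite mule_ge0 ?lee_fin// integral_ge0.
move=> t; rewrite /xi_abs.
have mL : measurable_fun setT (fun u => `|lh (t, u)|%:E).
  by apply/measurable_EFinP; apply: measurableT_comp => //; exact: msec.
under eq_integral => u _.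
  rewrite /w /weight -mulrA normrM (ger0_norm (divr_ge0 (p0 t) (g0 t)))/=.
  rewrite mulrCA mulrC EFinM; over.
rewrite ge0_integralZl_EFin ?mulr_ge0 ?invr_ge0//.
under [in RHS]eq_integral => u _.
  rewrite /xi normrM normfV (ger0_norm (l0 t)) mulrC EFinM; over.
rewrite ge0_integralZl_EFin ?invr_ge0//.
rewrite [in RHS]muleAC !muleA -!EFinM; congr (_%:E * _)%E.
by rewrite mulrCA weight_coef; ring.
Qed.

Lemma weight_sqr_moment (c : Theta -> R) : measurable_fun setT c ->
  (forall t, 0 <= c t) ->
  (\int[P]_o (c (Z 0%N o).1 * w (Z 0%N o) ^+ 2)%:E =
   (ev ^+ 2)%:E * expectation_of mu g (fun t =>
     (pi t ^+ 2 / g t ^+ 2 * c t)%:E * xi_moment2 l p lh t))%E.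
Proof.
move=> mc c0; have [_ p0 _] := dprior; have [mg g0 _] := dg.
have mf : measurable_fun setT (fun z => (c z.1 * w z ^+ 2)%:E).
  apply/measurable_EFinP; apply: measurable_funM.
    exact: (measurableT_comp mc).
  by apply: measurable_funX; exact: measurable_weight.
have f0 z : (0 <= (c z.1 * w z ^+ 2)%:E)%E by rewrite lee_fin mulr_ge0 ?sqr_ge0.
rewrite (sample_integral dg sZ mf f0).
apply: integral_eqZl; first by rewrite exprn_gt0.
- apply: emeasurable_funM; first exact/measurable_EFinP.
  exact: (measurable_kernel_integral p mf).
- by move=> t; rewrite mule_ge0 ?lee_fin// integral_ge0.
move=> t; rewrite /xi_moment2.
have mL : measurable_fun setT (fun u => (lh (t, u) ^+ 2)%:E).
  by apply/measurable_EFinP; apply: measurable_funX; exact: msec.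
under eq_integral => u _.
  rewrite /w /weight -mulrA exprMn/= mulrCA mulrC EFinM; over.
rewrite ge0_integralZl_EFin ?mulr_ge0 ?sqr_ge0 ?invr_ge0//; last first.
  by move=> u _; rewrite lee_fin sqr_ge0.
under [in RHS]eq_integral => u _.
  rewrite /xi exprMn mulrC EFinM; over.
rewrite ge0_integralZl_EFin ?sqr_ge0//; last first.
  by move=> u _; rewrite lee_fin sqr_ge0.
rewrite [in RHS]muleAC !muleA -!EFinM; congr (_%:E * _)%E.
have [gt0|gt0] := eqVneq (g t) 0; first by rewrite gt0 !mul0r !mulr0 !mul0r.
rewrite (_ : g t * _ = c t * (g t * (prior t / g t)) ^+ 2 / g t); last by field.
by rewrite weight_coef; move: (l t)^-1 => li; field.
Qed.

(** Integrating out u replaces the estimator by the likelihood, which cancels the inverse likelihood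
    in [weight_coef]; where the likelihood is 0 the posterior factor is 0 as well. *)
Lemma weight_mean (c : Theta -> R) : measurable_fun setT c ->
  P.-integrable setT (fun o => (c (Z 0%N o).1 * w (Z 0%N o))%:E) ->
  \int[P]_o (c (Z 0%N o).1 * w (Z 0%N o)) = ev * \int[mu]_t (c t * pi t).
Proof.
move=> mc iP; have [_ p0 _] := dprior; have [mg g0 _] := dg.
have mf : measurable_fun setT (fun z => c z.1 * w z).
  apply: measurable_funM; first exact: (measurableT_comp mc).
  exact: measurable_weight.
have fE t u : c t * w (t, u) = c t * (prior t / g t) * lh (t, u).
  by rewrite /w /weight/=; ring.
have intf t : (p t).-integrable setT (fun u => (c t * w (t, u))%:E).
  have [ilh _] := lhE t.
  by under eq_fun do rewrite fE EFinM; exact: integrableZl.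
have [jI ->] := sample_Rintegral dg sZ mf intf iP.
have gE t : g t * \int[p t]_u (c t * w (t, u)) = ev * (c t * pi t).
  have [ilh elh] := lhE t.
  under eq_Rintegral do rewrite fE.
  rewrite RintegralZl//= [X in _ * (_ * X)](_ : _ = l t); last first.
    by rewrite /Rintegral elh.
  rewrite (_ : g t * _ = c t * l t * (g t * (prior t / g t))); last by ring.
  rewrite weight_coef.
  have [lt0|lt0] := eqVneq (l t) 0; last by field.
  by rewrite /pi /posterior lt0 !mul0r !mulr0 ?mul0r.
have kI : mu.-integrable setT (fun t => (c t * pi t)%:E).
  have ev1 : ev != 0 by rewrite gt_eqF.
  under eq_fun do rewrite -[c _ * _](mulKf ev1) -gE EFinM.
  exact: integrableZl.
by under eq_Rintegral do rewrite gE; rewrite RintegralZl.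
Qed.

Variable phi : Theta -> R.
Hypothesis mphi : measurable_fun setT phi.
Hypothesis int_xi : (\int[mu]_t (xi_abs l p lh t * (pi t)%:E) < +oo)%E.

Let m := posterior_mean mu prior l phi.
Let iZ : iid P Z := iid_sample_iid sZ.
Let mw := measurable_weight.
Let ev1 : ev != 0. Proof. by rewrite gt_eqF. Qed.

Let mcZ (c : Theta -> R) : measurable_fun setT c ->
  measurable_fun setT (fun o => c (Z 0%N o).1 * w (Z 0%N o)).
Proof.
have [mZ _ _] := sZ => mc; apply: measurable_funM.
  by apply: (measurableT_comp mc); exact: measurableT_comp.
exact: (measurableT_comp mw).
Qed.

Let int_cw (c : Theta -> R) : measurable_fun setT c ->
  (\int[mu]_t (xi_abs l p lh t * (`|c t| * pi t)%:E) < +oo)%E ->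
  P.-integrable setT (fun o => (c (Z 0%N o).1 * w (Z 0%N o))%:E).
Proof.
move=> mc cfin; apply/integrableP; split.
  by apply/measurable_EFinP; exact: mcZ.
under eq_integral do rewrite abse_EFin normrM.
rewrite (weight_abs_moment (c := fun t => `|c t|))//; last exact: measurableT_comp.
by rewrite lte_mul_pinfty// lee_fin ltW.
Qed.

Lemma integrable_weight : P.-integrable setT (fun o => (w (Z 0%N o))%:E).
Proof.
under eq_fun do rewrite -[w _]mul1r.
apply: (int_cw (c := fun=> 1)) => //.
by under eq_integral do rewrite normr1 mul1r.
Qed.

Lemma Rintegral_weight : \int[P]_o w (Z 0%N o) = ev.
Proof.
under eq_Rintegral do rewrite -[w _]mul1r.
rewrite (weight_mean (c := fun=> 1))//; last first.
  by under eq_fun do rewrite mul1r; exact: integrable_weight.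
under eq_Rintegral do rewrite mul1r.
by rewrite [X in _ * X](_ : _ = 1) ?mulr1// /Rintegral integral_posterior.
Qed.

Lemma mean_estimator_consistent :
  (\int[mu]_t (xi_abs l p lh t * (`|phi t| * pi t)%:E) < +oo)%E ->
  {ae P, forall o, mean_estimator phi w Z M o @[M --> \oo] --> m}.
Proof.
move=> fin_phi; apply: (@mean_estimator_cvg _ _ _ _ _ _ _ P phi w Z ev) => //.
- exact: integrable_weight.
- exact: Rintegral_weight.
- exact: int_cw.
- by rewrite weight_mean//; exact: int_cw.
Qed.

Let yf (z : Theta * U) := (phi z.1 - m) * w z / ev.
Let sigma2 := asymptotic_variance mu prior l p lh g phi.
Hypothesis sigma2_fin : (sigma2 < +oo)%E.

Let sqr_moment : P.-integrable setT (fun o => (yf (Z 0%N o) ^+ 2)%:E) /\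
  \int[P]_o (yf (Z 0%N o) ^+ 2) = fine sigma2.
Proof.
have [mZ _ _] := sZ.
have mdev : measurable_fun setT (fun t => (phi t - m) ^+ 2).
  by apply: measurable_funX; exact: measurable_funB.
have myf : measurable_fun setT (fun o => yf (Z 0%N o)).
  apply: measurable_funM => //.
  by apply: (mcZ (c := fun t => phi t - m)); exact: measurable_funB.
have E : (\int[P]_o (yf (Z 0%N o) ^+ 2)%:E = sigma2)%E.
  have := weight_sqr_moment mdev (fun t => sqr_ge0 _); rewrite -/sigma2.
  have yE o : yf (Z 0%N o) ^+ 2 =
      ev ^- 2 * ((phi (Z 0%N o).1 - m) ^+ 2 * w (Z 0%N o) ^+ 2).
    by rewrite /yf; field.
  under [in X in _ -> X]eq_integral do rewrite yE EFinM.
  rewrite ge0_integralZl_EFin ?invr_ge0 ?sqr_ge0//; last 2 first.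
  - by move=> o _; rewrite lee_fin mulr_ge0 ?sqr_ge0.
  - apply/measurable_EFinP; apply: measurable_funM.
      by apply: (measurableT_comp mdev); exact: measurableT_comp.
    by apply: measurable_funX; exact: (measurableT_comp mw).
  by move=> ->; rewrite muleA -EFinM mulVf ?mul1e// expf_neq0.
split; last by rewrite /Rintegral E.
apply/integrableP; split.
  by apply/measurable_EFinP; exact: measurable_funX.
by under eq_integral do rewrite gee0_abs ?lee_fin ?sqr_ge0//; rewrite E.
Qed.

(** Finite sigma2 makes Y square integrable, so phi w = ev Y + m w is integrable and [weight_mean]
    gives it the mean ev m. The term m w has the same mean, which leaves 0 for Y. *)
Let mean_yf : \int[P]_o yf (Z 0%N o) = 0.
Proof.
have [mZ _ _] := sZ; have [sqri _] := sqr_moment.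
have myf : measurable_fun setT (fun o => yf (Z 0%N o)).
  apply: measurable_funM => //.
  by apply: (mcZ (c := fun t => phi t - m)); exact: measurable_funB.
have iyf := integrable_sqr myf sqri.
have iw := integrable_weight.
have E o : phi (Z 0%N o).1 * w (Z 0%N o) = ev * yf (Z 0%N o) + m * w (Z 0%N o).
  by rewrite /yf; field.
have iphi : P.-integrable setT (fun o => (phi (Z 0%N o).1 * w (Z 0%N o))%:E).
  under eq_fun do rewrite E EFinD.
  by apply: integrableD => //; exact: integrable_scale.
have := weight_mean mphi iphi; rewrite -/m.
under eq_Rintegral do rewrite E.
rewrite RintegralD//; [|exact: integrable_scale..].
rewrite !RintegralZl// Rintegral_weight => h.
by apply: (mulfI ev1); apply: (addIr (m * ev)); rewrite h mulr0 add0r mulrC.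
Qed.

Lemma mean_estimator_normal :
  converges_in_distribution P
    (fun M o => Num.sqrt M%:R * (mean_estimator phi w Z M o - m))
    (centered_normal (fine sigma2)).
Proof.
have [sqri <-] := sqr_moment.
apply: mean_estimator_clt => //.
- exact: integrable_weight.
- exact: Rintegral_weight.
Qed.

Lemma variance_estimator_consistent :
  converges_in_probability P (variance_estimator phi w Z) (fine sigma2).
Proof.
have [sqri <-] := sqr_moment.
apply: variance_estimator_cvg => //.
- exact: integrable_weight.
- exact: Rintegral_weight.
Qed.

End weight_moments.

(** * The exact likelihood as an estimator constant in u *)

Section exact_likelihood.
Context (R : realType) (dT dU : measure_display).
Context (Theta : measurableType dT) (U : measurableType dU).
Variables (mu : {measure set Theta -> \bar R}) (prior g phi l : Theta -> R).
Variable p : R.-pker Theta ~> U.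

Let lx (v : Theta * U) := l v.1.

Let xi_exact t u : l t != 0 -> xi l lx t u = 1.
Proof. by move=> lt0; rewrite /xi /lx/= divff. Qed.

(** Where the likelihood vanishes the quotient xi is 0 instead of 1, but the posterior factor is 0
    there. *)
Lemma xi_abs_exact t : (xi_abs l p lx t * (posterior mu prior l t)%:E =
  (posterior mu prior l t)%:E)%E.
Proof.
have [lt0|lt0] := eqVneq (l t) 0.
  by rewrite /posterior lt0 !mul0r mule0.
rewrite /xi_abs; under eq_integral do rewrite xi_exact// normr1.
by rewrite integral_cst//= mul1e prob_kernel mul1e.
Qed.

Lemma asymptotic_variance_exact :
  asymptotic_variance mu prior l p lx g phi = noiseless_variance mu prior l g phi.
Proof.
apply: eq_integral => t _; congr (_ * _)%E.
have [lt0|lt0] := eqVneq (l t) 0.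
  by rewrite /posterior lt0 !mul0r expr0n/= !mul0r mul0e.
rewrite /xi_moment2; under eq_integral do rewrite xi_exact// expr1n.
by rewrite integral_cst//= mul1e prob_kernel mule1.
Qed.

End exact_likelihood.

Theorem theorem2 (R : realType) (d : nat) (dT dU dO : measure_display)
    (Theta : measurableType dT) (U : measurableType dU)
    (Omega : measurableType dO)
    (mu : {sigma_finite_measure set Theta -> \bar R})
    (prior gIS phi : Theta -> R)
    (lik : Theta -> d.-tuple R -> R) (sobs : d.-tuple R)
    (D : design R d) (p : R.-pker Theta ~> U)
    (S : 'I_(nrep D) -> nat -> nat -> Theta * U -> d.-tuple R)
    (T : 'I_(nrep D) -> Theta * U -> nat)
    (P : probability Omega R) (Z : nat -> Omega -> Theta * U) :
  let l := fun t => lik t sobs in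
  let lh := likelihood_estimator sobs S T in
  let pi := posterior mu prior l in
  let m := posterior_mean mu prior l phi in
  let sigma2 := asymptotic_variance mu prior l p lh gIS phi in
  let sigma2_exact := noiseless_variance mu prior l gIS phi in
  let E_IS := expectation_of mu gIS in
  let Exi2 := xi_moment2 l p lh in
  let Eabsxi := xi_abs l p lh in
  let w := weight prior gIS lh in
  let w_exact := weight prior gIS (fun v : Theta * U => l v.1) in
  (0 < d)%N ->
  density mu prior ->
  density mu gIS ->
  measurable_fun setT phi ->
  (forall t, density (lebesgue_tuple d) (lik t)) ->
  (forall t, twice_differentiable (lik t)) ->
  measurable_fun setT l ->
  (0 < evidence mu prior l < +oo)%E ->
  admissible D ->
  (forall r k i, measurable_fun setT (S r k i)) ->
  (forall r, measurable_fun setT (T r)) ->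
  (forall t r, simulation D sobs (p t) (lik t)
     (fun k i u => S r k i (t, u)) (fun u => T r (t, u))) ->
  (forall t, mutually_independent (p t) (fun r : 'I_(nrep D) =>
     sigma_of (fun u => debiased D
       (zeta D sobs (fun k i => S r k i (t, u))) (T r (t, u))))) ->
  (forall t, (p t).-integrable setT (fun u => (lh (t, u))%:E) /\
     (\int[p t]_u (lh (t, u))%:E = (l t)%:E)%E) ->
  (* xi is well defined wherever the weight does not vanish *)
  (forall t, 0 < prior t -> 0 < gIS t -> 0 < l t) ->
  supp pi `<=` supp gIS ->
  iid_sample mu gIS p P Z ->
  (* the weights, which may be negative, have a finite mean *)
  (\int[mu]_t (Eabsxi t * (pi t)%:E) < +oo)%E ->
  [/\ (* (i) *)
      (\int[mu]_t (`|phi t| * pi t)%:E < +oo)%E ->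
      (\int[mu]_t (Eabsxi t * (`|phi t| * pi t)%:E) < +oo)%E ->
      {ae P, forall o, mean_estimator phi w Z M o @[M --> \oo] --> m},
      (* (ii) *)
      (E_IS (fun t => Exi2 t * (phi t ^+ 2 * pi t ^+ 2 / gIS t ^+ 2)%:E)
        < +oo)%E ->
      (sigma2 < +oo)%E ->
      converges_in_distribution P
        (fun M o => Num.sqrt M%:R * (mean_estimator phi w Z M o - m))
        (centered_normal (fine sigma2)),
      (* (ii), exact likelihood *)
      asymptotic_variance mu prior l p (fun v : Theta * U => l v.1) gIS phi
        = sigma2_exact /\
      ((E_IS (fun t => (phi t ^+ 2 * pi t ^+ 2 / gIS t ^+ 2)%:E) < +oo)%E ->
       (sigma2_exact < +oo)%E ->
       converges_in_distribution P
         (fun M o => Num.sqrt M%:R * (mean_estimator phi w_exact Z M o - m))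
         (centered_normal (fine sigma2_exact))) &
      (* (iii) *)
      (\int[mu]_t (`|phi t| * pi t)%:E < +oo)%E ->
      (sigma2 < +oo)%E ->
      converges_in_probability P (variance_estimator phi w Z) (fine sigma2)].
Proof.
move=> l lh pi m sigma2 sigma2_exact E_IS Exi2 Eabsxi w w_exact.
move=> _ dprior dg mphi dlik _ ml evl admD mS mT _ _ lhE lpos supp_pi sZ int_xi.
have l0 t : 0 <= l t by have [_ + _] := dlik t; apply.
have mlh : measurable_fun setT lh.
  by apply: measurable_likelihood_estimator => //; have [[[]]] := admD.
have mlx : measurable_fun setT (fun v : Theta * U => l v.1).
  exact: measurableT_comp.
(* The exact likelihood is itself an unbiased estimator, so the noiseless central limit theorem is
   the general one applied to it. *)
have lxE t : (p t).-integrable setT (fun u => (l (t, u).1)%:E) /\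
    (\int[p t]_u (l (t, u).1)%:E = (l t)%:E)%E.
  split; last by rewrite /= integral_cst//= prob_kernel mule1.
  apply/integrableP; split; first exact: (measurable_cst (l t)%:E).
  by under eq_integral do rewrite abse_EFin/=; rewrite integral_cst//= prob_kernel mule1 ltry.
(* With xi = 1 the finite-mean condition on the weights reduces to the posterior having mass 1. *)
have int_xi_exact : (\int[mu]_t (xi_abs l p (fun v : Theta * U => l v.1) t *
    (posterior mu prior l t)%:E) < +oo)%E.
  under eq_integral do rewrite xi_abs_exact.
  by rewrite integral_posterior// ltry.
split.
- move=> _ int_phi.
  exact: (mean_estimator_consistent dprior dg ml l0 evl mlh lhE lpos supp_pi sZ).
- move=> _ sigma2_fin.
  exact: (mean_estimator_normal dprior dg ml l0 evl mlh lhE lpos supp_pi sZ).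
- have e := @asymptotic_variance_exact R dT dU Theta U mu prior gIS phi l p.
  split=> // _; rewrite /sigma2_exact -e => sigma2_fin.
  exact: (mean_estimator_normal dprior dg ml l0 evl mlx lxE lpos supp_pi sZ).
- move=> _ sigma2_fin.
  exact: (variance_estimator_consistent dprior dg ml l0 evl mlh lhE lpos supp_pi sZ).
Qed.
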